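(* Let $n\ge 1$ and let $\mathcal{A}_n=Q_1\cup\cdots\cup Q_n\subset\mathbb{P}^2$ be a union of $n$ distinct quadrics which are tangent to each other at two common points. Then there are meridians $a_1,\dots,a_n$ of $Q_1,\dots,Q_n$ respectively such that $\pi_1(\mathbb{P}^2\setminus\mathcal{A}_n)$ is generated by $a_1,\dots,a_n$ and admits the presentation $$\pi_1(\mathbb{P}^2\setminus \mathcal{A}_n)\simeq\big\langle a_1,a_2,\dots,a_n \;\big|\; (a_1a_2\cdots a_n)^2=e\big\rangle .$$
   Context: $\mathbb{P}^2$ is the complex projective plane. A quadric is a smooth conic (smooth plane curve of degree 2) in $\mathbb{P}^2$. ''Tangent to each other at two common points'' means that there are two distinct points $p,q\in\mathbb{P}^2$ lying on all the $Q_i$ such that any two distinct $Q_i,Q_j$ are tangent at $p$ and at $q$. For $n=1$, $\mathcal{A}_1$ is a single smooth conic. A meridian of an irreducible component $B$ of a curve $C\subset\mathbb{P}^2$, based at $*\in\mathbb{P}^2\setminus C$, is (the homotopy class of) a loop which follows a path $\omega$ in $\mathbb{P}^2\setminus C$ from $*$ to a point near a point $p\in B\setminus \mathrm{Sing}(C)$, turns once in the positive sense along the boundary of a small disc that meets $C$ only at $p$ and transversally, and returns to $*$ along $\omega^{-1}$. *)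

(* Defs.v *)
From HB Require Import structures.
From mathcomp Require Import all_boot all_order all_algebra generic_quotient.
From mathcomp Require Import complex.
From mathcomp Require mpoly.
(* The notations of mpoly clash with those of the analysis library. *)
Import (canonicals, coercions) mpoly.
From mathcomp Require Import all_classical all_reals all_analysis homotopy.
From mathcomp Require Import lra.

Set Implicit Arguments.
Unset Strict Implicit.
Unset Printing Implicit Defensive.

Import Order.TTheory GRing.Theory Num.Theory.
Import numFieldNormedType.Exports.

Local Open Scope classical_set_scope.
Local Open Scope ring_scope.
Local Open Scope quotient_scope.

Section UnitInterval.
Variable R : realType.

Definition I01 : Type := set_type `[0, 1 : R]%classic.

HB.instance Definition _ :=
  Topological.copy I01 (set_type `[0, 1 : R]%classic).

Lemma clamp_subproof (t : R) :
  Num.max 0 (Num.min 1 t) \in `[0, 1 : R]%classic.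
Proof.
apply/mem_set => /=; rewrite in_itv /= le_max lexx /= ge_max ler01 /=.
by rewrite ge_min lexx.
Qed.

Definition clamp (t : R) : I01 :=
  @exist R (fun x => x \in `[0, 1]%classic) _ (clamp_subproof t).

Definition I01_val (t : I01) : R := \val t.

Lemma I01_ge0 (t : I01) : 0 <= I01_val t.
Proof. by case: t => t; rewrite /I01_val /= => /set_mem /=; rewrite in_itv => /andP[]. Qed.

Lemma I01_le1 (t : I01) : I01_val t <= 1.
Proof. by case: t => t; rewrite /I01_val /= => /set_mem /=; rewrite in_itv => /andP[]. Qed.

Lemma clamp_val (t : I01) : clamp (I01_val t) = t.
Proof.
apply/val_inj; rewrite /= (min_idPr (I01_le1 t)); exact/max_idPr/I01_ge0.
Qed.

Lemma val_clamp (t : R) : 0 <= t -> t <= 1 -> I01_val (clamp t) = t.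
Proof. by move=> t0 t1; rewrite /I01_val /= (min_idPr t1) (max_idPr t0). Qed.

Lemma clamp_le0 (t : R) : t <= 0 -> clamp t = clamp 0.
Proof.
move=> t0; apply/val_inj => /=.
by rewrite (min_idPr ler01) (min_idPr (le_trans t0 ler01)) maxxx; apply/max_idPl.
Qed.

Lemma clamp_ge1 (t : R) : 1 <= t -> clamp t = clamp 1.
Proof. by move=> t1; apply/val_inj => /=; rewrite minxx (min_idPl t1). Qed.

Lemma clamp01 : clamp 0 != clamp 1.
Proof.
apply/eqP => /(congr1 I01_val); rewrite !val_clamp//.
by move/esym/eqP; rewrite oner_eq0.
Qed.

HB.instance Definition _ := @isBiPointed.Build I01 (clamp 0) (clamp 1) clamp01.

Lemma I01_val_continuous : continuous I01_val.
Proof. exact: initial_continuous. Qed.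

Lemma clamp_continuous : continuous clamp.
Proof.
apply: continuous_comp_initial => t /=.
have c0 : {for t, continuous (fun _ : R => 0 : R^o)} by exact: cvg_cst.
apply: continuous_max; first exact: cvg_cst.
by apply: continuous_min; [exact: cvg_cst|exact: cvg_id].
Qed.

End UnitInterval.

Section Glue.
Variables (R : realType) (T X : topologicalType).

Lemma continuous_glue (h : T -> R) (a : R) (f g : T -> X) :
  continuous h -> continuous f -> continuous g ->
  (forall t, h t = a -> f t = g t) ->
  continuous (fun t => if h t <= a then f t else g t).
Proof.
move=> hc fc gc fg; apply/continuous_closedP => A cA.
rewrite (_ : _ @^-1` A = (h @^-1` [set x | x <= a] `&` f @^-1` A) `|`
                         (h @^-1` [set x | a <= x] `&` g @^-1` A)).
  have /continuous_closedP hcl := hc.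
  have /continuous_closedP fcl := fc.
  have /continuous_closedP gcl := gc.
  apply: closedU; apply: closedI; try exact: fcl; try exact: gcl; apply: hcl.
    exact: closed_le.
  exact: closed_ge.
apply/seteqP; split=> t /=.
  by case: leP => [hta|/ltW hta] At; [left|right].
case=> [[-> //]|[hta At]].
by case: leP => // hta'; rewrite fg //; apply/eqP; rewrite eq_le hta hta'.
Qed.

End Glue.

Section ContinuityHelpers.
Variables (R : realType) (T : topologicalType).

Lemma continuous_cst (X : topologicalType) (a : X) : continuous (fun _ : T => a).
Proof. by move=> t; exact: cvg_cst. Qed.

Lemma continuous_circ (X Y : topologicalType) (f : T -> X) (g : X -> Y) :
  continuous f -> continuous g -> continuous (fun t => g (f t)).
Proof. by move=> fc gc t; apply: continuous_comp; [exact: fc|exact: gc]. Qed.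

Lemma continuous_couple (X Y : topologicalType) (f : T -> X) (g : T -> Y) :
  continuous f -> continuous g -> continuous (fun t => (f t, g t)).
Proof. by move=> fc gc t; exact: (cvg_pair (fc t) (gc t)). Qed.

Lemma continuous_add (f g : T -> R) :
  continuous f -> continuous g -> continuous (fun t => f t + g t).
Proof. by move=> fc gc t; exact: (cvgD (fc t) (gc t)). Qed.

Lemma continuous_sub (f g : T -> R) :
  continuous f -> continuous g -> continuous (fun t => f t - g t).
Proof. by move=> fc gc t; exact: (cvgB (fc t) (gc t)). Qed.

Lemma continuous_mul (f g : T -> R) :
  continuous f -> continuous g -> continuous (fun t => f t * g t).
Proof. by move=> fc gc t; exact: (cvgM (fc t) (gc t)). Qed.

Lemma continuous_minr (f g : T -> R) :
  continuous f -> continuous g -> continuous (fun t => Num.min (f t) (g t)).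
Proof. by move=> fc gc t; apply: continuous_min; [exact: fc|exact: gc]. Qed.

Lemma continuous_maxr (f g : T -> R) :
  continuous f -> continuous g -> continuous (fun t => Num.max (f t) (g t)).
Proof. by move=> fc gc t; apply: continuous_max; [exact: fc|exact: gc]. Qed.

End ContinuityHelpers.

Lemma continuous_id (T : topologicalType) : continuous (fun t : T => t).
Proof. by move=> t; exact: cvg_id. Qed.

Lemma continuous_fst (S T : topologicalType) : continuous (@fst S T).
Proof. by move=> t; exact: cvg_fst. Qed.

Lemma continuous_snd (S T : topologicalType) : continuous (@snd S T).
Proof. by move=> t; exact: cvg_snd. Qed.

Lemma continuous_affine (R : realType) (a b : R) :
  continuous (fun t : R => a * t + b).
Proof.
apply: continuous_add; last exact: continuous_cst.
by apply: continuous_mul; [exact: continuous_cst|exact: continuous_id].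
Qed.

Section PathHomotopy.
Variables (R : realType) (X : topologicalType).
Local Notation I := (I01 R).
Implicit Types x y z : X.

Definition path_homotopic x y (p q : {path I from x to y in X}) : Prop :=
  exists H : I * I -> X,
  [/\ continuous H,
      forall t, H (t, zero) = p t,
      forall t, H (t, one) = q t &
      forall s, H (zero, s) = x /\ H (one, s) = y].

Lemma fst_val_continuous : continuous (fun u : I * I => I01_val u.1).
Proof.
exact: (continuous_circ (@continuous_fst _ _) (@I01_val_continuous R)).
Qed.

Lemma snd_val_continuous : continuous (fun u : I * I => I01_val u.2).
Proof.
exact: (continuous_circ (@continuous_snd _ _) (@I01_val_continuous R)).
Qed.

Lemma path_homotopic_refl x y (p : {path I from x to y in X}) :
  path_homotopic p p.
Proof.
exists (fun u => p u.1); split=> //.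
- exact: (continuous_circ (@continuous_fst _ _) cts_fun).
- by move=> s; rewrite path_zero path_one.
Qed.

Lemma path_homotopic_eq x y (p q : {path I from x to y in X}) :
  p =1 q -> path_homotopic p q.
Proof. by move/path_eqP => ->; exact: path_homotopic_refl. Qed.

Definition I01_rev (t : I) : I := clamp (1 - I01_val t).

Lemma I01_rev_continuous : continuous I01_rev.
Proof.
apply: (@continuous_circ _ _ _ (fun t : I => 1 - I01_val t : R)).
  by apply: continuous_sub; [exact: continuous_cst|exact: I01_val_continuous].
exact: clamp_continuous.
Qed.

Lemma I01_rev0 : I01_rev zero = one.
Proof. by rewrite /I01_rev val_clamp // subr0. Qed.

Lemma I01_rev1 : I01_rev one = zero.
Proof. by rewrite /I01_rev val_clamp // subrr. Qed.

Lemma path_homotopic_sym x y (p q : {path I from x to y in X}) :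
  path_homotopic p q -> path_homotopic q p.
Proof.
case=> H [Hc H0 H1 H01]; exists (fun u => H (u.1, I01_rev u.2)); split.
- apply: (@continuous_circ _ _ _ (fun u : I * I => (u.1, I01_rev u.2)) H) => //.
  apply: continuous_couple; first exact: continuous_fst.
  exact: (continuous_circ (@continuous_snd _ _) I01_rev_continuous).
- by move=> t; rewrite /= I01_rev0.
- by move=> t; rewrite /= I01_rev1.
- by move=> s; exact: H01.
Qed.

Definition I01_fst (t : I) : I := clamp (2 * I01_val t).
Definition I01_snd (t : I) : I := clamp (2 * I01_val t - 1).

Lemma I01_fst_continuous : continuous I01_fst.
Proof.
apply: (@continuous_circ _ _ _ (fun t : I => 2 * I01_val t : R)).
  by apply: continuous_mul; [exact: continuous_cst|exact: I01_val_continuous].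
exact: clamp_continuous.
Qed.

Lemma I01_snd_continuous : continuous I01_snd.
Proof.
apply: (@continuous_circ _ _ _ (fun t : I => 2 * I01_val t - 1 : R)).
  apply: continuous_sub; last exact: continuous_cst.
  by apply: continuous_mul; [exact: continuous_cst|exact: I01_val_continuous].
exact: clamp_continuous.
Qed.

Lemma I01_fst_half t : I01_val t = 2^-1 -> I01_fst t = one.
Proof. by move=> th; rewrite /I01_fst th mulfV// pnatr_eq0. Qed.

Lemma I01_snd_half t : I01_val t = 2^-1 -> I01_snd t = zero.
Proof. by move=> th; rewrite /I01_snd th mulfV ?pnatr_eq0// subrr. Qed.

Lemma I01_fst0 : I01_fst zero = zero.
Proof. by rewrite /I01_fst val_clamp // mulr0. Qed.

Lemma I01_snd1 : I01_snd one = one.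
Proof. by rewrite /I01_snd val_clamp //; congr clamp; lra. Qed.

Lemma I01_zero_half : I01_val (zero : I) <= 2^-1.
Proof. by rewrite val_clamp //; lra. Qed.

Lemma I01_one_half : (I01_val (one : I) <= 2^-1) = false.
Proof. by rewrite val_clamp //; apply/negbTE; rewrite -ltNge; lra. Qed.

Lemma path_homotopic_trans x y (p q r : {path I from x to y in X}) :
  path_homotopic p q -> path_homotopic q r -> path_homotopic p r.
Proof.
case=> H [Hc H0 H1 H01] [K [Kc K0 K1 K01]].
exists (fun u => if I01_val u.2 <= 2^-1 then H (u.1, I01_fst u.2)
                 else K (u.1, I01_snd u.2)); split.
- apply: (@continuous_glue R _ _ (fun u : I * I => I01_val u.2) 2^-1
    (fun u : I * I => H (u.1, I01_fst u.2)) (fun u : I * I => K (u.1, I01_snd u.2))).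
  + exact: snd_val_continuous.
  + apply: (@continuous_circ _ _ _ (fun u : I * I => (u.1, I01_fst u.2)) H) => //.
    apply: continuous_couple; first exact: continuous_fst.
    exact: (continuous_circ (@continuous_snd _ _) I01_fst_continuous).
  + apply: (@continuous_circ _ _ _ (fun u : I * I => (u.1, I01_snd u.2)) K) => //.
    apply: continuous_couple; first exact: continuous_fst.
    exact: (continuous_circ (@continuous_snd _ _) I01_snd_continuous).
  + by move=> u uh; rewrite I01_fst_half// I01_snd_half// H1 K0.
- by move=> t /=; rewrite I01_zero_half I01_fst0.
- by move=> t /=; rewrite I01_one_half I01_snd1.
- by move=> s /=; case: ifP => _; [exact: H01|exact: K01].
Qed.

Section Concatenation.
Variables (x y z : X).
Variables (p : {path I from x to y in X}) (q : {path I from y to z in X}).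

Definition path_cat_fun (t : I) : X :=
  if I01_val t <= 2^-1 then p (I01_fst t) else q (I01_snd t).

Lemma path_cat_continuous : continuous path_cat_fun.
Proof.
apply: (@continuous_glue R _ _ (@I01_val R) 2^-1 (p \o I01_fst) (q \o I01_snd)).
- exact: I01_val_continuous.
- by move=> u; apply: continuous_comp; [exact: I01_fst_continuous|exact: cts_fun].
- by move=> u; apply: continuous_comp; [exact: I01_snd_continuous|exact: cts_fun].
- by move=> t th /=; rewrite I01_fst_half// I01_snd_half// path_zero path_one.
Qed.

Lemma path_cat_zero : path_cat_fun zero = x.
Proof. by rewrite /path_cat_fun I01_zero_half I01_fst0 path_zero. Qed.

Lemma path_cat_one : path_cat_fun one = z.
Proof. by rewrite /path_cat_fun I01_one_half I01_snd1 path_one. Qed.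

Definition path_cat : {path I from x to z in X} :=
  mk_path path_cat_continuous path_cat_zero path_cat_one.

Lemma path_catE t : path_cat t = path_cat_fun t.
Proof. by []. Qed.

End Concatenation.

Section Reverse.
Variables (x y : X) (p : {path I from x to y in X}).

Lemma path_rev_continuous : continuous (p \o I01_rev).
Proof.
by move=> u; apply: continuous_comp; [exact: I01_rev_continuous|exact: cts_fun].
Qed.

Lemma path_rev_zero : (p \o I01_rev) zero = y.
Proof. by rewrite /= I01_rev0 path_one. Qed.

Lemma path_rev_one : (p \o I01_rev) one = x.
Proof. by rewrite /= I01_rev1 path_zero. Qed.

Definition path_rev : {path I from y to x in X} :=
  mk_path path_rev_continuous path_rev_zero path_rev_one.

Lemma path_revE t : path_rev t = p (I01_rev t).
Proof. by []. Qed.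

End Reverse.

Definition path_cst x : {path I from x to x in X} := cst x.

Lemma path_cat_homotopic x y z (p p' : {path I from x to y in X})
    (q q' : {path I from y to z in X}) :
  path_homotopic p p' -> path_homotopic q q' ->
  path_homotopic (path_cat p q) (path_cat p' q').
Proof.
case=> H [Hc H0 H1 H01] [K [Kc K0 K1 K01]].
exists (fun u => if I01_val u.1 <= 2^-1 then H (I01_fst u.1, u.2)
                 else K (I01_snd u.1, u.2)); split.
- apply: (@continuous_glue R _ _ (fun u : I * I => I01_val u.1) 2^-1
    (fun u : I * I => H (I01_fst u.1, u.2)) (fun u : I * I => K (I01_snd u.1, u.2))).
  + exact: fst_val_continuous.
  + apply: (@continuous_circ _ _ _ (fun u : I * I => (I01_fst u.1, u.2)) H) => //.
    apply: continuous_couple; last exact: continuous_snd.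
    exact: (continuous_circ (@continuous_fst _ _) I01_fst_continuous).
  + apply: (@continuous_circ _ _ _ (fun u : I * I => (I01_snd u.1, u.2)) K) => //.
    apply: continuous_couple; last exact: continuous_snd.
    exact: (continuous_circ (@continuous_fst _ _) I01_snd_continuous).
  + move=> u uh; rewrite I01_fst_half// I01_snd_half//.
    by rewrite (H01 _).2 (K01 _).1.
- by move=> t; rewrite /= /mk_path /path_cat_fun; case: ifP => _; rewrite ?H0 ?K0.
- by move=> t; rewrite /= /mk_path /path_cat_fun; case: ifP => _; rewrite ?H1 ?K1.
- move=> s /=; rewrite I01_zero_half I01_one_half I01_fst0 I01_snd1.
  by split; [exact: (H01 _).1|exact: (K01 _).2].
Qed.

Lemma path_rev_homotopic x y (p p' : {path I from x to y in X}) :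
  path_homotopic p p' -> path_homotopic (path_rev p) (path_rev p').
Proof.
case=> H [Hc H0 H1 H01].
exists (fun u => H (I01_rev u.1, u.2)); split.
- apply: (@continuous_circ _ _ _ (fun u : I * I => (I01_rev u.1, u.2)) H) => //.
  apply: continuous_couple; last exact: continuous_snd.
  exact: (continuous_circ (@continuous_fst _ _) I01_rev_continuous).
- by move=> t; rewrite /= H0.
- by move=> t; rewrite /= H1.
- by move=> s; rewrite /= I01_rev0 I01_rev1; split; [exact: (H01 _).2|exact: (H01 _).1].
Qed.

Lemma reparam_homotopic x y x' y' (p : {path I from x to y in X})
    (f g : {path I from x' to y' in X}) (phi psi : R -> R) :
  continuous phi -> continuous psi -> phi 0 = psi 0 -> phi 1 = psi 1 ->
  (forall t, f t = p (clamp (phi (I01_val t)))) ->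
  (forall t, g t = p (clamp (psi (I01_val t)))) ->
  path_homotopic f g.
Proof.
move=> phic psic e0 e1 fE gE.
pose h (u : I * I) : R := (1 - I01_val u.2) * phi (I01_val u.1)
                          + I01_val u.2 * psi (I01_val u.1).
have I0 : I01_val (zero : I) = 0 by rewrite val_clamp.
have I1 : I01_val (one : I) = 1 by rewrite val_clamp.
exists (fun u => p (clamp (h u))); split.
- apply: (@continuous_circ _ _ _ (fun u => clamp (h u)) p); last exact: cts_fun.
  apply: (@continuous_circ _ _ _ h (@clamp R)); last exact: clamp_continuous.
  apply: continuous_add; apply: continuous_mul.
  + apply: continuous_sub; first exact: continuous_cst.
    exact: snd_val_continuous.
  + exact: (continuous_circ fst_val_continuous phic).
  + exact: snd_val_continuous.
  + exact: (continuous_circ fst_val_continuous psic).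
- by move=> t; rewrite fE /h /= I0 subr0 mul1r mul0r addr0.
- by move=> t; rewrite gE /h /= I1 subrr mul1r mul0r add0r.
- move=> s; rewrite /h /= I0 I1 e0 e1 -!mulrDl subrK !mul1r -I0 -I1 -!gE.
  by rewrite path_zero path_one.
Qed.

Lemma path_catA x y z w (p : {path I from x to y in X})
    (q : {path I from y to z in X}) (r : {path I from z to w in X}) :
  path_homotopic (path_cat p (path_cat q r)) (path_cat (path_cat p q) r).
Proof.
apply: path_homotopic_sym.
apply: (@reparam_homotopic _ _ _ _ (path_cat p (path_cat q r)) _ _
  (fun t => Num.min (2 * t + 0) (Num.min (1 * t + 4^-1) (2^-1 * t + 2^-1))) id).
- apply: continuous_minr; first exact: continuous_affine.
  by apply: continuous_minr; exact: continuous_affine.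
- exact: continuous_id.
- rewrite !mulr0 !add0r; apply/min_idPl; rewrite le_min; lra.
- rewrite (_ : Num.min (1 * 1 + 4^-1) (2^-1 * 1 + 2^-1) = 1 :> R).
    by apply/min_idPr; lra.
  rewrite (_ : 2^-1 * 1 + 2^-1 = 1 :> R); last by lra.
  by apply/min_idPr; lra.
- move=> t; have := I01_ge0 t; have := I01_le1 t.
  set s := I01_val t => s1 s0.
  rewrite /= /mk_path /path_cat_fun -/s /I01_fst /I01_snd -/s.
  have [sh|sh] := leP s 2^-1; last first.
    rewrite (_ : Num.min _ _ = 2^-1 * s + 2^-1); last first.
      by rewrite (min_idPr (_ : 2^-1 * s + 2^-1 <= 1 * s + 4^-1)); [apply/min_idPr|]; lra.
    rewrite val_clamp; [|lra|lra].
    rewrite ifF; last by apply/negbTE; rewrite -ltNge; lra.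
    rewrite path_catE /path_cat_fun /I01_fst /I01_snd val_clamp; [|lra|lra].
    rewrite ifF; last by apply/negbTE; rewrite -ltNge; lra.
    by congr (r (clamp _)); lra.
  have [sh'|sh'] := leP s 4^-1.
    rewrite (_ : Num.min _ _ = 2 * s); last first.
      by rewrite addr0; apply/min_idPl; rewrite le_min; apply/andP; split; lra.
    rewrite path_catE /path_cat_fun /I01_fst !val_clamp; [|lra..].
    by rewrite ifT; [rewrite ifT//|]; lra.
  rewrite (_ : Num.min _ _ = s + 4^-1); last first.
    rewrite (min_idPl (_ : 1 * s + 4^-1 <= 2^-1 * s + 2^-1)); last by lra.
    by rewrite mul1r; apply/min_idPr; lra.
  rewrite path_catE /path_cat_fun /I01_snd !val_clamp; [|lra..].
  rewrite ifF; last by apply/negbTE; rewrite -ltNge; lra.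
  rewrite ifF; last by apply/negbTE; rewrite -ltNge; lra.
  rewrite path_catE /path_cat_fun /I01_fst /I01_snd val_clamp; [|lra|lra].
  rewrite ifT; last by lra.
  by congr (q (clamp _)); lra.
- by move=> t; rewrite clamp_val.
Qed.

Lemma path_cat1p x y (p : {path I from x to y in X}) :
  path_homotopic (path_cat (path_cst x) p) p.
Proof.
apply: (@reparam_homotopic _ _ _ _ p _ _
  (fun t => Num.max 0 (2 * t + - 1)) id).
- apply: continuous_maxr; last exact: continuous_affine.
  exact: continuous_cst.
- exact: continuous_id.
- by apply/max_idPl; lra.
- by rewrite (_ : 2 * 1 + -1 = 1 :> R); [apply/max_idPr|]; lra.
- move=> t /=; rewrite /mk_path /path_cat_fun; case: leP => th.
    by rewrite (max_idPl _); [rewrite -/(zero : I) path_zero|lra].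
  by rewrite (max_idPr _) //; lra.
- by move=> t; rewrite clamp_val.
Qed.

Lemma path_catp1 x y (p : {path I from x to y in X}) :
  path_homotopic (path_cat p (path_cst y)) p.
Proof.
apply: (@reparam_homotopic _ _ _ _ p _ _
  (fun t => Num.min 1 (2 * t + 0)) id).
- apply: continuous_minr; last exact: continuous_affine.
  exact: continuous_cst.
- exact: continuous_id.
- by rewrite mulr0 addr0; apply/min_idPr.
- by apply/min_idPl; lra.
- move=> t /=; rewrite /mk_path /path_cat_fun addr0; case: leP => th.
    by rewrite (min_idPr _) //; lra.
  by rewrite (min_idPl _); [rewrite -/(one : I) path_one|lra].
- by move=> t; rewrite clamp_val.
Qed.

Lemma path_catpV x y (p : {path I from x to y in X}) :
  path_homotopic (path_cat p (path_rev p)) (path_cst x).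
Proof.
apply: (@reparam_homotopic _ _ _ _ p _ _
  (fun t => Num.min (2 * t + 0) (-2 * t + 2)) (fun _ => 0)).
- by apply: continuous_minr; exact: continuous_affine.
- exact: continuous_cst.
- by rewrite !mulr0 !add0r; apply/min_idPl; lra.
- by rewrite (_ : -2 * 1 + 2 = 0 :> R); [apply/min_idPr|]; lra.
- move=> t; have := I01_le1 t; rewrite /= /mk_path /path_cat_fun => t1.
  case: leP => th.
    by rewrite (min_idPl _) ?addr0 //; lra.
  rewrite (min_idPr _); last by lra.
  by rewrite path_revE /I01_rev /I01_snd val_clamp; [congr (p (clamp _))|..]; lra.
- by move=> t; rewrite -/(zero : I) path_zero.
Qed.

Lemma path_rev_rev x y (p : {path I from x to y in X}) :
  path_rev (path_rev p) = p.
Proof.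
apply/path_eqP => t; have := I01_ge0 t; have := I01_le1 t => t1 t0.
rewrite !path_revE /I01_rev val_clamp; [|lra|lra].
by rewrite -[in RHS](clamp_val t); congr (p (clamp _)); lra.
Qed.

Lemma path_catVp x y (p : {path I from x to y in X}) :
  path_homotopic (path_cat (path_rev p) p) (path_cst y).
Proof. by have := path_catpV (path_rev p); rewrite path_rev_rev. Qed.

End PathHomotopy.

Section FundamentalGroup.
Variables (R : realType) (X : topologicalType) (x0 : X).
Local Notation loop := {path I01 R from x0 to x0 in X}.

Definition loop_homotopicb (p q : loop) : bool := `[< path_homotopic p q >].

Lemma loop_homotopicb_refl : reflexive loop_homotopicb.
Proof. by move=> p; apply/asboolP; exact: path_homotopic_refl. Qed.

Lemma loop_homotopicb_sym : symmetric loop_homotopicb.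
Proof.
by move=> p q; apply/asboolP/asboolP => /path_homotopic_sym.
Qed.

Lemma loop_homotopicb_trans : transitive loop_homotopicb.
Proof.
move=> q p r /asboolP pq /asboolP qr; apply/asboolP.
exact: path_homotopic_trans pq qr.
Qed.

Canonical loop_homotopy_equiv := EquivRel loop_homotopicb
  loop_homotopicb_refl loop_homotopicb_sym loop_homotopicb_trans.

Definition pi1 : Type := {eq_quot loop_homotopy_equiv}.

HB.instance Definition _ := Choice.copy pi1 {eq_quot loop_homotopy_equiv}.

Definition loop_class (p : loop) : pi1 := \pi_{eq_quot loop_homotopy_equiv} p.

Lemma loop_class_eq (p q : loop) :
  loop_class p = loop_class q <-> path_homotopic p q.
Proof.
by split=> [/eqmodP/asboolP //|pq]; apply/eqmodP/asboolP.
Qed.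

Lemma loop_classP (a : pi1) : exists p, a = loop_class p.
Proof. by exists (repr (a : {eq_quot loop_homotopy_equiv})); rewrite /loop_class reprK. Qed.

Definition loop_repr (a : pi1) : loop := repr (a : {eq_quot loop_homotopy_equiv}).

Lemma loop_reprK a : loop_class (loop_repr a) = a.
Proof. by rewrite /loop_class /loop_repr reprK. Qed.

Lemma loop_repr_class p : path_homotopic (loop_repr (loop_class p)) p.
Proof. by apply/loop_class_eq; rewrite loop_reprK. Qed.

(* The loop a is travelled first. *)
Definition pi1_mul (a b : pi1) : pi1 :=
  loop_class (path_cat (loop_repr a) (loop_repr b)).
Definition pi1_inv (a : pi1) : pi1 := loop_class (path_rev (loop_repr a)).
Definition pi1_one : pi1 := loop_class (path_cst R x0).

Lemma pi1_mulE p q :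
  pi1_mul (loop_class p) (loop_class q) = loop_class (path_cat p q).
Proof.
by apply/loop_class_eq; apply: path_cat_homotopic; exact: loop_repr_class.
Qed.

Lemma pi1_invE p : pi1_inv (loop_class p) = loop_class (path_rev p).
Proof. by apply/loop_class_eq; apply: path_rev_homotopic; exact: loop_repr_class. Qed.

Lemma pi1_mulA : associative pi1_mul.
Proof.
move=> a b c; have [p ->] := loop_classP a; have [q ->] := loop_classP b.
have [r ->] := loop_classP c; rewrite !pi1_mulE; apply/loop_class_eq.
exact: path_catA.
Qed.

Lemma pi1_mul1 : left_id pi1_one pi1_mul.
Proof.
move=> a; have [p ->] := loop_classP a; rewrite pi1_mulE.
by apply/loop_class_eq; exact: path_cat1p.
Qed.

Lemma pi1_1mul : right_id pi1_one pi1_mul.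
Proof.
move=> a; have [p ->] := loop_classP a; rewrite pi1_mulE.
by apply/loop_class_eq; exact: path_catp1.
Qed.

Lemma pi1_mulV : left_inverse pi1_one pi1_inv pi1_mul.
Proof.
move=> a; have [p ->] := loop_classP a; rewrite pi1_invE pi1_mulE.
by apply/loop_class_eq; exact: path_catVp.
Qed.

Lemma pi1_Vmul : right_inverse pi1_one pi1_inv pi1_mul.
Proof.
move=> a; have [p ->] := loop_classP a; rewrite pi1_invE pi1_mulE.
by apply/loop_class_eq; exact: path_catpV.
Qed.

HB.instance Definition _ := isGroup.Build pi1
  pi1_mulA pi1_mul1 pi1_1mul pi1_mulV pi1_Vmul.

End FundamentalGroup.

Arguments pi1 R {X} x0.

Section Presentation.
Variable A : choiceType.

(* [(a, false)] stands for the letter a and [(a, true)] for its inverse. *)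
Definition word : Type := seq (A * bool).

Definition word_inv (w : word) : word :=
  rev [seq (l.1, ~~ l.2) | l <- w].

Variable rel : set word.

Inductive word_eq : word -> word -> Prop :=
| word_eq_refl u : word_eq u u
| word_eq_sym u v : word_eq u v -> word_eq v u
| word_eq_trans u v w : word_eq u v -> word_eq v w -> word_eq u w
| word_eq_cat u u' v v' : word_eq u u' -> word_eq v v' ->
    word_eq (u ++ v) (u' ++ v')
| word_eq_cancel a (b : bool) : word_eq [:: (a, b); (a, ~~ b)] [::]
| word_eq_rel r : rel r -> word_eq r [::].

Definition word_eqb (u v : word) : bool := `[< word_eq u v >].

Lemma word_eqb_refl : reflexive word_eqb.
Proof. by move=> u; apply/asboolP; exact: word_eq_refl. Qed.

Lemma word_eqb_sym : symmetric word_eqb.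
Proof. by move=> u v; apply/asboolP/asboolP => /word_eq_sym. Qed.

Lemma word_eqb_trans : transitive word_eqb.
Proof.
by move=> v u w /asboolP uv /asboolP vw; apply/asboolP; exact: word_eq_trans uv vw.
Qed.

Canonical word_equiv := EquivRel word_eqb
  word_eqb_refl word_eqb_sym word_eqb_trans.

Definition presented : Type := {eq_quot word_equiv}.

HB.instance Definition _ := Choice.copy presented {eq_quot word_equiv}.

Definition word_class (w : word) : presented := \pi_{eq_quot word_equiv} w.

Definition presented_gen (a : A) : presented := word_class [:: (a, false)].

Lemma word_class_eq u v : word_class u = word_class v <-> word_eq u v.
Proof. by split=> [/eqmodP/asboolP //|uv]; apply/eqmodP/asboolP. Qed.

Definition word_repr (g : presented) : word := repr (g : {eq_quot word_equiv}).

Lemma word_reprK g : word_class (word_repr g) = g.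
Proof. by rewrite /word_class /word_repr reprK. Qed.

Lemma word_classP (g : presented) : exists w, g = word_class w.
Proof. by exists (word_repr g); rewrite word_reprK. Qed.

Lemma word_repr_class w : word_eq (word_repr (word_class w)) w.
Proof. by apply/word_class_eq; rewrite word_reprK. Qed.

Lemma word_inv_cons l w : word_inv (l :: w) = word_inv w ++ [:: (l.1, ~~ l.2)].
Proof. by rewrite /word_inv /= rev_cons cats1. Qed.

Lemma word_inv_cat u v : word_inv (u ++ v) = word_inv v ++ word_inv u.
Proof. by rewrite /word_inv map_cat rev_cat. Qed.

Lemma word_invK : involutive word_inv.
Proof.
move=> w; rewrite /word_inv map_rev revK -map_comp -[RHS]map_id.
by apply: eq_map => -[a b] /=; rewrite negbK.
Qed.

Lemma word_catV w : word_eq (w ++ word_inv w) [::].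
Proof.
elim: w => [|[a b] w IH]; first exact: word_eq_refl.
rewrite word_inv_cons.
have -> : ((a, b) :: w) ++ (word_inv w ++ [:: (a, ~~ b)])
  = [:: (a, b)] ++ ((w ++ word_inv w) ++ [:: (a, ~~ b)]) by rewrite -catA.
apply: word_eq_trans (word_eq_cancel a b).
apply: (@word_eq_cat [:: (a, b)] [:: (a, b)] _ [:: (a, ~~ b)]).
  exact: word_eq_refl.
exact: (word_eq_cat IH (word_eq_refl _)).
Qed.

Lemma word_Vcat w : word_eq (word_inv w ++ w) [::].
Proof. by have := word_catV (word_inv w); rewrite word_invK. Qed.

Lemma word_eq_inv u v : word_eq u v -> word_eq (word_inv u) (word_inv v).
Proof.
move=> uv; apply: (@word_eq_trans _ (word_inv u ++ (v ++ word_inv v))).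
  rewrite -[X in word_eq X _]cats0; apply: word_eq_cat; first exact: word_eq_refl.
  exact/word_eq_sym/word_catV.
rewrite catA -[X in word_eq _ X]cat0s; apply: word_eq_cat; last exact: word_eq_refl.
apply: word_eq_trans (word_Vcat u); apply: word_eq_cat; first exact: word_eq_refl.
exact: word_eq_sym.
Qed.

Definition presented_mul (g h : presented) : presented :=
  word_class (word_repr g ++ word_repr h).
Definition presented_inv (g : presented) : presented :=
  word_class (word_inv (word_repr g)).
Definition presented_one : presented := word_class [::].

Lemma presented_mulE u v :
  presented_mul (word_class u) (word_class v) = word_class (u ++ v).
Proof. by apply/word_class_eq; apply: word_eq_cat; exact: word_repr_class. Qed.

Lemma presented_invE u : presented_inv (word_class u) = word_class (word_inv u).
Proof. by apply/word_class_eq; apply: word_eq_inv; exact: word_repr_class. Qed.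

Lemma presented_mulA : associative presented_mul.
Proof.
move=> a b c; have [p ->] := word_classP a; have [q ->] := word_classP b.
by have [r ->] := word_classP c; rewrite !presented_mulE catA.
Qed.

Lemma presented_mul1 : left_id presented_one presented_mul.
Proof. by move=> a; have [p ->] := word_classP a; rewrite presented_mulE. Qed.

Lemma presented_1mul : right_id presented_one presented_mul.
Proof.
by move=> a; have [p ->] := word_classP a; rewrite presented_mulE cats0.
Qed.

Lemma presented_mulV : left_inverse presented_one presented_inv presented_mul.
Proof.
move=> a; have [p ->] := word_classP a; rewrite presented_invE presented_mulE.
by apply/word_class_eq; exact: word_Vcat.
Qed.

Lemma presented_Vmul : right_inverse presented_one presented_inv presented_mul.
Proof.
move=> a; have [p ->] := word_classP a; rewrite presented_invE presented_mulE.
by apply/word_class_eq; exact: word_catV.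
Qed.

HB.instance Definition _ := isGroup.Build presented
  presented_mulA presented_mul1 presented_1mul presented_mulV presented_Vmul.

End Presentation.

Section Words.
Variables (A : choiceType) (G : groupType) (g : A -> G).

Definition word_val (w : word A) : G :=
  (\prod_(l <- w) (if l.2 then (g l.1)^-1 else g l.1))%g.

End Words.

Definition product_word (n : nat) : word 'I_n :=
  [seq (i, false) | i <- enum 'I_n].

(* the topology of the modulus *)
HB.instance Definition _ (R : rcfType) :=
  PseudoPointedMetric.copy R[i] (R[i])^o.

Section ProjectivePlane.
Variable R : realType.
Local Notation C := R[i].

Definition nzvec : Type := set_type [set v : 'rV[C]_3 | v != 0].

HB.instance Definition _ :=
  Topological.copy nzvec (set_type [set v : 'rV[C]_3 | v != 0]).

Definition nzvec_val (v : nzvec) : 'rV[C]_3 := \val v.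

Definition proportional (u v : nzvec) : bool :=
  `[< exists2 c : C, c != 0 & nzvec_val v = c *: nzvec_val u >].

Lemma proportional_refl : reflexive proportional.
Proof. by move=> u; apply/asboolP; exists 1; rewrite ?oner_neq0 ?scale1r. Qed.

Lemma proportional_sym : symmetric proportional.
Proof.
move=> u v; apply/asboolP/asboolP => -[c c0 E]; exists c^-1; rewrite ?invr_eq0//.
  by rewrite E scalerA mulVf// scale1r.
by rewrite E scalerA mulVf// scale1r.
Qed.

Lemma proportional_trans : transitive proportional.
Proof.
move=> v u w /asboolP[c c0 vE] /asboolP[d d0 wE]; apply/asboolP.
by exists (d * c); rewrite ?mulf_neq0// wE vE scalerA.
Qed.

Canonical proportional_equiv := EquivRel proportional
  proportional_refl proportional_sym proportional_trans.

Definition P2 : Type := quotient_topology {eq_quot proportional_equiv}.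

HB.instance Definition _ :=
  Topological.copy P2 (quotient_topology {eq_quot proportional_equiv}).

(* [coords x v]: the entries of v are homogeneous coordinates of x. *)
Definition coords (x : P2) (v : 'rV[C]_3) : Prop :=
  exists2 u : nzvec, nzvec_val u = v & x = \pi_{eq_quot proportional_equiv} u.

Lemma coords_ex (x : P2) : exists v, coords x v.
Proof.
exists (nzvec_val (repr (x : {eq_quot proportional_equiv}))).
by exists (repr (x : {eq_quot proportional_equiv})); rewrite ?reprK.
Qed.

Lemma coords_neq0 (x : P2) v : coords x v -> v != 0.
Proof. by case=> -[u u0] <- _; exact: (set_mem u0). Qed.

Lemma coords_point (v : 'rV[C]_3) : v != 0 -> exists x, coords x v.
Proof.
move=> v0; pose u : nzvec := @exist _ (fun w => w \in [set w : 'rV[C]_3 | w != 0]) v (mem_set v0).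
by exists (\pi_{eq_quot proportional_equiv} u); exists u.
Qed.

Lemma coords_inj (x y : P2) v : coords x v -> coords y v -> x = y.
Proof.
case=> u <- -> [u' /val_inj E ->]; by rewrite E.
Qed.

Lemma coords_scale (x : P2) u v :
  coords x u -> coords x v <-> exists2 c : C, c != 0 & v = c *: u.
Proof.
move=> xu; split=> [xv|[c c0 vE]].
  case: xu xv => u' <- -> [v' <-] /eqmodP/asboolP //.
case: xu => u' uE xE.
have v0 : v != 0.
  by rewrite vE scaler_eq0 negb_or c0 -uE; exact: (set_mem (valP u')).
pose v' : nzvec := @exist _ (fun w => w \in [set w : 'rV[C]_3 | w != 0]) v (mem_set v0).
exists v' => //; rewrite xE; apply/eqmodP/asboolP; exists c => //.
by rewrite uE -vE.
Qed.

Local Notation poly3 := (mpoly.mpoly 3 C).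

Definition peval (F : poly3) (v : 'rV[C]_3) : C :=
  mpoly.meval (fun k => v 0 k) F.

Definition differential (F : poly3) (v w : 'rV[C]_3) : C :=
  \sum_(k < 3) peval (mpoly.mderiv k F) v * w 0 k.

Definition zero_locus (F : poly3) : set P2 :=
  [set x | forall v, coords x v -> peval F v = 0].

Definition singular_point (F : poly3) (x : P2) : Prop :=
  forall v, coords x v ->
    peval F v = 0 /\ forall k, peval (mpoly.mderiv k F) v = 0.

Definition smooth_curve (d : nat) (F : poly3) : Prop :=
  [/\ F \is mpoly.ishomog1 d (@mpoly.mdeg 3), F != 0 & forall x, ~ singular_point F x].

Definition tangent_line (F : poly3) (x : P2) : set P2 :=
  [set y | forall v w, coords x v -> coords y w -> differential F v w = 0].

Definition tangent_at (F G : poly3) (x : P2) : Prop :=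
  [/\ zero_locus F x, zero_locus G x & tangent_line F x = tangent_line G x].

End ProjectivePlane.

Section Meridians.
Variables (R : realType) (n : nat) (F : 'I_n -> mpoly.mpoly 3 R[i]).

Definition union_curve : set (P2 R) := \bigcup_i zero_locus (F i).

Definition cexp (t : R) : R[i] := (cos t +i* sin t)%C.

(* [F i] is an equation of the component B, and [\prod_j F j] a reduced
   equation of the curve.  The disc is { [v + z w] | |z| <= 1 }, which lies in
   the projective line through [v] and [w] and carries the complex orientation
   of its parameter z; it is embedded and transverse to B at [v] = p because the
   derivative of [F i] at v in the direction w is nonzero. *)
Definition is_meridian (i : 'I_n) (x0 : ~` union_curve) (a : pi1 R x0) : Prop :=
  exists (p : P2 R) (v w : 'rV[R[i]]_3) (y : ~` union_curve)
    (omega : {path I01 R from x0 to y in _})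
    (delta : {path I01 R from y to y in _}),
  [/\ zero_locus (F i) p /\ ~ singular_point (\prod_j F j) p,
      coords p v /\ differential (F i) v w != 0,
      forall (z : R[i]) (x : P2 R), `|z| <= 1 -> coords x (v + z *: w) ->
        union_curve x -> x = p,
      forall t, coords (\val (delta t)) (v + cexp (2 * pi * I01_val t) *: w) &
      a = loop_class (path_cat (path_cat omega delta) (path_rev omega))].

End Meridians.

Arguments is_meridian {R n} F i {x0} a.

(* Main.v *)
(** In coordinates where the two common points are [1:0:0] and [0:1:0] and the pole
    of the line joining them, which is the same for all the conics, is [0:0:1], the
    conics are xy = lam i * z^2 with distinct nonzero lam i.  A multiplicative
    homeomorphism of C that twists each circle |w| = r by an angle proportional
    to ln r, followed by a rotation, makes the lam i lie on distinct half-lines,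
    none of them the positive real one; write lam i = mu k ^ 2 with Im (mu k) > 0,
    the mu k sorted by their argument.

    The complement of the conics is then covered by three open sets that are
    star-shaped in suitable coordinates: one around [0:0:1], obtained by removing
    the half-lines [1,oo) * mu k ^ 2 from the values of xy / z^2, and two around the
    line z = 0, on which x / y takes values in C^* cut along a half-line.  With
    x = r m, y = m / r, z = 1, the first set meets each of the others in 2n
    contractible pieces, indexed by the sectors into which the lines directed by
    the mu k divide the plane of m; the two others meet each other in two pieces,
    which accounts for the identification of (r, m) with (- r, - m).  Comparing
    the paths from the base point in two charts gives a pi1-valued cocycle on this
    cover.  Its value T m between the first chart and another one is 1 on the sector
    of m = 1, is multiplied by (a k)^-1 on the left when m crosses the half-line of
    mu k, which defines a k, and satisfies T (- m) = T m * T (- 1) with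
    T (- 1) = (a 0 ... a (n-1))^-1; for m = - 1 this says that the square of the
    product is 1.  Lifting
    loops along the cocycle shows that the a k generate.  Conversely elements b k
    of any group with (b 0 ... b (n-1))^2 = 1 define by the same formulas a
    cocycle, whose holonomy is a morphism sending a k to b k.

    Each a k is a meridian, which is seen on a small circle around a point of the
    conic; Hurwitz moves restore the original order of the conics. *)

(* The overlaps of the charts are disconnected, so the usual van Kampen theorem, which wants a
   connected intersection, does not apply; locally constant cocycles stand in for it, and one theory
   of lifts serves both for generation and for the absence of further relations.

   The half-lines of the lam i must be distinct for the charts to cover: a point removed from the
   chart around [0:0:1] because of one conic must not be removed near the line z = 0 because of
   another. The map that separates them has to be multiplicative, in order to commute with the
   scaling of homogeneous coordinates and to respect the equations xy = lam z^2. Such a twist does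
   not preserve lines, whereas the disc of a meridian must lie in a line. The way out is the line x
   = mu k * z: there the twist acts on a single parameter, preserves its modulus and fixes the unit
   circle, so that a round circle about 1 can be located in the charts through its two explicit
   intersections with the unit circle. *)
From HB Require Import structures.
From mathcomp Require Import generic_quotient.
Require Import Defs.
From mathcomp Require Import all_boot all_order all_algebra complex.
From mathcomp Require mpoly.
Import (canonicals, coercions) mpoly.
From mathcomp Require Import all_classical all_reals all_analysis homotopy.
From mathcomp Require Import ring lra.
Set Implicit Arguments.
Unset Strict Implicit.
Unset Printing Implicit Defensive.
Import Order.TTheory GRing.Theory Num.Theory.
Import numFieldNormedType.Exports.
Local Open Scope classical_set_scope.
Local Open Scope ring_scope.

(** * Lifts to a cocycle and holonomy *)

Section LocallyConstant.
Variables (T : topologicalType) (A : set T).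
Hypothesis A_connected : connected A.

(** Within [A], both [Q] and its negation are relatively open. This induction along a connected set
    replaces every subdivision of an interval by a Lebesgue number. *)
Lemma connected_clopen_pred (Q : T -> Prop) (t0 : T) :
  A t0 -> Q t0 ->
  (forall t, A t -> \forall u \near t, A u -> (Q u <-> Q t)) ->
  forall t, A t -> Q t.
Proof.
move=> At0 Qt0 Qloc.
have E : A `&` Q = A.
  apply: A_connected; first by exists t0.
  - exists (\bigcup_(x in A `&` Q) interior [set u | A u -> Q u]).
      by apply: bigcup_open => x _; exact: open_interior.
    apply/seteqP; split=> [u [Au Qu]|u [Au [x _ ux]]].
      split=> //; exists u => //; apply: filterS (Qloc u Au) => v /= vu Av.
      exact/(vu Av).
    by split=> //; exact: (interior_subset ux).
  - exists (~` \bigcup_(x in A `&` ~` Q) interior [set u | A u -> ~ Q u]).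
      apply: open_closedC; apply: bigcup_open => x _; exact: open_interior.
    apply/seteqP; split=> [u [Au Qu]|u [Au Qu]]; split=> //.
      by case=> x _ ux; exact: (interior_subset ux).
    apply: contrapT => nQu; apply: Qu; exists u => //.
    by apply: filterS (Qloc u Au) => v /= vu Av /(vu Av).
by move=> t At; have [] : (A `&` Q) t by rewrite E.
Qed.

Lemma connected_locally_constant (Y : Type) (f : T -> Y) :
  (forall t, A t -> \forall u \near t, A u -> f u = f t) ->
  forall s t, A s -> A t -> f s = f t.
Proof.
move=> floc s t As At.
apply: (connected_clopen_pred (Q := fun u => f s = f u) As) => // {t At} t At.
by apply: filterS (floc t At) => u ut Au; rewrite ut.
Qed.

End LocallyConstant.

Lemma connected_real (R : realType) : connected [set: R].
Proof. exact/connected_intervalP. Qed.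

Section Lifts.
Variables (X : topologicalType) (K : Type) (W : K -> set X).
Variables (G : groupType) (g : K -> K -> X -> G).
Hypothesis W_open : forall k, open (W k).
Hypothesis W_cover : forall x, exists k, W k x.

Local Open Scope group_scope.

(* A lift of f is a section over f of the principal G-bundle glued from the
   trivial bundles on the sets W k by the transition functions g k l. *)
Definition lift (T : topologicalType) (f : T -> X) (L : T -> K -> G) : Prop :=
  (forall t k l, W k (f t) -> W l (f t) -> L t l = L t k * g k l (f t)) /\
  (forall t k, W k (f t) -> \forall u \near t, L u k = L t k).

Lemma lift_comp (T T' : topologicalType) (f : T -> X) (h : T' -> T) L :
  continuous h -> lift f L -> lift (f \o h) (L \o h).
Proof.
move=> hc [L1 L2]; split=> [t k l|t k Wk]; first exact: L1.
exact: (hc t _ (L2 (h t) k Wk)).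
Qed.

Lemma lift_mull (T : topologicalType) (f : T -> X) c L :
  lift f L -> lift f (fun t k => c * L t k).
Proof.
move=> [L1 L2]; split=> [t k l Wk Wl|t k Wk]; first by rewrite (L1 t k l)// mulgA.
by apply: filterS (L2 t k Wk) => u ->.
Qed.

Lemma lift_const (T : topologicalType) (A : set T) (f : T -> X) L k :
  connected A -> lift f L -> (forall t, A t -> W k (f t)) ->
  forall s t, A s -> A t -> L s k = L t k.
Proof.
move=> Ac [_ L2] AW; apply: (connected_locally_constant Ac) => t At.
by apply: filterS (L2 t k (AW t At)).
Qed.

(** Transition functions multiply on the right, so [L t k * (L' t k)^-1] does not depend on the
    chart [k]; it is locally constant, hence constant. *)
Lemma lift_unique (T : topologicalType) (f : T -> X) L L' :
  connected [set: T] -> continuous f -> lift f L -> lift f L' ->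
  forall s t k l, W k (f s) -> W l (f t) ->
  (L s k)^-1 * L t l = (L' s k)^-1 * L' t l.
Proof.
move=> Tc fc [L1 L2] [L1' L2'] s t k l Wk Wl.
suff : L s k * (L' s k)^-1 = L t l * (L' t l)^-1.
  move=> E; apply: (mulgI (L s k)); by rewrite mulVKg mulgA E mulgVK.
pose c t := let k := sval (cid (W_cover (f t))) in L t k * (L' t k)^-1.
have cE u m : W m (f u) -> L u m * (L' u m)^-1 = c u.
  move=> Wm; rewrite /c; case: cid => m' /= Wm'.
  by rewrite (L1 u m' m)// (L1' u m' m)// invgM !mulgA mulgK.
rewrite !cE//; apply: (connected_locally_constant Tc) => // {Wk Wl l k} u _.
have [m Wm] := W_cover (f u).
have nWm : \forall v \near u, W m (f v).
  by apply: (fc u); exact: open_nbhs_nbhs.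
near=> v => _; rewrite -(cE u m)// -(cE v m); last by near: v.
by congr (_ * _^-1); near: v; [exact: L2|exact: L2'].
Unshelve. all: by end_near. Qed.

Hypothesis g_cocycle : forall k l m x, W k x -> W l x -> W m x ->
  g k l x * g l m x = g k m x.

Lemma cocycle_refl k x : W k x -> g k k x = 1.
Proof. by move=> Wk; apply: (mulgI (g k k x)); rewrite mulg1 g_cocycle. Qed.

Lemma cocycle_sym k l x : W k x -> W l x -> g l k x = (g k l x)^-1.
Proof.
by move=> Wk Wl; apply: (mulgI (g k l x)); rewrite mulgV g_cocycle// cocycle_refl.
Qed.

Section Subgroup.
Variable S : set G.
Hypothesis S1 : S 1.
Hypothesis SM : forall x y, S x -> S y -> S (x * y).
Hypothesis gS : forall k l x, W k x -> W l x -> S (g k l x).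

(** In a fixed chart a lift is locally constant, and a change of chart multiplies it by a transition
    value, so it cannot leave [S]. Generation of the fundamental group is deduced from this. *)
Lemma lift_subgroup (T : topologicalType) (f : T -> X) L :
  connected [set: T] -> continuous f -> lift f L ->
  forall s k, W k (f s) -> S (L s k) -> forall t l, W l (f t) -> S (L t l).
Proof.
move=> Tc fc [L1 L2] s k Wk SL t l Wl.
have change u m m' : W m (f u) -> W m' (f u) -> S (L u m) -> S (L u m').
  by move=> Wm Wm' Sm; rewrite (L1 u m m')//; apply: SM => //; exact: gS.
have := connected_clopen_pred (Q := fun u => exists2 m, W m (f u) & S (L u m)) Tc.
case/(_ s _ _ _ t) => //; first by exists k.
  move=> u _; have [m Wm] := W_cover (f u).
  have nWm : \forall v \near u, W m (f v).
    by apply: (fc u); exact: open_nbhs_nbhs.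
  near=> v => _.
  have Wmv : W m (f v) by near: v.
  have E : L v m = L u m by near: v; exact: L2.
  split=> -[m' Wm' Sm']; exists m => //.
    by rewrite -E; exact: (change v m').
  by rewrite E; exact: (change u m').
by move=> m Wm Sm; exact: (change t m l).
Unshelve. all: by end_near. Qed.

End Subgroup.

Hypothesis g_locally_constant : forall k l x, W k x -> W l x ->
  \forall y \near x, g k l y = g k l x.

Lemma lift_cst (T : topologicalType) (x : X) :
  exists L, lift (fun _ : T => x) L.
Proof.
have [k Wk] := W_cover x; exists (fun _ l => g k l x); split.
  by move=> t l m Wl Wm; rewrite g_cocycle.
by move=> t l Wl; exact: nearW.
Qed.

(** [Order.min t a] stops the path at time [a], so that partial lifts are still lifts of maps on the
    whole line. Between [a] and [b] the path remains in the chart [k], where a lift must keep the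
    value [L a k]; the cocycle then dictates the other charts. *)
Lemma lift_extend (R : realType) (f : R -> X) (k : K) (a b : R) :
  continuous f -> a <= b -> (forall t, a <= t <= b -> W k (f t)) ->
  (exists L, lift (fun t => f (Order.min t a)) L) ->
  exists L, lift (fun t => f (Order.min t b)) L.
Proof.
move=> fc ab fW [L [L1 L2]].
pose L' t l := if t <= a then L t l else L a k * g k l (f (Order.min t b)).
have minc (c : R) : continuous (fun t : R => Order.min t c).
  by apply: continuous_minr; [exact: continuous_id|exact: continuous_cst].
have Wka : W k (f (Order.min a a)) by rewrite minxx; apply: fW; rewrite lexx ab.
have WkE t : a <= t -> W k (f (Order.min t b)).
  by move=> at_; apply: fW; rewrite le_min at_ ab /= ge_min lexx orbT.
have gnear t l : a <= t -> W l (f (Order.min t b)) ->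
  \forall u \near t, g k l (f (Order.min u b)) = g k l (f (Order.min t b)).
  move=> at_ Wl.
  have := @g_locally_constant k l _ (WkE t at_) Wl.
  exact: (continuous_comp (minc b t) (fc _)).
exists L'; split.
  move=> t l m; rewrite /L'; case: leP => [ta|/ltW at_] Wl Wm.
    have E : Order.min t b = Order.min t a.
      by rewrite (min_idPl ta) (min_idPl (le_trans ta ab)).
    by rewrite E; apply: L1; rewrite -E.
  by rewrite -mulgA g_cocycle//; exact: WkE.
move=> t l Wl.
have [ta|at_|ta] := ltgtP t a.
- have E : Order.min t b = Order.min t a.
    by rewrite (min_idPl (ltW ta)) (min_idPl (le_trans (ltW ta) ab)).
  have nL : \forall u \near t, L u l = L t l by apply: L2; rewrite -E.
  have nt : \forall u \near t, u < a by exact: lt_nbhsl.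
  near=> u; rewrite /L' (ltW ta).
  have -> : u <= a by apply: ltW; near: u.
  by near: u.
- have nt : \forall u \near t, a < u by exact: lt_nbhsr.
  have ng := gnear t l (ltW at_) Wl.
  near=> u; rewrite /L' !leNgt at_ /=.
  have -> /= : a < u by near: u.
  by congr (_ * _); near: u.
- move: Wl; rewrite ta => Wl.
  have Eab : Order.min a b = Order.min a a by rewrite minxx (min_idPl ab).
  have nL : \forall u \near a, L u l = L a l by apply: L2; rewrite -Eab.
  have ng := gnear a l (lexx a) Wl.
  have ELa : L a l = L a k * g k l (f (Order.min a b)).
    by rewrite Eab; apply: L1; rewrite // -Eab.
  near=> u; rewrite /L' lexx; case: leP => _; first by near: u.
  by rewrite ELa; congr (_ * _); near: u.
Unshelve. all: by end_near. Qed.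

Lemma lift_restrict (R : realType) (f : R -> X) (a b : R) : a <= b ->
  (exists L, lift (fun t => f (Order.min t b)) L) ->
  exists L, lift (fun t => f (Order.min t a)) L.
Proof.
move=> ab [L Ll]; exists (L \o (fun t => Order.min t a)).
have -> : (fun t => f (Order.min t a)) =
    (fun t => f (Order.min t b)) \o (fun t => Order.min t a).
  by apply/funext => t /=; rewrite -minA (min_idPl ab).
apply: lift_comp => //.
by apply: continuous_minr; [exact: continuous_id|exact: continuous_cst].
Qed.

(** The times [a] such that the path stopped at [a] has a lift form an open and closed set that
    contains 0. *)
Lemma lift_real (R : realType) (f : R -> X) :
  continuous f -> (forall t, t <= 0 -> f t = f 0) ->
  (forall t, 1%R <= t -> f t = f 1%R) -> exists L, lift f L.
Proof.
move=> fc f0 f1.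
have : exists L, lift (fun t : R => f (Order.min t 1%R)) L.
  have := connected_clopen_pred
    (Q := fun a => exists L, lift (fun t => f (Order.min t a)) L)
    (@connected_real R) (t0 := 0).
  apply => // [|t _].
    have -> : (fun t => f (Order.min t 0)) = (fun _ => f 0).
      by apply/funext => t; rewrite f0// ge_min lexx orbT.
    exact: lift_cst.
  have [k Wk] := W_cover (f t).
  have : \forall u \near t, W k (f u).
    by apply: (fc t); exact: open_nbhs_nbhs.
  move=> /nbhs_ballP[e /= e0 eW].
  apply/nbhs_ballP; exists e => //= u; rewrite /ball /= => tu _.
  have key a b : a <= b -> `|t - a| < e -> `|t - b| < e ->
      (exists L, lift (fun v => f (Order.min v a)) L) <->
      (exists L, lift (fun v => f (Order.min v b)) L).
    move=> ab ta tb; split; last exact: lift_restrict.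
    apply: (lift_extend (k := k)) => // v /andP[av vb].
    by apply: eW; rewrite /ball /=; move: ta tb; rewrite !ltr_norml; lra.
  have tt : `|t - t| < e by rewrite subrr normr0.
  by have [tu'|/ltW tu'] := leP t u; [apply: iff_sym|]; apply: key.
case=> L Ll; exists L; rewrite (_ : f = (fun t => f (Order.min t 1%R)))//.
by apply/funext => t; case: (leP t 1%R) => [//|/ltW]; exact: f1.
Qed.

(* Lifts over the horizontal segments, normalised along the left edge, fit
   together: in a box inside one chart each of them is constant in t. *)
Lemma lift_real2 (R : realType) (f : R * R -> X) :
  continuous f ->
  (forall t s, t <= 0 -> f (t, s) = f (0, s)) ->
  (forall t s, 1%R <= t -> f (t, s) = f (1%R, s)) ->
  (forall s, s <= 0 -> f (0, s) = f (0, 0)) ->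
  (forall s, 1%R <= s -> f (0, s) = f (0, 1%R)) -> exists L, lift f L.
Proof.
move=> fc ft0 ft1 fs0 fs1.
have rowc s : continuous (fun t : R => f (t, s)).
  apply: (@continuous_circ _ _ _ (fun t : R => (t, s))) => //.
  by apply: continuous_couple; [exact: continuous_id|exact: continuous_cst].
have colc t : continuous (fun s : R => f (t, s)).
  apply: (@continuous_circ _ _ _ (fun s : R => (t, s))) => //.
  by apply: continuous_couple; [exact: continuous_cst|exact: continuous_id].
have [M [M1 M2]] := lift_real (colc 0) fs0 fs1.
have row s : exists L, lift (fun t : R => f (t, s)) L /\
    forall k, W k (f (0, s)) -> L 0 k = M s k.
  have [L Ll] := lift_real (rowc s) (fun t => ft0 t s) (fun t => ft1 t s).
  have [k Wk] := W_cover (f (0, s)).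
  exists (fun t l => (M s k * (L 0 k)^-1) * L t l); split.
    exact: lift_mull.
  move=> l Wl; case: Ll => L1 _.
  by rewrite (L1 0 k l)// (M1 s k l)// !mulgA mulgVK.
pose LL s := sval (cid (row s)).
have LL1 s : lift (fun t : R => f (t, s)) (LL s) by rewrite /LL; case: cid => ? [].
have LL0 s k : W k (f (0, s)) -> LL s 0 k = M s k.
  by rewrite /LL; case: cid => ? [_ /= E] /E.
exists (fun u k => LL u.2 u.1 k); split.
  by move=> [t s] k l /=; case: (LL1 s) => + _; exact.
move=> [t0 s0] /=.
(* The property [good] spreads along the row [s0] from the left edge, where the lifts agree with
   [M]. Near [(t, s0)] everything happens in one chart; the other charts follow by the cocycle. *)
pose good t := forall k, W k (f (t, s0)) ->
  \forall u \near (t, s0), LL u.2 u.1 k = LL s0 t k.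
suff : good t0 by [].
apply: (connected_clopen_pred (Q := good) (@connected_real R) (t0 := 0)) => //.
- move=> k Wk.
  have : \forall u \near ((0 : R), s0), W k (f u).
    by apply: (fc (0, s0)); exact: open_nbhs_nbhs.
  case=> -[A B] /= [nA nB] AB.
  have nM : \forall s \near s0, M s k = M s0 k by exact: M2.
  move: nA => /nbhs_ballP[e /= e0 eA].
  exists (ball (0 : R) e, B `&` [set s | M s k = M s0 k]) => /=.
    by split; [exact: nbhsx_ballx|exact: filterI].
  move=> [t s] /= [te [Bs Ms]].
  transitivity (LL s 0 k); last first.
    have Wks : W k (f (0, s)).
      by apply: (AB (0, s)); split => //=; exact/eA/ballxx.
    by rewrite (LL0 s k Wks) (LL0 s0 k Wk).
  apply: (@lift_const R (ball (0 : R) e) _ _ k _ (LL1 s)) => //.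
  + apply/connected_intervalP => x y; rewrite /ball /= => xe ye z xyz.
    by move: xe ye; rewrite !ltr_norml; lra.
  + by move=> v ve; apply: (AB (v, s)); split => //=; exact: eA.
  + exact: ballxx.
- move=> t _; have [k Wk] := W_cover (f (t, s0)).
  have : \forall u \near (t, s0), W k (f u).
    by apply: (fc (t, s0)); exact: open_nbhs_nbhs.
  case=> -[A B] /= [nA nB] AB.
  move: nA => /nbhs_ballP[e /= e0 eA].
  have Bs0 : B s0 by exact: nbhs_singleton.
  have ballc : connected (ball t e).
    apply/connected_intervalP => x y; rewrite /ball /= => xe ye z xyz.
    by move: xe ye; rewrite !ltr_norml; lra.
  have rowE s u v : B s -> ball t e u -> ball t e v -> LL s u k = LL s v k.
    move=> Bs ue ve; apply: (@lift_const R (ball t e) _ _ k _ (LL1 s)) => //.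
    by move=> w we; apply: (AB (w, s)); split => //=; exact: eA.
  have spread u v : ball t e u -> ball t e v -> good u -> good v.
    move=> ue ve gu l Wl.
    have Wku : W k (f (u, s0)) by apply: (AB (u, s0)); split => //=; exact: eA.
    have Wkv : W k (f (v, s0)) by apply: (AB (v, s0)); split => //=; exact: eA.
    have ns : \forall s \near s0, LL s u k = LL s0 u k.
      have cu : continuous (fun s : R => (u, s)).
        by apply: continuous_couple; [exact: continuous_cst|exact: continuous_id].
      exact: (cu s0 _ (gu k Wku)).
    have nWl : \forall w \near (v, s0), W l (f w).
      by apply: (fc (v, s0)); exact: open_nbhs_nbhs.
    have nWk : \forall w \near (v, s0), W k (f w).
      by apply: (fc (v, s0)); exact: open_nbhs_nbhs.
    have ng : \forall w \near (v, s0), g k l (f w) = g k l (f (v, s0)).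
      exact: (fc (v, s0) _ (@g_locally_constant k l _ Wkv Wl)).
    have nb : \forall w \near (v, s0), ball t e w.1 /\
        (B w.2 /\ LL w.2 u k = LL s0 u k).
      exists (ball t e, B `&` [set s | LL s u k = LL s0 u k]) => /=.
        split; last exact: filterI.
        apply: open_nbhs_nbhs; split=> //; exact: ball_open.
      by move=> w /= [].
    near=> w.
    have [we [Bw Ew]] : ball t e w.1 /\ (B w.2 /\ LL w.2 u k = LL s0 u k).
      by near: w.
    have Wlw : W l (f w) by near: w.
    have Wkw : W k (f w) by near: w.
    have gw : g k l (f w) = g k l (f (v, s0)) by near: w.
    have wE : w = (w.1, w.2) by exact: surjective_pairing.
    rewrite wE in Wlw Wkw gw.
    have [Lw _] := LL1 w.2; have [Lv _] := LL1 s0.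
    rewrite (Lw w.1 k l)// (Lv v k l)// gw; congr (_ * _).
    by rewrite (rowE _ _ u)// Ew; exact: rowE.
  apply/nbhs_ballP; exists e => //= u ue _.
  by split; apply: spread => //; exact: ballxx.
Unshelve. all: by end_near. Qed.

End Lifts.

(** * Paths up to homotopy, and loops made of two paths with the same ends *)

Section PathAlgebra.
Variables (R : realType) (X : topologicalType).
Local Notation I := (I01 R).

Lemma I01_val0 : I01_val (zero : I) = 0.
Proof. by rewrite val_clamp. Qed.

Lemma I01_val1 : I01_val (one : I) = 1.
Proof. by rewrite val_clamp. Qed.

Definition path_real x y (p : {path I from x to y in X}) (t : R) : X := p (clamp t).

Lemma path_real_continuous x y (p : {path I from x to y in X}) :
  continuous (path_real p).
Proof. exact: (continuous_circ (@clamp_continuous R) cts_fun). Qed.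

Lemma path_real_le0 x y (p : {path I from x to y in X}) t :
  t <= 0 -> path_real p t = x.
Proof. by move=> t0; rewrite /path_real clamp_le0//; exact: path_zero. Qed.

Lemma path_real_ge1 x y (p : {path I from x to y in X}) t :
  1 <= t -> path_real p t = y.
Proof. by move=> t1; rewrite /path_real clamp_ge1//; exact: path_one. Qed.

Lemma path_real0 x y (p : {path I from x to y in X}) : path_real p 0 = x.
Proof. exact: path_real_le0. Qed.

Lemma path_real1 x y (p : {path I from x to y in X}) : path_real p 1 = y.
Proof. exact: path_real_ge1. Qed.

Lemma path_cat_real x y z (p : {path I from x to y in X})
    (q : {path I from y to z in X}) (t : R) :
  path_real (path_cat p q) t =
  if t <= 2^-1 then path_real p (2 * t) else path_real q (2 * t - 1).
Proof.
have [t0|t0] := ltP t 0.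
  by rewrite ifT; [rewrite !path_real_le0//|]; lra.
have [t1|t1] := ltP 1 t.
  by rewrite ifF; [rewrite !path_real_ge1//; lra|apply/negbTE; rewrite -ltNge; lra].
by rewrite {1}/path_real path_catE /path_cat_fun /I01_fst /I01_snd !val_clamp.
Qed.

Lemma path_cat_homotopicl x y z (p p' : {path I from x to y in X})
    (q : {path I from y to z in X}) :
  path_homotopic p p' -> path_homotopic (path_cat p q) (path_cat p' q).
Proof. by move=> pp'; apply: path_cat_homotopic => //; exact: path_homotopic_refl. Qed.

Lemma path_cat_homotopicr x y z (p : {path I from x to y in X})
    (q q' : {path I from y to z in X}) :
  path_homotopic q q' -> path_homotopic (path_cat p q) (path_cat p q').
Proof. by move=> qq'; apply: path_cat_homotopic => //; exact: path_homotopic_refl. Qed.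

Lemma path_catK x y z (p : {path I from x to y in X})
    (q : {path I from y to z in X}) :
  path_homotopic (path_cat (path_cat p q) (path_rev q)) p.
Proof.
apply: path_homotopic_trans (path_homotopic_sym (path_catA _ _ _)) _.
apply: path_homotopic_trans (path_cat_homotopicr _ (path_catpV _)) _.
exact: path_catp1.
Qed.

Lemma path_catVKr x y z (p : {path I from x to y in X})
    (q : {path I from z to y in X}) :
  path_homotopic (path_cat (path_cat p (path_rev q)) q) p.
Proof.
apply: path_homotopic_trans (path_homotopic_sym (path_catA _ _ _)) _.
apply: path_homotopic_trans (path_cat_homotopicr _ (path_catVp _)) _.
exact: path_catp1.
Qed.

Lemma pi1_mul_class (x0 : X) (p q : {path I from x0 to x0 in X}) :
  (loop_class p * loop_class q)%g = loop_class (path_cat p q).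
Proof. exact: pi1_mulE. Qed.

Lemma pi1_inv_class (x0 : X) (p : {path I from x0 to x0 in X}) :
  (loop_class p)^-1%g = loop_class (path_rev p).
Proof. exact: pi1_invE. Qed.

(** [path_cat p (path_rev q)] acts as the quotient of two paths with the same ends; this lemma and
    the next ones are the rules of that division. *)
Lemma loop_class_div (x0 y : X) (c : {path I from x0 to x0 in X})
    (p q : {path I from x0 to y in X}) :
  path_homotopic (path_cat c q) p ->
  loop_class (path_cat p (path_rev q)) = loop_class c.
Proof.
move=> cqp; apply/loop_class_eq.
apply: path_homotopic_trans (path_cat_homotopicl _ (path_homotopic_sym cqp)) _.
exact: path_catK.
Qed.

Lemma loop_class_divK (x0 y : X) (a b c : {path I from x0 to y in X}) :
  (loop_class (path_cat a (path_rev b)) * loop_class (path_cat b (path_rev c)) =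
   loop_class (path_cat a (path_rev c)))%g.
Proof.
rewrite pi1_mul_class; apply/loop_class_eq.
apply: path_homotopic_trans (path_catA _ _ _) _.
exact: path_cat_homotopicl (path_catVKr _ _).
Qed.

Lemma loop_class_divr (x0 y z : X) (a b : {path I from x0 to y in X})
    (s : {path I from y to z in X}) :
  loop_class (path_cat (path_cat a s) (path_rev (path_cat b s))) =
  loop_class (path_cat a (path_rev b)).
Proof.
apply: loop_class_div.
apply: path_homotopic_trans (path_catA _ _ _) _.
exact: path_cat_homotopicl (path_catVKr _ _).
Qed.

Lemma loop_class_div_homotopic (x0 y : X) (a a' b b' : {path I from x0 to y in X}) :
  path_homotopic a a' -> path_homotopic b b' ->
  loop_class (path_cat a (path_rev b)) = loop_class (path_cat a' (path_rev b')).
Proof.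
move=> aa' bb'; apply/loop_class_eq; apply: path_cat_homotopic => //.
exact: path_rev_homotopic.
Qed.

Lemma loop_class_divpp (x0 y : X) (a : {path I from x0 to y in X}) :
  loop_class (path_cat a (path_rev a)) = 1%g.
Proof. by apply/loop_class_eq; exact: path_catpV. Qed.

Lemma continuous_clampR : continuous (fun t : R => I01_val (clamp t)).
Proof. exact: (continuous_circ (@clamp_continuous R) (@I01_val_continuous R)). Qed.

Section Plane.
Variables (f : R * R -> X).
Hypothesis f_continuous : continuous f.

(** The plane is convex, so [phi] and [psi] are joined by segments, and [f] carries this homotopy to
    [X]. Identities between concatenations then reduce to exhibiting paths in a square. *)
Lemma plane_homotopic (u v : R * R) (x y : X)
    (phi psi : {path I from u to v in (R * R)%type})
    (p q : {path I from x to y in X}) :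
  (forall t, p t = f (phi t)) -> (forall t, q t = f (psi t)) ->
  path_homotopic p q.
Proof.
move=> pE qE.
pose h (w : I * I) : R * R :=
  ((1 - I01_val w.2) * (phi w.1).1 + I01_val w.2 * (psi w.1).1,
   (1 - I01_val w.2) * (phi w.1).2 + I01_val w.2 * (psi w.1).2).
have c1 (r : {path I from u to v in (R * R)%type}) :
    continuous (fun w : I * I => (r w.1).1).
  apply: (@continuous_circ _ _ _ (fun w : I * I => r w.1)); last exact: continuous_fst.
  exact: (continuous_circ (@continuous_fst _ _) cts_fun).
have c2 (r : {path I from u to v in (R * R)%type}) :
    continuous (fun w : I * I => (r w.1).2).
  apply: (@continuous_circ _ _ _ (fun w : I * I => r w.1)); last exact: continuous_snd.
  exact: (continuous_circ (@continuous_fst _ _) cts_fun).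
have cs : continuous (fun w : I * I => 1 - I01_val w.2).
  by apply: continuous_sub; [exact: continuous_cst|exact: snd_val_continuous].
exists (fun w => f (h w)); split.
- apply: (@continuous_circ _ _ _ h f) => //; apply: continuous_couple.
    by apply: continuous_add; apply: continuous_mul => //; exact: snd_val_continuous.
  by apply: continuous_add; apply: continuous_mul => //; exact: snd_val_continuous.
- by move=> t; rewrite pE /h /= I01_val0 subr0 !mul1r !mul0r !addr0 -surjective_pairing.
- by move=> t; rewrite qE /h /= I01_val1 subrr !mul1r !mul0r !add0r -surjective_pairing.
- move=> s; rewrite /h /= !path_zero !path_one -!mulrDl !subrK !mul1r -!surjective_pairing.
  split; first by have := pE zero; rewrite !path_zero.
  by have := pE one; rewrite !path_one.
Qed.

Definition segment_fun (u v : R * R) (t : I) : R * R :=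
  (u.1 + (v.1 - u.1) * I01_val t, u.2 + (v.2 - u.2) * I01_val t).

Lemma segment_fun_continuous u v : continuous (segment_fun u v).
Proof.
by apply: continuous_couple; apply: continuous_add;
  (try exact: continuous_cst); apply: continuous_mul;
  (try exact: continuous_cst); exact: I01_val_continuous.
Qed.

Lemma segment_fun0 u v : segment_fun u v zero = u.
Proof. by rewrite /segment_fun I01_val0 !mulr0 !addr0 -surjective_pairing. Qed.

Lemma segment_fun1 u v : segment_fun u v one = v.
Proof. by rewrite /segment_fun I01_val1 !mulr1 !(addrC _ (_ - _)) !subrK -surjective_pairing. Qed.

Definition segment (u v : R * R) : {path I from u to v in (R * R)%type} :=
  mk_path (@segment_fun_continuous u v) (segment_fun0 u v) (segment_fun1 u v).

End Plane.

Lemma path_cat_comp (Y : topologicalType) (f : Y -> X) (a b c : Y) (x y z : X)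
    (phi : {path I from a to b in Y}) (psi : {path I from b to c in Y})
    (p : {path I from x to y in X}) (q : {path I from y to z in X}) :
  (forall t, p t = f (phi t)) -> (forall t, q t = f (psi t)) ->
  forall t, path_cat p q t = f (path_cat phi psi t).
Proof. by move=> pE qE t; rewrite !path_catE /path_cat_fun; case: ifP. Qed.

Section RealSegment.
Variables (f : R -> X).
Hypothesis f_continuous : continuous f.

Lemma real_segment_continuous a b :
  continuous (fun t : I => f (a + (b - a) * I01_val t)).
Proof.
apply: (@continuous_circ _ _ _ (fun t : I => a + (b - a) * I01_val t) f) => //.
apply: continuous_add; first exact: continuous_cst.
by apply: continuous_mul; [exact: continuous_cst|exact: I01_val_continuous].
Qed.

Lemma real_segment0 a b : f (a + (b - a) * I01_val (zero : I)) = f a.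
Proof. by rewrite I01_val0 mulr0 addr0. Qed.

Lemma real_segment1 a b : f (a + (b - a) * I01_val (one : I)) = f b.
Proof. by rewrite I01_val1 mulr1 addrC subrK. Qed.

Definition real_segment a b : {path I from f a to f b in X} :=
  mk_path (@real_segment_continuous a b) (real_segment0 a b) (real_segment1 a b).

Lemma real_segmentE a b t : real_segment a b t = f (a + (b - a) * I01_val t).
Proof. by []. Qed.

Lemma real_segment_cat a b c :
  path_homotopic (path_cat (real_segment a b) (real_segment b c)) (real_segment a c).
Proof.
apply: (@plane_homotopic (f \o fst) _ (a, 0) (c, 0) _ _
  (path_cat (segment (a, 0) (b, 0)) (segment (b, 0) (c, 0))) (segment (a, 0) (c, 0))) => //.
- exact: (continuous_circ (@continuous_fst _ _) f_continuous).
- by apply: path_cat_comp.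
Qed.

End RealSegment.

End PathAlgebra.

(** * Holonomy of a locally constant cocycle *)

Section Holonomy.
Variables (R : realType) (X : topologicalType) (K : Type) (W : K -> set X).
Variables (G : groupType) (g : K -> K -> X -> G).
Hypothesis W_open : forall k, open (W k).
Hypothesis W_cover : forall x, exists k, W k x.
Hypothesis g_cocycle : forall k l m x, W k x -> W l x -> W m x ->
  (g k l x * g l m x = g k m x)%g.
Hypothesis g_locally_constant : forall k l x, W k x -> W l x ->
  \forall y \near x, g k l y = g k l x.
Local Notation I := (I01 R).
Local Notation lift := (lift W g).

Lemma path_lift x y (p : {path I from x to y in X}) :
  exists L, lift (path_real p) L.
Proof.
apply: (lift_real W_open W_cover g_cocycle g_locally_constant).
- exact: path_real_continuous.
- by move=> t t0; rewrite !path_real_le0.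
- by move=> t t1; rewrite !path_real_ge1.
Qed.

(** Two lifts of a path differ by a constant factor on the left, which this quotient cancels; [k]
    and [l] are the charts in which the two ends are read. *)
Definition holonomy x y (p : {path I from x to y in X}) k l : G :=
  let L := sval (cid (path_lift p)) in ((L 0%R k)^-1 * L 1%R l)%g.

Lemma holonomyE x y (p : {path I from x to y in X}) L k l :
  lift (path_real p) L -> W k x -> W l y ->
  holonomy p k l = ((L 0%R k)^-1 * L 1%R l)%g.
Proof.
move=> Lp Wk Wl; rewrite /holonomy; case: cid => L' /= Lp'.
apply: (lift_unique W_open W_cover (@connected_real R) _ Lp' Lp).
- exact: path_real_continuous.
- by rewrite path_real0.
- by rewrite path_real1.
Qed.

(** The whole homotopy square has a lift. Along its two vertical edges the map is constant and the
    lift does not move, so the two horizontal edges give the same quotient. *)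
Lemma holonomy_homotopic x y (p q : {path I from x to y in X}) k l :
  W k x -> W l y -> path_homotopic p q -> holonomy p k l = holonomy q k l.
Proof.
move=> Wk Wl [H [Hc Hp Hq Hs]].
pose F (u : R * R) : X := H (clamp u.1, clamp u.2).
have Fc : continuous F.
  apply: (@continuous_circ _ _ _ (fun u : R * R => (clamp u.1, clamp u.2))) => //.
  apply: continuous_couple.
    exact: (continuous_circ (@continuous_fst _ _) (@clamp_continuous R)).
  exact: (continuous_circ (@continuous_snd _ _) (@clamp_continuous R)).
have F0 s : F (0, s) = x by exact: (Hs _).1.
have F1 s : F (1, s) = y by exact: (Hs _).2.
have [||||L LF] := lift_real2 W_open W_cover g_cocycle g_locally_constant Fc.
- by move=> t s t0; rewrite /F /= clamp_le0.
- by move=> t s t1; rewrite /F /= clamp_ge1.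
- by move=> s _; rewrite !F0.
- by move=> s _; rewrite !F0.
have hc (t : R) : continuous (fun s : R => (s, t)).
  by apply: continuous_couple; [exact: continuous_id|exact: continuous_cst].
have vc (t : R) : continuous (fun s : R => (t, s)).
  by apply: continuous_couple; [exact: continuous_cst|exact: continuous_id].
rewrite (holonomyE (L := L \o (fun t => (t, 0%R))))//; last first.
  have -> : path_real p = F \o (fun t => (t, 0%R)).
    by apply/funext => t; rewrite /path_real -Hp.
  exact: lift_comp.
rewrite (holonomyE (L := L \o (fun t => (t, 1%R))))//; last first.
  have -> : path_real q = F \o (fun t => (t, 1%R)).
    by apply/funext => t; rewrite /path_real -Hq.
  exact: lift_comp.
rewrite /=; congr (_^-1 * _)%g.
  apply: (@lift_const _ _ _ _ _ _ setT (F \o (fun s => (0%R, s)))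
    (L \o (fun s => (0%R, s))) k) => //.
  + exact: connected_real.
  + exact: (lift_comp (vc 0) LF).
  + by move=> s _; rewrite /= F0.
apply: (@lift_const _ _ _ _ _ _ setT (F \o (fun s => (1%R, s))) (L \o (fun s => (1%R, s))) l) => //.
+ exact: connected_real.
+ exact: (lift_comp (vc 1) LF).
+ by move=> s _; rewrite /= F1.
Qed.

Lemma holonomy_cat x y z (p : {path I from x to y in X})
    (q : {path I from y to z in X}) k l m :
  W k x -> W l y -> W m z ->
  holonomy (path_cat p q) k m = (holonomy p k l * holonomy q l m)%g.
Proof.
move=> Wk Wl Wm; have [L Lpq] := path_lift (path_cat p q).
rewrite (holonomyE Lpq)//.
(* [h1] and [h2] send the line to the two halves of the unit interval and are constant outside of
   that interval, as [path_real] is; a lift of the concatenation thus yields lifts of [p] and of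
   [q]. *)
pose h1 (t : R) : R := I01_val (clamp t) * 2^-1.
pose h2 (t : R) : R := I01_val (clamp t) * 2^-1 + 2^-1.
have h1c : continuous h1.
  by apply: continuous_mul; [exact: continuous_clampR|exact: continuous_cst].
have h2c : continuous h2 by apply: continuous_add => //; exact: continuous_cst.
have h10 : h1 0 = 0 by rewrite /h1 val_clamp// mul0r.
have h11 : h1 1 = 2^-1 by rewrite /h1 val_clamp// mul1r.
have h20 : h2 0 = 2^-1 by rewrite /h2 val_clamp// mul0r add0r.
have h21 : h2 1 = 1 by rewrite /h2 val_clamp// mul1r; lra.
have cl (t : R) : 0 <= I01_val (clamp t) <= 1 by rewrite I01_ge0 I01_le1.
rewrite (@holonomyE _ _ p (L \o h1))//; last first.
  have -> : path_real p = path_real (path_cat p q) \o h1.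
    apply/funext => t; rewrite -[RHS]/(path_real (path_cat p q) (h1 t)) path_cat_real.
    rewrite ifT /h1; last by have := cl t; lra.
    by rewrite mulrCA mulfV// mulr1 {2}/path_real clamp_val.
  exact: lift_comp.
rewrite (@holonomyE _ _ q (L \o h2))//; last first.
  have -> : path_real q = path_real (path_cat p q) \o h2.
    apply/funext => t; rewrite -[RHS]/(path_real (path_cat p q) (h2 t)) path_cat_real /h2.
    case: ifPn => t0.
      have E : I01_val (clamp t) = 0 by have := cl t; move: t0; lra.
      rewrite E mul0r add0r mulfV// path_real1.
      by rewrite /path_real -(clamp_val (clamp t)) E; exact: path_zero.
    by rewrite mulrDr mulrCA !mulfV// mulr1 addrK {2}/path_real clamp_val.
  exact: lift_comp.
by rewrite /= h10 h11 h20 h21 mulgA mulgK.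
Qed.

Lemma holonomy_in x y (p : {path I from x to y in X}) k :
  (forall t, W k (p t)) -> holonomy p k k = 1%g.
Proof.
move=> Wp; have [L Lp] := path_lift p.
have Wx : W k x by have := Wp zero; rewrite path_zero.
have Wy : W k y by have := Wp one; rewrite path_one.
rewrite (holonomyE Lp)//; apply: (mulgI (L 0%R k)); rewrite mulVKg mulg1.
apply: (lift_const (@connected_real R) Lp) => // t _; exact: Wp.
Qed.

Lemma holonomy_rev x y (p : {path I from x to y in X}) k l :
  W k x -> W l y -> holonomy (path_rev p) l k = (holonomy p k l)^-1%g.
Proof.
move=> Wk Wl; apply: (mulgI (holonomy p k l)); rewrite mulgV -holonomy_cat//.
rewrite (holonomy_homotopic _ _ (path_catpV p))//.
by apply: holonomy_in => t.
Qed.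

End Holonomy.

(** The loop runs through chart [l] up to time [c] and back through chart [k], so its monodromy is
    the product of only two transitions, at times 0 and [c]. The circle of a meridian is treated in
    this way. *)
Lemma lift_split (R : realType) (X : topologicalType) (K : Type) (W : K -> set X)
    (G : groupType) (g : K -> K -> X -> G) (f : R -> X) L (c : R) (k l : K) :
  lift W g f L -> 0 <= c <= 1 -> f 1 = f 0 ->
  (forall t, 0 <= t <= c -> W l (f t)) -> (forall t, c <= t <= 1 -> W k (f t)) ->
  ((L 0%R k)^-1 * L 1%R k = g k l (f 0%R) * g l k (f c))%g.
Proof.
move=> Lf /andP[c0 c1] f10 Wl Wk.
have Wk0 : W k (f 0) by rewrite -f10; apply: Wk; rewrite c1 lexx.
have Wl0 : W l (f 0) by apply: Wl; rewrite c0 lexx.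
have Wlc : W l (f c) by apply: Wl; rewrite c0 lexx.
have Wkc : W k (f c) by apply: Wk; rewrite c1 lexx.
have El : L 0 l = L c l.
  apply: (lift_const (@segment_connected R 0 c) Lf) => /=; rewrite ?in_itv /= ?lexx ?c0 ?c1//.
have Ek : L c k = L 1 k.
  apply: (lift_const (@segment_connected R c 1) Lf) => /=; rewrite ?in_itv /= ?lexx ?c0 ?c1//.
case: Lf => L1 _.
by rewrite -Ek (L1 c l k)// -El (L1 0 k l)// !mulgA mulVg mul1g.
Qed.

(** * The cocycle defined by a system of paths, with values in the fundamental group *)

Section PathLift.
Variables (R : realType) (X : topologicalType) (x0 : X) (K : Type) (W : K -> set X).
Local Notation I := (I01 R).
Variable tau : forall k x, W k x -> {path I from x0 to x in X}.
Hypothesis W_open : forall k, open (W k).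
Hypothesis tauP : forall k x y (wx : W k x) (wy : W k y)
  (p : {path I from x to y in X}), (forall t, W k (p t)) ->
  path_homotopic (path_cat (tau wx) p) (tau wy).

(** [tau] takes a proof of membership, hence the case analysis; the value 1 off the overlap is a
    default. *)
Definition transition k l x : pi1 R x0 :=
  match pselect (W k x), pselect (W l x) with
  | left wk, left wl => loop_class (path_cat (tau wk) (path_rev (tau wl)))
  | _, _ => 1%g
  end.

Lemma tau_irrelevance k x (w w' : W k x) : tau w = tau w'.
Proof. by congr tau; exact: Prop_irrelevance. Qed.

Lemma transitionE k l x (wk : W k x) (wl : W l x) :
  transition k l x = loop_class (path_cat (tau wk) (path_rev (tau wl))).
Proof.
rewrite /transition; case: pselect => // wk'; case: pselect => // wl'.
by rewrite (tau_irrelevance wk' wk) (tau_irrelevance wl' wl).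
Qed.

Lemma transition_cocycle k l m x : W k x -> W l x -> W m x ->
  (transition k l x * transition l m x = transition k m x)%g.
Proof.
by move=> wk wl wm; rewrite (transitionE wk wl) (transitionE wl wm) (transitionE wk wm)
  loop_class_divK.
Qed.

Variables (f : R -> X) (f_continuous : continuous f).
Variable p0 : {path I from x0 to f 0 in X}.

(** The tautological lift of [f]: follow [f] up to time [t], then close the loop by the path that
    the chart prescribes. *)
Definition path_section t k : pi1 R x0 :=
  match pselect (W k (f t)) with
  | left w => loop_class (path_cat (path_cat p0 (real_segment f_continuous 0 t))
                                   (path_rev (tau w)))
  | _ => 1%g
  end.

Lemma path_sectionE t k (w : W k (f t)) : path_section t k =
  loop_class (path_cat (path_cat p0 (real_segment f_continuous 0 t)) (path_rev (tau w))).
Proof. by rewrite /path_section; case: pselect => // w'; rewrite (tau_irrelevance w' w). Qed.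

Lemma path_section_lift : lift W transition f path_section.
Proof.
split=> [t k l wk wl|t k wk].
  by rewrite (path_sectionE wk) (path_sectionE wl) (transitionE wk wl) loop_class_divK.
have : \forall u \near t, W k (f u).
  exact: (f_continuous (open_nbhs_nbhs (conj (W_open k) wk))).
move=> /nbhs_ballP[e /= e0 eW]; apply/nbhs_ballP; exists e => //= u ue.
have wu : W k (f u) by exact: eW.
rewrite (path_sectionE wk) (path_sectionE wu).
rewrite -(@loop_class_divr _ _ _ _ _ (path_cat p0 (real_segment f_continuous 0 t)) (tau wk)
   (real_segment f_continuous t u)).
apply: loop_class_div_homotopic.
  apply: path_homotopic_trans
    (path_cat_homotopicr _ (path_homotopic_sym (real_segment_cat _ 0 t u))) _.
  exact: path_catA.
apply/path_homotopic_sym/tauP => s; rewrite real_segmentE; apply: eW.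
move: ue (I01_ge0 s) (I01_le1 s); rewrite /ball /= opprD addrA subrr sub0r normrN normrM.
move=> ue s0 s1; rewrite (ger0_norm s0) distrC; apply: le_lt_trans ue.
by rewrite ler_piMr.
Qed.

End PathLift.

(** * Contractible charts *)

Section StarCharts.
Variables (R : realType) (X : topologicalType) (W : set X) (b : X).
Variable H : X -> R -> X.
Local Notation I := (I01 R).
Hypothesis H_continuous : forall x s, W x -> 0 <= s <= 1 ->
  {for (x, s), continuous (fun u : X * R => H u.1 u.2)}.
Hypothesis H0 : forall x, W x -> H x 0 = b.
Hypothesis H1 : forall x, W x -> H x 1 = x.

Lemma star_path_continuous x : W x -> continuous (fun s : I => H x (I01_val s)).
Proof.
move=> Wx s; apply: (@continuous_comp _ _ _ (fun s : I => (x, I01_val s))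
  (fun u : X * R => H u.1 u.2)).
  by apply: continuous_couple; [exact: continuous_cst|exact: I01_val_continuous].
by apply: H_continuous => //; rewrite I01_ge0 I01_le1.
Qed.

Lemma star_path0 x : W x -> H x (I01_val (zero : I)) = b.
Proof. by move=> Wx; rewrite I01_val0 H0. Qed.

Lemma star_path1 x : W x -> H x (I01_val (one : I)) = x.
Proof. by move=> Wx; rewrite I01_val1 H1. Qed.

Definition star_path x (Wx : W x) : {path I from b to x in X} :=
  mk_path (star_path_continuous Wx) (star_path0 Wx) (star_path1 Wx).

Lemma star_pathE x (Wx : W x) t : star_path Wx t = H x (I01_val t).
Proof. by []. Qed.

(** [F] is a square whose lower edge is collapsed to [b], whose upper edge is [p] and whose vertical
    edges are the star paths of [x] and [y]. The two paths are the two halves of its boundary. *)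
Lemma star_path_cat x y (Wx : W x) (Wy : W y) (p : {path I from x to y in X}) :
  (forall t, W (p t)) -> path_homotopic (path_cat (star_path Wx) p) (star_path Wy).
Proof.
move=> Wp; apply: path_homotopic_trans (path_cat1p _).
pose F (u : R * R) := H (path_real p u.1) (I01_val (clamp u.2)).
have Fc : continuous F.
  move=> u; apply: (@continuous_comp _ _ _ (fun u : R * R => (path_real p u.1, I01_val (clamp u.2)))
    (fun u : X * R => H u.1 u.2)); last first.
    by apply: H_continuous; [exact: Wp|rewrite I01_ge0 I01_le1].
  apply: continuous_couple.
    exact: (continuous_circ (@continuous_fst _ _) (@path_real_continuous _ _ _ _ p)).
  exact: (continuous_circ (@continuous_snd _ _) (@continuous_clampR R)).
apply: (@plane_homotopic _ _ F Fc (0, 0) (1, 1) _ _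
  (path_cat (segment (0, 0) (0, 1)) (segment (0, 1) (1, 1)))
  (path_cat (segment (0, 0) (1, 0)) (segment (1, 0) (1, 1)))).
- apply: path_cat_comp => t; rewrite /F /= /mk_path /segment_fun /=.
    by rewrite subrr mul0r addr0 path_real0 add0r subr0 mul1r clamp_val.
  by rewrite subrr subr0 mul0r addr0 add0r mul1r /path_real clamp_val val_clamp// H1.
- apply: path_cat_comp => t; rewrite /F /= /mk_path /segment_fun /=.
    by rewrite subrr mul0r addr0 val_clamp// H0//; exact: Wp.
  by rewrite subrr subr0 mul0r addr0 add0r mul1r path_real1 clamp_val.
Qed.

End StarCharts.

(** * Complex functions and the twist *)

Section ContinuityAt.
Variables (T : topologicalType) (x : T).

Lemma for_comp (U V : topologicalType) (f : T -> U) (h : U -> V) :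
  {for x, continuous f} -> {for f x, continuous h} ->
  {for x, continuous (fun t => h (f t))}.
Proof. by move=> fc hc; exact: continuous_comp. Qed.

Lemma for_pair (U V : topologicalType) (f : T -> U) (h : T -> V) :
  {for x, continuous f} -> {for x, continuous h} ->
  {for x, continuous (fun t => (f t, h t))}.
Proof. by move=> fc hc; exact: cvg_pair. Qed.

Lemma for_cst (U : topologicalType) (a : U) : {for x, continuous (fun _ : T => a)}.
Proof. exact: cvg_cst. Qed.

Lemma for_fst (U V : topologicalType) (f : T -> U * V) :
  {for x, continuous f} -> {for x, continuous (fun t => (f t).1)}.
Proof. by move=> fc; apply: for_comp fc _; exact: cvg_fst. Qed.

Lemma for_snd (U V : topologicalType) (f : T -> U * V) :
  {for x, continuous f} -> {for x, continuous (fun t => (f t).2)}.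
Proof. by move=> fc; apply: for_comp fc _; exact: cvg_snd. Qed.

Section Field.
Variable F : numFieldType.
Implicit Types f h : T -> F.

Lemma for_add f h : {for x, continuous f} -> {for x, continuous h} ->
  {for x, continuous (fun t => f t + h t)}.
Proof. by move=> fc hc; exact: cvgD. Qed.

Lemma for_sub f h : {for x, continuous f} -> {for x, continuous h} ->
  {for x, continuous (fun t => f t - h t)}.
Proof. by move=> fc hc; exact: cvgB. Qed.

Lemma for_opp f : {for x, continuous f} -> {for x, continuous (fun t => - f t)}.
Proof. by move=> fc; exact: cvgN. Qed.

Lemma for_mul f h : {for x, continuous f} -> {for x, continuous h} ->
  {for x, continuous (fun t => f t * h t)}.
Proof. by move=> fc hc; exact: cvgM. Qed.

Lemma for_exp2 f : {for x, continuous f} -> {for x, continuous (fun t => f t ^+ 2)}.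
Proof. by move=> fc; exact: (for_mul fc fc). Qed.

Lemma for_inv f : f x != 0 -> {for x, continuous f} ->
  {for x, continuous (fun t => (f t)^-1)}.
Proof. by move=> fx fc; exact: cvgV. Qed.

Lemma for_div f h : h x != 0 -> {for x, continuous f} -> {for x, continuous h} ->
  {for x, continuous (fun t => f t / h t)}.
Proof. by move=> hx fc hc; apply: for_mul => //; exact: for_inv. Qed.

Lemma near_neq f a : {for x, continuous f} -> f x != a -> \forall t \near x, f t != a.
Proof.
move=> fc fx; apply: (fc [set y | y != a]).
apply/nbhs_ballP; exists `|f x - a| => /=; first by rewrite normr_gt0 subr_eq0.
by move=> y /=; rewrite /ball /=; apply: contraTneq => ->; rewrite ltxx.
Qed.

End Field.

Section Real.
Variable R : realType.
Implicit Types f h : T -> R.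

Lemma near_gt f a : {for x, continuous f} -> a < f x -> \forall t \near x, a < f t.
Proof. by move=> fc fx; apply: (fc [set y | a < y]); exact: lt_nbhsr. Qed.

Lemma near_lt f a : {for x, continuous f} -> f x < a -> \forall t \near x, f t < a.
Proof. by move=> fc fx; apply: (fc [set y | y < a]); exact: lt_nbhsl. Qed.

Lemma for_sqrt f : {for x, continuous f} -> {for x, continuous (fun t => Num.sqrt (f t))}.
Proof. by move=> fc; apply: for_comp fc _; exact: sqrt_continuous. Qed.

End Real.
End ContinuityAt.

Section Complex.
Variable R : realType.
Local Notation C := R[i].
Local Notation Re := complex.Re.
Local Notation Im := complex.Im.

Definition cabs (z : C) : R := Num.sqrt (Re z ^+ 2 + Im z ^+ 2).

Lemma normr_cabs (z : C) : `|z| = (cabs z)%:C%C.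
Proof. exact: normc_def. Qed.

Lemma cabs_ge0 z : 0 <= cabs z.
Proof. exact: sqrtr_ge0. Qed.

Lemma cabs_sqr z : cabs z ^+ 2 = Re z ^+ 2 + Im z ^+ 2.
Proof. by rewrite sqr_sqrtr// addr_ge0// sqr_ge0. Qed.

Lemma cabsM z w : cabs (z * w) = cabs z * cabs w.
Proof. by apply: (@complexI R); rewrite rmorphM /= -!normr_cabs normrM. Qed.

Lemma cabs_eq0 z : (cabs z == 0) = (z == 0).
Proof. by rewrite -(inj_eq (@complexI R)) -normr_cabs normr_eq0. Qed.

Lemma cabs_gt0 z : (0 < cabs z) = (z != 0).
Proof. by rewrite lt_def cabs_ge0 andbT cabs_eq0. Qed.

Lemma cabs1 : cabs 1 = 1.
Proof. by apply: (@complexI R); rewrite -normr_cabs normr1. Qed.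

Lemma cabsV z : cabs z^-1 = (cabs z)^-1.
Proof. by apply: (@complexI R); rewrite fmorphV /= -!normr_cabs normfV. Qed.

Lemma Re_le_cabs z : `|Re z| <= cabs z.
Proof. by rewrite -sqrtr_sqr ler_wsqrtr// lerDl sqr_ge0. Qed.

Lemma Im_le_cabs z : `|Im z| <= cabs z.
Proof. by rewrite -sqrtr_sqr ler_wsqrtr// lerDr sqr_ge0. Qed.

Lemma ReM (z w : C) : Re (z * w) = Re z * Re w - Im z * Im w.
Proof. by case: z w => [a b] [c d]. Qed.

Lemma ImM (z w : C) : Im (z * w) = Re z * Im w + Im z * Re w.
Proof. by case: z w => [a b] [c d]. Qed.

Lemma ReZ (a : R) (w : C) : Re (a%:C%C * w) = a * Re w.
Proof. by rewrite ReM /= mul0r subr0. Qed.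

Lemma ImZ (a : R) (w : C) : Im (a%:C%C * w) = a * Im w.
Proof. by rewrite ImM /= mul0r addr0. Qed.

Lemma ReB (z w : C) : Re (z - w) = Re z - Re w.
Proof. by case: z w => [a b] [c d]. Qed.

Lemma ImB (z w : C) : Im (z - w) = Im z - Im w.
Proof. by case: z w => [a b] [c d]. Qed.

Lemma ReD (z w : C) : Re (z + w) = Re z + Re w.
Proof. by case: z w => [a b] [c d]. Qed.

Lemma ImD (z w : C) : Im (z + w) = Im z + Im w.
Proof. by case: z w => [a b] [c d]. Qed.

Lemma ReN (z : C) : Re (- z) = - Re z.
Proof. by case: z. Qed.

Lemma ImN (z : C) : Im (- z) = - Im z.
Proof. by case: z. Qed.

Lemma complex_eqP (z w : C) : Re z = Re w -> Im z = Im w -> z = w.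
Proof. by case: z w => [a b] [c d] /= -> ->. Qed.

Lemma near_cabs (z : C) (e : R) : 0 < e -> \forall w \near z, cabs (z - w) < e.
Proof.
move=> e0; apply/nbhs_ballP; exists e%:C%C => /=; first by rewrite ltcR.
by move=> w; rewrite /ball /= normr_cabs ltcR.
Qed.

Lemma Re_continuous : continuous (fun z : C => Re z).
Proof.
move=> z A /nbhs_ballP[e /= e0 eA]; apply: filterS (near_cabs z e0) => w /= zw.
by apply: eA; rewrite /ball /= -ReB; apply: le_lt_trans zw; exact: Re_le_cabs.
Qed.

Lemma Im_continuous : continuous (fun z : C => Im z).
Proof.
move=> z A /nbhs_ballP[e /= e0 eA]; apply: filterS (near_cabs z e0) => w /= zw.
by apply: eA; rewrite /ball /= -ImB; apply: le_lt_trans zw; exact: Im_le_cabs.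
Qed.

Lemma cabs_le z : cabs z <= `|Re z| + `|Im z|.
Proof.
rewrite -(@ler_sqr R) ?nnegrE ?cabs_ge0 ?addr_ge0//.
rewrite cabs_sqr sqrrD !real_normK ?num_real// -addrA lerD2l addrC lerDl.
by rewrite mulrn_wge0// mulr_ge0.
Qed.

Section For.
Variables (T : topologicalType) (x : T).

Lemma forC_add (f h : T -> C) : {for x, continuous f} -> {for x, continuous h} ->
  {for x, continuous (fun t => f t + h t)}.
Proof. exact: (@for_add T x R[i] f h). Qed.

Lemma forC_mul (f h : T -> C) : {for x, continuous f} -> {for x, continuous h} ->
  {for x, continuous (fun t => f t * h t)}.
Proof. exact: (@for_mul T x R[i] f h). Qed.

Lemma forC_exp2 (f : T -> C) :
  {for x, continuous f} -> {for x, continuous (fun t => f t ^+ 2)}.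
Proof. exact: (@for_exp2 T x R[i] f). Qed.

Lemma forC_inv (f : T -> C) : f x != 0 -> {for x, continuous f} ->
  {for x, continuous (fun t => (f t)^-1)}.
Proof. exact: (@for_inv T x R[i] f). Qed.

Lemma forC_div (f h : T -> C) : h x != 0 -> {for x, continuous f} ->
  {for x, continuous h} -> {for x, continuous (fun t => f t / h t)}.
Proof. exact: (@for_div T x R[i] f h). Qed.

Lemma nearC_neq (f : T -> C) a : {for x, continuous f} -> f x != a ->
  \forall t \near x, f t != a.
Proof. exact: (@near_neq T x R[i] f a). Qed.

Lemma for_coords2 (f : T -> C * C) : {for x, continuous f} ->
  {for x, continuous (fun t => (f t).1)} /\ {for x, continuous (fun t => (f t).2)}.
Proof. by move=> fc; split; [exact: for_fst|exact: for_snd]. Qed.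

Lemma for_coords3 (f : T -> C * C * C) : {for x, continuous f} ->
  [/\ {for x, continuous (fun t => (f t).1.1)}, {for x, continuous (fun t => (f t).1.2)} &
      {for x, continuous (fun t => (f t).2)}].
Proof.
by move=> fc; split; [exact: for_fst (for_fst fc)|exact: for_snd (for_fst fc)|exact: for_snd].
Qed.

Lemma for_Re (f : T -> C) : {for x, continuous f} -> {for x, continuous (fun t => Re (f t))}.
Proof. by move=> fc; apply: for_comp fc _; exact: Re_continuous. Qed.

Lemma for_Im (f : T -> C) : {for x, continuous f} -> {for x, continuous (fun t => Im (f t))}.
Proof. by move=> fc; apply: for_comp fc _; exact: Im_continuous. Qed.

Lemma for_complex (f h : T -> R) : {for x, continuous f} -> {for x, continuous h} ->
  {for x, continuous (fun t => (f t +i* h t)%C)}.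
Proof.
move=> fc hc A /nbhs_ballP[ce /= ce0 eA].
have [e e0 ceE] : exists2 e : R, 0 < e & ce = e%:C%C.
  case: ce ce0 {eA} => e e'; rewrite ltcE /= => /andP[/eqP -> e0].
  by exists e.
rewrite {}ceE {ce ce0} in eA.
have e20 : 0 < e / 2 by rewrite divr_gt0.
have nf : \forall t \near x, ball (f x) (e / 2) (f t).
  by apply: (fc (ball (f x) (e / 2))); exact: nbhsx_ballx.
have nh : \forall t \near x, ball (h x) (e / 2) (h t).
  by apply: (hc (ball (h x) (e / 2))); exact: nbhsx_ballx.
change (\forall t \near x, A (f t +i* h t)%C).
near=> t; apply: eA.
rewrite /ball /= normr_cabs -/(real_complex_def _ _) ltcR.
apply: le_lt_trans (cabs_le _) _ => /=.
rewrite (splitr e); apply: ltrD.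
  by change (ball (f x) (e / 2) (f t)); near: t.
by change (ball (h x) (e / 2) (h t)); near: t.
Unshelve. all: by end_near. Qed.

Lemma for_real (f : T -> R) : {for x, continuous f} ->
  {for x, continuous (fun t => (f t)%:C%C)}.
Proof. by move=> fc; apply: for_complex => //; exact: for_cst. Qed.

Lemma for_cabs (f : T -> C) : {for x, continuous f} -> {for x, continuous (fun t => cabs (f t))}.
Proof.
by move=> fc; apply: for_sqrt; apply: for_add; apply: for_exp2; [exact: for_Re|exact: for_Im].
Qed.

End For.

(* The principal branch on the plane slit along the nonpositive reals. *)
Definition psqrt (u : C) : C :=
  let s := Num.sqrt ((cabs u + Re u) / 2) in (s +i* (Im u / (2 * s)))%C.

Definition off_npos (u : C) : bool := (Im u != 0) || (0 < Re u).

Lemma off_npos_gt0 u : off_npos u -> 0 < cabs u + Re u.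
Proof.
have := cabs_ge0 u; have := cabs_sqr u => E A.
have [Rpos|Rneg] := ltP 0 (Re u); first by move=> _; rewrite ltr_wpDl.
rewrite /off_npos ltNge Rneg orbF => I0.
have I2 : 0 < Im u ^+ 2 by rewrite exprn_even_gt0.
by rewrite ltNge; apply/negP => h; move: E I2; nra.
Qed.

Lemma psqrt_Re_gt0 u : off_npos u -> 0 < Re (psqrt u).
Proof. by move=> /off_npos_gt0 h; rewrite /= sqrtr_gt0 divr_gt0. Qed.

Lemma psqrt_sqr u : off_npos u -> psqrt u ^+ 2 = u.
Proof.
move=> hu; have := psqrt_Re_gt0 hu; rewrite /psqrt /=.
set s := Num.sqrt _ => s0.
have sE : s ^+ 2 = (cabs u + Re u) / 2.
  by rewrite sqr_sqrtr// divr_ge0// ltW// off_npos_gt0.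
have s1 : s != 0 by rewrite gt_eqF.
have E := cabs_sqr u.
apply: complex_eqP; rewrite expr2 ?ReM ?ImM /=; last by field.
apply: (@mulfI _ (4 * s ^+ 2)); first by rewrite mulf_neq0// expf_neq0.
have -> : 4 * s ^+ 2 * (s * s - Im u / (2 * s) * (Im u / (2 * s))) =
   4 * (s ^+ 2) ^+ 2 - Im u ^+ 2 by field.
have I2 : Im u ^+ 2 = cabs u ^+ 2 - Re u ^+ 2 by rewrite E addrAC subrr add0r.
by rewrite sE I2; field.
Qed.

Lemma psqrt_unique u z : z ^+ 2 = u -> 0 < Re z -> psqrt u = z.
Proof.
move=> zu z0.
have hu : off_npos u.
  rewrite -zu /off_npos expr2 ImM ReM; have [I0|//] /= := eqVneq (Im z) 0.
    by rewrite I0 !mulr0 mul0r addr0 eqxx /= subr0 mulr_gt0.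
  by move=> I0; rewrite mulrC -mulr2n -mulr_natl !mulf_neq0// ?pnatr_eq0// gt_eqF.
have : psqrt u ^+ 2 == z ^+ 2 by rewrite psqrt_sqr// zu.
rewrite eqf_sqr => /orP[/eqP//|/eqP E].
by have := psqrt_Re_gt0 hu; rewrite E ReN oppr_gt0 ltNge (ltW z0).
Qed.

Lemma for_psqrt (T : topologicalType) (x : T) (f : T -> C) : off_npos (f x) ->
  {for x, continuous f} -> {for x, continuous (fun t => psqrt (f t))}.
Proof.
move=> fx fc; have cs : {for x, continuous (fun t => Num.sqrt ((cabs (f t) + Re (f t)) / 2))}.
  apply: for_sqrt; apply: for_mul; last exact: for_cst.
  by apply: for_add; [exact: for_cabs|exact: for_Re].
apply: for_complex => //; apply: for_div; last first.
- by apply: for_mul => //; exact: for_cst.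
- exact: for_Im.
- by rewrite mulf_neq0// gt_eqF//; exact: (psqrt_Re_gt0 fx).
Qed.

Lemma near_off_npos (T : topologicalType) (x : T) (f : T -> C) : off_npos (f x) ->
  {for x, continuous f} -> \forall t \near x, off_npos (f t).
Proof.
move=> /orP[h|h] fc.
  by apply: filterS (near_neq (for_Im fc) h) => t ht; apply/orP; left.
by apply: filterS (near_gt (for_Re fc) h) => t ht; apply/orP; right.
Qed.

Lemma cexpD (s t : R) : cexp (s + t) = cexp s * cexp t.
Proof.
by apply: complex_eqP; rewrite ?ReM ?ImM /= ?cosD ?sinD// addrC mulrC [X in _ + X]mulrC.
Qed.

Lemma cexp0 : cexp (0 : R) = 1.
Proof. by rewrite /cexp cos0 sin0. Qed.

Lemma cexpN (t : R) : cexp (- t) = (cexp t)^-1.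
Proof.
have h : cexp (- t) * cexp t = 1 by rewrite -cexpD addNr cexp0.
have t0 : cexp t != 0 by apply: contra_eq_neq h => ->; rewrite mulr0 eq_sym oner_eq0.
by apply: (mulIf t0); rewrite h mulVf.
Qed.

Lemma cabs_cexp (t : R) : cabs (cexp t) = 1.
Proof. by rewrite /cabs /= cos2Dsin2 sqrtr1. Qed.

Lemma cexp_neq0 (t : R) : cexp t != 0.
Proof. by rewrite -cabs_eq0 cabs_cexp oner_eq0. Qed.

Lemma for_cexp (T : topologicalType) (x : T) (f : T -> R) :
  {for x, continuous f} -> {for x, continuous (fun t => cexp (f t))}.
Proof.
move=> fc; apply: for_complex.
  by apply: for_comp fc _; exact: continuous_cos.
by apply: for_comp fc _; exact: continuous_sin.
Qed.

Section Twist.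
Variable al : R.

(* A homeomorphism of the plane, multiplicative and preserving the modulus,
   which maps logarithmic spirals to half-lines. *)
Definition twist (w : C) : C := w * cexp (- (al * ln (cabs w))).

Lemma twist0 : twist 0 = 0.
Proof. by rewrite /twist mul0r. Qed.

Lemma twist1 : twist 1 = 1.
Proof. by rewrite /twist cabs1 ln1 mulr0 oppr0 cexp0 mulr1. Qed.

Lemma cabs_twist w : cabs (twist w) = cabs w.
Proof. by rewrite cabsM cabs_cexp mulr1. Qed.

Lemma twist_eq0 w : (twist w == 0) = (w == 0).
Proof. by rewrite -cabs_eq0 cabs_twist cabs_eq0. Qed.

Lemma twistM v w : twist (v * w) = twist v * twist w.
Proof.
have [->|v0] := eqVneq v 0; first by rewrite mul0r twist0 mul0r.
have [->|w0] := eqVneq w 0; first by rewrite mulr0 twist0 mulr0.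
rewrite /twist cabsM lnM ?posrE ?cabs_gt0// mulrDr opprD cexpD.
by rewrite !mulrA; congr (_ * _); rewrite mulrAC.
Qed.

Lemma twist_continuous : continuous twist.
Proof.
move=> w; have [->|w0] := eqVneq w 0; last first.
  change {for w, continuous (fun w : C => w * cexp (- (al * ln (cabs w))) : C)}.
  apply: forC_mul; first exact: cvg_id.
  apply: for_cexp; apply: for_opp; apply: for_mul; first exact: for_cst.
  apply: for_comp; first by apply: for_cabs; exact: cvg_id.
  by apply: continuous_ln; rewrite cabs_gt0.
(* The angle may be unbounded near 0, but the modulus is unchanged, so balls around 0 are
   preserved. *)
move=> A; rewrite twist0 => /nbhs_ballP[e /= e0 eA].
apply/nbhs_ballP; exists e => //= v ve; apply: eA; move: ve.
by rewrite /ball /= !sub0r !normrN !normr_cabs cabs_twist.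
Qed.

End Twist.

Lemma twistK al : cancel (twist al) (twist (- al)).
Proof.
move=> w; rewrite {1}/twist cabs_twist /twist mulNr opprK -mulrA -cexpD addNr.
by rewrite cexp0 mulr1.
Qed.

Lemma twist_inj al : injective (twist al).
Proof. exact: can_inj (twistK al). Qed.

End Complex.

(** * Charts of the complement of the conics *)

Section Model.
Variables (R : realType) (n : nat).
Local Notation C := R[i].
Local Notation Re := complex.Re.
Local Notation Im := complex.Im.
Local Notation C3 := (C * C * C)%type.
Variable mu : 'I_n -> C.
Hypothesis mu_Im : forall k, 0 < Im (mu k).

Lemma mu_neq0 k : mu k != 0.
Proof. by apply: contraTneq (mu_Im k) => ->; rewrite ltxx. Qed.

Definition off_conics (v : C3) : Prop :=
  forall k, v.1.1 * v.1.2 != mu k ^+ 2 * v.2 ^+ 2.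

Definition scale3 (c : C) (v : C3) : C3 := (c * v.1.1, c * v.1.2, c * v.2).

Lemma scale3_off_conics c v : c != 0 -> off_conics v -> off_conics (scale3 c v).
Proof.
move=> c0 hv k /=; apply: contra (hv k) => /eqP E; apply/eqP.
by apply: (mulfI (expf_neq0 2 c0)); move: E; rewrite !expr2 => E; ring: E.
Qed.

(** The plane without the real half-line from 1 to infinity; it is star-shaped about 0. *)
Definition slit (u : C) : bool := (Im u != 0) || (Re u < 1).

Lemma slit_scale (s : R) u : 0 <= s <= 1 -> slit u -> slit (s%:C%C * u).
Proof.
move=> /andP[s0 s1]; rewrite /slit ReZ ImZ.
have [->|sn0] := eqVneq s 0; first by rewrite !mul0r ltr01 orbT.
case/orP=> [h|h]; first by rewrite mulf_neq0.
apply/orP; right; have [h0|/ltW h0] := leP 0 (Re u); last first.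
  by apply: le_lt_trans ltr01; rewrite mulr_ge0_le0.
by apply: le_lt_trans h; rewrite ler_piMl.
Qed.

Lemma slit_sqr (u : C) : Im u != 0 -> slit (u ^+ 2).
Proof.
move=> u0; rewrite /slit expr2 ReM ImM.
have [r0|r0] := eqVneq (Re u) 0.
  have : 0 < Im u ^+ 2 by rewrite exprn_even_gt0.
  by rewrite r0; move=> h; apply/orP; right; nra.
by apply/orP; left; rewrite [X in _ + X]mulrC -mulr2n -mulr_natl !mulf_neq0 ?pnatr_eq0.
Qed.

Lemma near_slit (T : topologicalType) (x : T) (f : T -> C) : slit (f x) ->
  {for x, continuous f} -> \forall t \near x, slit (f t).
Proof.
move=> /orP[h|h] fc.
  by apply: filterS (near_neq (for_Im fc) h) => t ht; apply/orP; left.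
by apply: filterS (near_lt (for_Re fc) h) => t ht; apply/orP; right.
Qed.

(** For [true] the right half-plane with centre 1, for [false] the upper one with centre i; [root b]
    is the branch of the square root with values in [half b]. The factor [eta b ^+ 2] is a sign,
    which places the cut on the negative or on the positive reals. *)
Definition eta (b : bool) : C := if b then 1 else 'i%C.
Definition half (b : bool) (r : C) : bool := if b then 0 < Re r else 0 < Im r.
Definition root b (u : C) : C := eta b * psqrt (eta b ^+ 2 * u).

Lemma eta4 b : eta b ^+ 2 * eta b ^+ 2 = 1.
Proof. by case: b; rewrite /eta ?expr1n ?mul1r// sqr_i mulrNN mulr1. Qed.

Lemma half_eta b z : half b (eta b * z) = (0 < Re z).
Proof. by case: b; rewrite /half /eta ?mul1r// ImM /= mul0r add0r mul1r. Qed.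

Lemma half_neq0 b r : half b r -> r != 0.
Proof. by case: b => /= h; apply: contraTneq h => ->; rewrite ltxx. Qed.

Lemma eta_half b : half b (eta b).
Proof. by case: b => /=; rewrite ltr01. Qed.

Lemma root_sqr b u : off_npos (eta b ^+ 2 * u) -> root b u ^+ 2 = u.
Proof. by move=> h; rewrite /root exprMn psqrt_sqr// mulrA eta4 mul1r. Qed.

Lemma root_half b u : off_npos (eta b ^+ 2 * u) -> half b (root b u).
Proof. by move=> h; rewrite half_eta psqrt_Re_gt0. Qed.

Lemma eta_neq0 b : eta b != 0.
Proof. exact: half_neq0 (eta_half b). Qed.

Lemma root_unique b r : half b r -> off_npos (eta b ^+ 2 * r ^+ 2) /\ root b (r ^+ 2) = r.
Proof.
move=> hr; have [z rE] : exists z, r = eta b * z.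
  by exists ((eta b)^-1 * r); rewrite mulrA mulfV ?mul1r ?eta_neq0.
have z0 : 0 < Re z by rewrite -(half_eta b) -rE.
have E : eta b ^+ 2 * r ^+ 2 = z ^+ 2 by rewrite rE exprMn mulrA eta4 mul1r.
rewrite /root E (psqrt_unique erefl z0) -rE; split=> //.
have [I0|I0] := eqVneq (Im z) 0; rewrite /off_npos expr2 ImM ReM.
  by apply/orP; right; rewrite I0 mulr0 subr0 mulr_gt0.
by apply/orP; left; rewrite [X in _ + X]mulrC -mulr2n -mulr_natl !mulf_neq0 ?pnatr_eq0// gt_eqF.
Qed.

(* Chart None is the complement of the half-lines [1,oo) * mu k ^ 2 in the
   coordinate t = xy / z^2, which contracts to [0:0:1].  In terms of 1/t its
   complement is contracted to the line z = 0, where x / y is a coordinate in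
   C^*; the charts Some b cut C^* along the negative and the positive reals. *)
Definition chart (k : option bool) (v : C3) : Prop :=
  match k with
  | None => v.2 != 0 /\ forall j, slit (v.1.1 * v.1.2 / (mu j ^+ 2 * v.2 ^+ 2))
  | Some b => [/\ v.1.1 != 0, v.1.2 != 0, off_npos (eta b ^+ 2 * (v.1.1 / v.1.2)) &
      forall j, slit (mu j ^+ 2 * v.2 ^+ 2 / (v.1.1 * v.1.2))]
  end.

(** Near z = 0 the representative is scaled so that its first two coordinates are [r] and [r^-1].
    This leaves a sign free, which the half-plane [half b] fixes; the third coordinate w then
    satisfies w^2 = z^2 / (xy). *)
Definition chart_coord (k : option bool) (v : C3) : C * C :=
  match k with
  | None => (v.1.1 / v.2, v.1.2 / v.2)
  | Some b => let r := root b (v.1.1 / v.1.2) in (r, v.2 / (v.1.2 * r))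
  end.

Definition chart_dom (k : option bool) (e : C * C) : Prop :=
  match k with
  | None => forall j, slit (e.1 * e.2 / mu j ^+ 2)
  | Some b => half b e.1 /\ forall j, slit (mu j ^+ 2 * e.2 ^+ 2)
  end.

Definition chart_point (k : option bool) (e : C * C) : C3 :=
  match k with
  | None => (e.1, e.2, 1)
  | Some b => (e.1, e.1^-1, e.2)
  end.

Definition chart_center (k : option bool) : C * C :=
  match k with None => (0, 0) | Some b => (eta b, 0) end.

Definition chart_ray (k : option bool) (e : C * C) (s : R) : C * C :=
  ((1 - s)%:C%C * (chart_center k).1 + s%:C%C * e.1, s%:C%C * e.2).

Lemma chart_dom_coord k v : chart k v -> chart_dom k (chart_coord k v).
Proof.
case: k => [b|] /=.
  move=> [x0 y0 h hs]; split=> [|j]; first exact: root_half.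
  have := hs j; congr slit.
  have r2 := root_sqr h; have r0 := half_neq0 (root_half h).
  set r := root b _ in r2 r0 *; rewrite exprMn exprVn exprMn r2.
  by field; rewrite x0 y0.
move=> [z0 hs] j; have := hs j; congr slit; field.
by rewrite z0 mu_neq0.
Qed.

Lemma chart_chart_point k e : chart_dom k e -> chart k (chart_point k e).
Proof.
case: k => [b|] /=.
  move=> [hr hs]; have r0 := half_neq0 hr; split=> //.
  - by rewrite invr_eq0.
  - by rewrite invrK -expr2; have [] := root_unique hr.
  - by move=> j; rewrite mulfV// divr1.
move=> hs; split=> [|j]; first exact: oner_neq0.
by rewrite expr1n mulr1.
Qed.

Lemma slit1 : slit 1 = false.
Proof. by rewrite /slit eqxx ltxx. Qed.

Lemma chart_off_conics k v : chart k v -> off_conics v.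
Proof.
case: k => [b|] /= => [[x0 y0 _ hs]|[z0 hs]] j; apply: contraTneq (hs j) => E.
  by rewrite -E mulfV ?slit1// mulf_neq0.
by rewrite E mulfV ?slit1// mulf_neq0// expf_neq0// mu_neq0.
Qed.

Lemma chart_pointK k v : chart k v ->
  exists2 c, c != 0 & v = scale3 c (chart_point k (chart_coord k v)).
Proof.
case: v => [[x y] z]; case: k => [b|] /=.
  move=> [x0 y0 h hs]; have r2 := root_sqr h; have r0 := half_neq0 (root_half h).
  set r := root b _ in r2 r0 *; exists (y * r); first by rewrite mulf_neq0.
  rewrite /scale3 /=; congr (_, _, _).
  - by rewrite -mulrA -expr2 r2 mulrC mulfVK.
  - by rewrite mulfK.
  - by rewrite mulrC mulfVK// mulf_neq0.
move=> [z0 hs]; exists z => //; rewrite /scale3 /=; congr (_, _, _).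
- by rewrite mulrC mulfVK.
- by rewrite mulrC mulfVK.
- by rewrite mulr1.
Qed.

Lemma chart_coord_scale k c v : c != 0 -> chart_coord k (scale3 c v) = chart_coord k v.
Proof.
move=> c0; have cancel a d : (c * a) / (c * d) = a / d.
  by rewrite -mulf_div mulfV// mul1r.
by case: k => [b|] /=; rewrite ?cancel// -[c * v.1.2 * _]mulrA cancel.
Qed.

Lemma chart_scale k c v : c != 0 -> chart k v -> chart k (scale3 c v).
Proof.
move=> c0; have cancel a d : (c * a) / (c * d) = a / d.
  by rewrite -mulf_div mulfV// mul1r.
have cc : c * c != 0 by rewrite mulf_neq0.
have cancel2 a d : (c * c * a) / (c * c * d) = a / d.
  by rewrite -mulf_div mulfV// mul1r.
case: k => [b|] /= [].
  move=> x0 y0 h hs; split; rewrite ?mulf_neq0 ?cancel//.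
  by move=> j; rewrite [c * _ * _]mulrACA exprMn [mu j ^+ 2 * _]mulrCA cancel2.
move=> z0 hs; split; rewrite ?mulf_neq0// => j.
by rewrite [c * _ * _]mulrACA exprMn [mu j ^+ 2 * _]mulrCA cancel2.
Qed.

(** Along a ray the quantity tested by [slit] is multiplied by s^2, and [half b] is convex. *)
Lemma chart_ray_dom k e s : 0 <= s <= 1 -> chart_dom k e -> chart_dom k (chart_ray k e s).
Proof.
move=> s01; have s201 : 0 <= s * s <= 1.
  by case/andP: s01 => s0 s1; rewrite mulr_ge0//= mulr_ile1.
rewrite /chart_ray; case: k => [b|] /=; last first.
  move=> hs j; have := slit_scale s201 (hs j); congr slit.
  by rewrite mulr0 add0r rmorphM /= -!mulrA; congr (_ * _); rewrite mulrCA.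
case=> hr hs; split=> [|j]; last first.
  by have := slit_scale s201 (hs j); congr slit; rewrite rmorphM /= exprMn mulrCA expr2.
case/andP: s01 => s0 s1; case: b hr {hs} => /= hr.
  rewrite ReD !ReM /= !mul0r !subr0 mulr1.
  have [->|sn0] := eqVneq s 0; first by rewrite mul0r subr0 addr0.
  by rewrite ltr_wpDl ?subr_ge0// mulr_gt0// lt_def sn0.
rewrite ImD !ImM /= !mul0r !addr0 mulr1.
have [->|sn0] := eqVneq s 0; first by rewrite mul0r subr0 addr0.
by rewrite ltr_wpDl ?subr_ge0// mulr_gt0// lt_def sn0.
Qed.

Lemma chart_ray0 k e : chart_ray k e 0 = chart_center k.
Proof.
rewrite /chart_ray subr0 !mul0r addr0 mul1r [RHS]surjective_pairing.
by congr (_, _); case: k.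
Qed.

Lemma chart_ray1 k e : chart_ray k e 1 = e.
Proof. by rewrite /chart_ray subrr !mul1r mul0r add0r -surjective_pairing. Qed.

(** A point with z nonzero outside chart [None] has t = xy / (mu_k^2 z^2) real and at least 1 for
    some k, and t is not 1 off the conic k. The quantity tested for j at infinity is (mu_j^2 /
    mu_k^2) / t: it is less than 1 for j = k and, by the hypothesis on the arguments, never a
    positive real otherwise. *)
Lemma off_conics_chart (i0 : 'I_n) :
  (forall j k, j != k -> Im (mu j ^+ 2 / mu k ^+ 2) = 0 -> Re (mu j ^+ 2 / mu k ^+ 2) < 0) ->
  forall v, off_conics v -> exists k, chart k v.
Proof.
move=> mu_arg [[x y] z] hv; rewrite /off_conics /= in hv.
have inf_chart : x != 0 -> y != 0 ->
    (forall j, slit (mu j ^+ 2 * z ^+ 2 / (x * y))) -> exists k, chart k (x, y, z).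
  move=> x0 y0 hs; have [h|h] := boolP (off_npos (x / y)).
    by exists (Some true); split=> //=; rewrite expr1n mul1r.
  exists (Some false); split=> //=; rewrite sqr_i mulN1r.
  move: h; rewrite /off_npos ReN ImN oppr_eq0 negb_or negbK -leNgt => /andP[/eqP I0].
  rewrite le_eqVlt => /orP[/eqP R0|R0]; last by rewrite oppr_gt0 R0 orbT.
  have : x / y == 0 by apply/eqP/complex_eqP.
  by rewrite mulf_eq0 invr_eq0 (negbTE x0) (negbTE y0).
have [z0|z0] := eqVneq z 0.
  have xy0 : x * y != 0.
    by have := hv i0; rewrite z0 expr0n mulr0.
  apply: inf_chart => [||j].
  - by apply: contraNneq xy0 => ->; rewrite mul0r.
  - by apply: contraNneq xy0 => ->; rewrite mulr0.
  - by rewrite z0 expr0n mulr0 mul0r /slit ltr01 orbT.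
have m0 k : mu k ^+ 2 * z ^+ 2 != 0 by rewrite mulf_neq0// expf_neq0// mu_neq0.
have [[k]|hN] := pselect (exists k, ~~ slit (x * y / (mu k ^+ 2 * z ^+ 2))); last first.
  by exists None; split=> //= j; apply: contrapT => /negP h; apply: hN; exists j.
rewrite /slit negb_or negbK -leNgt => /andP[/eqP I0 R1].
have xy0 : x * y != 0.
  by apply: contraTneq R1 => ->; rewrite mul0r /= -ltNge ltr01.
apply: inf_chart => [||j].
- by apply: contraNneq xy0 => ->; rewrite mul0r.
- by apply: contraNneq xy0 => ->; rewrite mulr0.
set t := x * y / _ in I0 R1.
have tE : t = (Re t)%:C%C by apply: complex_eqP.
have t0 : 0 < Re t by apply: lt_le_trans R1.
have t1 : Re t != 1.
  apply: contra (hv k) => /eqP t1; apply/eqP.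
  have -> : x * y = t * (mu k ^+ 2 * z ^+ 2) by rewrite mulfVK.
  by rewrite tE t1 mul1r.
have -> : mu j ^+ 2 * z ^+ 2 / (x * y) = ((Re t)^-1)%:C%C * (mu j ^+ 2 / mu k ^+ 2).
  have /andP[x0 y0] : (x != 0) && (y != 0) by rewrite -negb_or -mulf_eq0.
  rewrite fmorphV /= -tE /t; field.
  by rewrite ?x0 ?y0 ?z0 ?mu_neq0.
have [->|jk] := eqVneq j k.
  rewrite mulfV ?expf_neq0 ?mu_neq0// mulr1 /slit /= eqxx /=.
  by rewrite invf_lt1// lt_def t1.
rewrite /slit ReZ ImZ.
have [I1|I1] := eqVneq (Im (mu j ^+ 2 / mu k ^+ 2)) 0; last first.
  by rewrite mulf_neq0// invr_eq0 gt_eqF.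
apply/orP; right; apply: lt_trans ltr01.
by rewrite pmulr_rlt0 ?invr_gt0// mu_arg.
Qed.

Section Continuity.
Variables (T : topologicalType) (x : T).

Lemma for_chart_coord k (f : T -> C3) : chart k (f x) -> {for x, continuous f} ->
  {for x, continuous (fun t => chart_coord k (f t))}.
Proof.
move=> h fc.
have [f1 f2 f3] := for_coords3 fc.
case: k h => [b|] /= [].
  move=> x0 y0 hr _.
  have uc : {for x, continuous (fun t => (f t).1.1 / (f t).1.2)}.
    exact: forC_div.
  have rc : {for x, continuous (fun t => root b ((f t).1.1 / (f t).1.2))}.
    apply: forC_mul; first exact: for_cst.
    apply: (@for_psqrt _ _ _ (fun t => eta b ^+ 2 * ((f t).1.1 / (f t).1.2)) hr).
    by apply: forC_mul; [exact: for_cst|exact: uc].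
  have d0 : (f x).1.2 * root b ((f x).1.1 / (f x).1.2) != 0.
    by rewrite mulf_neq0// (half_neq0 (root_half hr)).
  apply: (for_pair rc).
  exact: (@forC_div _ T x (fun t => (f t).2)
    (fun t => (f t).1.2 * root b ((f t).1.1 / (f t).1.2)) d0 f3 (forC_mul f2 rc)).
by move=> z0 _; apply: for_pair;
  [exact: (@forC_div _ T x (fun t => (f t).1.1) (fun t => (f t).2) z0 f1 f3)
  |exact: (@forC_div _ T x (fun t => (f t).1.2) (fun t => (f t).2) z0 f2 f3)].
Qed.

Lemma for_chart_point k (f : T -> C * C) : chart_dom k (f x) -> {for x, continuous f} ->
  {for x, continuous (fun t => chart_point k (f t))}.
Proof.
move=> h fc; have [f1 f2] := for_coords2 fc.
case: k h => [b|] /=.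
  move=> [hr _]; apply: for_pair; last exact: f2.
  apply: for_pair; first exact: f1.
  by apply: forC_inv; [exact: half_neq0 hr|exact: f1].
move=> _; apply: for_pair; last exact: for_cst.
by apply: for_pair; [exact: f1|exact: f2].
Qed.

Lemma for_chart_ray k (f : T -> C * C) (s : T -> R) : {for x, continuous f} ->
  {for x, continuous s} -> {for x, continuous (fun t => chart_ray k (f t) (s t))}.
Proof.
move=> fc sc; have [f1 f2] := for_coords2 fc.
have rc : {for x, continuous (fun t => (s t)%:C%C)} by exact: for_real.
apply: for_pair; last by apply: forC_mul; [exact: rc|exact: f2].
apply: forC_add; apply: forC_mul.
- by apply: for_real; apply: for_sub; [exact: for_cst|exact: sc].
- exact: for_cst.
- exact: rc.
- exact: f1.
Qed.

Lemma near_chart k (f : T -> C3) : chart k (f x) -> {for x, continuous f} ->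
  \forall t \near x, chart k (f t).
Proof.
move=> h fc.
have [f1 f2 f3] := for_coords3 fc.
case: k h => [b|] /= [].
  move=> x0 y0 hr hs.
  have uc : {for x, continuous (fun t => (f t).1.1 / (f t).1.2)}.
    exact: forC_div.
  have pc : {for x, continuous (fun t => (f t).1.1 * (f t).1.2)}.
    exact: forC_mul.
  have n1 : \forall t \near x, (f t).1.1 != 0 := nearC_neq f1 x0.
  have n2 : \forall t \near x, (f t).1.2 != 0 := nearC_neq f2 y0.
  have n3 : \forall t \near x, off_npos (eta b ^+ 2 * ((f t).1.1 / (f t).1.2)).
    apply: near_off_npos; first exact: hr.
    by apply: forC_mul; [exact: for_cst|exact: uc].
  have n4 : \forall t \near x, forall j,
      slit (mu j ^+ 2 * (f t).2 ^+ 2 / ((f t).1.1 * (f t).1.2)).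
    apply: filter_forall => j; apply: near_slit; first exact: hs.
    apply: forC_div.
    - by rewrite mulf_neq0.
    - by apply: forC_mul; [exact: for_cst|exact: (forC_exp2 f3)].
    - exact: pc.
  by near=> t; split; near: t.
move=> z0 hs.
have pc : {for x, continuous (fun t => (f t).1.1 * (f t).1.2)}.
  exact: forC_mul.
have n1 : \forall t \near x, (f t).2 != 0 := nearC_neq f3 z0.
have n4 : \forall t \near x, forall j,
    slit ((f t).1.1 * (f t).1.2 / (mu j ^+ 2 * (f t).2 ^+ 2)).
  apply: filter_forall => j; apply: near_slit; first exact: hs.
    apply: forC_div.
  - by rewrite mulf_neq0// expf_neq0// mu_neq0.
  - exact: pc.
  - by apply: forC_mul; [exact: for_cst|exact: (forC_exp2 f3)].
by near=> t; split; near: t.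
Unshelve. all: by end_near. Qed.

End Continuity.

(* [ell k m < 0] when m lies to the left of the line directed by [mu k]. *)
Definition ell (k : 'I_n) (m : C) : R := Re m * Im (mu k) - Im m * Re (mu k).

Lemma ell_mul k u : ell k (u * mu k) = - (Im u * cabs (mu k) ^+ 2).
Proof. by rewrite /ell ReM ImM cabs_sqr; ring. Qed.

Lemma ellN k m : ell k (- m) = - ell k m.
Proof. by rewrite /ell ReN ImN; ring. Qed.

Lemma ell_eq0 k m : (ell k m == 0) = (Im (m / mu k) == 0).
Proof.
rewrite -{1}(mulfVK (mu_neq0 k) m) ell_mul oppr_eq0 mulf_eq0 expf_eq0 /=.
by rewrite cabs_eq0 (negbTE (mu_neq0 k)) orbF.
Qed.

Lemma ImV_eq0 (u : C) : (Im u^-1 == 0) = (Im u == 0).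
Proof.
have key (w : C) : Im w = 0 -> Im w^-1 = 0.
  move=> w0; have -> : w = (Re w)%:C%C by apply: complex_eqP.
  by rewrite -fmorphV.
by apply/eqP/eqP => /key; rewrite ?invrK.
Qed.

Definition generic (m : C) : Prop := forall k, ell k m != 0.

Definition sector_point (r m : C) : C3 := (r * m, m / r, 1).

Lemma generic_neq0 (i0 : 'I_n) m : generic m -> m != 0.
Proof.
move=> /(_ i0); apply: contra_neq => ->.
by rewrite /ell !mul0r subrr.
Qed.

Lemma genericN m : generic m -> generic (- m).
Proof. by move=> h k; rewrite ellN oppr_eq0. Qed.

Lemma generic_slit (i0 : 'I_n) m k : generic m ->
  slit (m ^+ 2 / mu k ^+ 2) /\ slit (mu k ^+ 2 / m ^+ 2).
Proof.
move=> hm; have m0 := generic_neq0 i0 hm.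
rewrite -!expr_div_n; split; apply: slit_sqr.
  by rewrite -ell_eq0.
by rewrite -ImV_eq0 invf_div -ell_eq0.
Qed.

Lemma sector_point_chart (i0 : 'I_n) b r m : half b r -> generic m ->
  [/\ chart None (sector_point r m), chart (Some b) (sector_point r m) &
      chart_coord (Some b) (sector_point r m) = (r, m^-1)].
Proof.
move=> hr hm; have m0 := generic_neq0 i0 hm; have r0 := half_neq0 hr.
have rm : r * m * (m / r) = m ^+ 2 by field.
have rr : r * m / (m / r) = r ^+ 2 by field; rewrite m0 r0.
have [h1 h2] := root_unique hr.
rewrite /chart /chart_coord /sector_point /= rm rr h2; split.
- split=> [|j]; first exact: oner_neq0.
  by rewrite expr1n mulr1; have [] := generic_slit i0 j hm.
- split=> //; rewrite ?mulf_neq0 ?invr_eq0//.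
  by move=> j; rewrite expr1n mulr1; have [] := generic_slit i0 j hm.
- by congr (_, _); field; rewrite m0 r0.
Qed.

(** If m were on the line of mu_k, then u = m / mu_k would be real, and the slit conditions of the
    two charts would give both u^2 < 1 and u^-2 < 1. *)
Lemma chart_sector_point b v : chart None v -> chart (Some b) v ->
  let e := chart_coord (Some b) v in
  [/\ half b e.1, generic e.2^-1 & exists2 c, c != 0 & v = scale3 c (sector_point e.1 e.2^-1)].
Proof.
case: v => [[x y] z] [/= z0 hs] [/= x0 y0 hr hs'].
have r2 := root_sqr hr; have r0 := half_neq0 (root_half hr).
have hh := root_half hr.
set r := root b _ in r2 r0 hh *; split=> //.
  move=> k; rewrite ell_eq0; apply/negP => /eqP I0.
  set u := _ / mu k in I0.
  have uE : u = (Re u)%:C%C by apply: complex_eqP.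
  have u0 : Re u != 0.
    have u0 : u != 0.
      apply: mulf_neq0; last by rewrite invr_eq0 mu_neq0.
      by rewrite invr_eq0; apply: mulf_neq0 => //; rewrite invr_eq0 mulf_neq0.
    by apply: contraNneq u0 => h; apply/eqP/complex_eqP.
  have xE : x = y * r ^+ 2 by rewrite r2 mulrC mulfVK.
  have tE : x * y / (mu k ^+ 2 * z ^+ 2) = (Re u ^+ 2)%:C%C.
    rewrite rmorphXn /= -uE /u xE; field.
    by rewrite ?mu_neq0 ?z0 ?y0 ?r0.
  have tE' : mu k ^+ 2 * z ^+ 2 / (x * y) = (Re u ^- 2)%:C%C.
    by rewrite fmorphV /= -tE invf_div.
  have := hs k; have := hs' k; rewrite tE tE' /slit /= eqxx /= => h1 h2.
  have u2 : 0 < Re u ^+ 2 by rewrite exprn_even_gt0.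
  by move: h1; rewrite invf_lt1// ltNge (ltW h2).
exists z => //; rewrite /scale3 /sector_point /= invf_div; congr (_, _, _).
- have -> : x = y * r ^+ 2 by rewrite r2 mulrC mulfVK.
  by field; rewrite ?z0.
- by field; rewrite ?z0 ?r0.
- by rewrite mulr1.
Qed.

(** The two charts take the square root of x / y in the right and in the upper half-plane. The roots
    agree when x / y is in the upper half-plane and are opposite otherwise, which flips both
    coordinates. *)
Lemma chart_overlap v : chart (Some true) v -> chart (Some false) v ->
  Im (v.1.1 / v.1.2) != 0 /\
  chart_coord (Some false) v = let e := chart_coord (Some true) v in
    if 0 < Im (v.1.1 / v.1.2) then e else (- e.1, - e.2).
Proof.
case: v => [[x y] z] [/= x0 y0 h1 hs] [/= _ _ h2 _].
have r2 := @root_sqr true _ h1; have r0 := @root_half true _ h1; rewrite /= in r0.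
have I0 : Im (x / y) != 0.
  move: h1 h2; rewrite expr1n mul1r sqr_i mulN1r /off_npos ReN ImN oppr_eq0.
  by case: eqP => //= _ p1; rewrite oppr_gt0 ltNge (ltW p1).
split=> //; set r := root true _ in r2 r0 *.
have IE : Im (x / y) = 2 * (Re r * Im r).
  by rewrite -r2 expr2 ImM; ring.
rewrite {1}IE pmulr_rgt0// pmulr_rgt0//.
case: ltP => Ir.
  have hr : half false r by [].
  by rewrite -r2; have [_ ->] := root_unique hr.
have hr : half false (- r).
  rewrite /half ImN oppr_gt0 lt_def Ir andbT.
  by apply: contra_neq I0 => E; rewrite IE -E !mulr0.
rewrite -r2 -sqrrN; have [_ ->] := root_unique hr.
by rewrite mulrN invrN mulrN.
Qed.

(** The determinant of [mu j] and [mu k] is positive: the arguments, all strictly between 0 and pi,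
    increase with the index. *)
Hypothesis mu_sorted : forall j k : 'I_n, (j < k)%N ->
  Re (mu k) * Im (mu j) < Re (mu j) * Im (mu k).

(** The identity [E] is the Pluecker relation between the determinants of 1, m, mu_j and mu_k; in
    the upper half-plane the signs on its right side are known. *)
Lemma ell_lt0_upper m (j k : 'I_n) : 0 <= Im m -> (j < k)%N ->
  ell k m < 0 -> ell j m < 0.
Proof.
move=> m0 /mu_sorted jk; rewrite /ell; have := mu_Im j; have := mu_Im k.
move: (Re (mu k)) (Im (mu k)) (Re (mu j)) (Im (mu j)) jk => a b c d h b0 d0 hk.
have E : b * (Re m * d - Im m * c) = d * (Re m * b - Im m * a) - Im m * (c * b - a * d) by ring.
rewrite -(pmulr_rlt0 _ b0) E subr_lt0.
apply: lt_le_trans (_ : 0 <= _); first by rewrite pmulr_rlt0.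
by rewrite mulr_ge0// subr_ge0 ltW.
Qed.

(** The quotient of [mu j] by [mu k] is not real, and the square of a non-real number is real only
    if that number is purely imaginary. *)
Lemma mu_arg (j k : 'I_n) : j != k ->
  Im (mu j ^+ 2 / mu k ^+ 2) = 0 -> Re (mu j ^+ 2 / mu k ^+ 2) < 0.
Proof.
move=> jk; rewrite -expr_div_n.
have key (u : C) : Im u != 0 -> Im (u ^+ 2) = 0 -> Re (u ^+ 2) < 0.
  rewrite expr2 ImM ReM => u0 E.
  have /eqP -> : Re u == 0.
    move/eqP: E; rewrite [X in _ + X]mulrC -mulr2n -mulr_natl !mulf_eq0 pnatr_eq0 /=.
    by rewrite (negbTE u0) orbF.
  have : 0 < Im u ^+ 2 by rewrite exprn_even_gt0.
  by rewrite mul0r sub0r oppr_lt0 expr2.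
apply: key; rewrite -ell_eq0.
rewrite /ell; have [lt_jk|lt_kj|E] := ltngtP (val j) (val k).
- by rewrite gt_eqF// subr_gt0 [ltLHS]mulrC; have := mu_sorted lt_jk; rewrite [ltLHS]mulrC.
- by rewrite lt_eqF// subr_lt0 [ltRHS]mulrC; have := mu_sorted lt_kj; rewrite [ltRHS]mulrC.
- by case/eqP: jk; exact: val_inj.
Qed.

End Model.

(** * The fundamental group of the complement *)

Section LoopSection.
Variables (R : realType) (X : topologicalType) (x0 : X) (K : Type) (W : K -> set X).
Local Notation I := (I01 R).
Variable tau : forall k x, W k x -> {path I from x0 to x in X}.
Hypothesis W_open : forall k, open (W k).
Hypothesis tauP : forall k x y (wx : W k x) (wy : W k y)
  (p : {path I from x to y in X}), (forall t, W k (p t)) ->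
  path_homotopic (path_cat (tau wx) p) (tau wy).

Lemma path_section_class (f : R -> X) (fc : continuous f) (q : {path I from x0 to f 0 in X})
    t k y (e : f t = y) (w : W k y) (r : {path I from x0 to y in X}) :
  (forall s, r s = path_cat q (real_segment fc 0 t) s) ->
  path_section tau fc q t k = loop_class (path_cat r (path_rev (tau w))).
Proof.
case: y / e w r => w r /path_eqP ->; exact: path_sectionE.
Qed.

Lemma loop_section (y : X) (s : {path I from x0 to y in X}) (p : {path I from y to y in X}) :
  exists L, [/\ lift W (transition tau) (path_real p) L,
    forall k (w : W k y), L 0%R k = loop_class (path_cat s (path_rev (tau w))) &
    forall k (w : W k y), L 1%R k = loop_class (path_cat (path_cat s p) (path_rev (tau w)))].
Proof.
have pc := @path_real_continuous R X _ _ p.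
have e0 : path_real p 0 = y := path_real0 p.
have e1 : path_real p 1 = y := path_real1 p.
have s1 : s one = path_real p 0 by rewrite e0 path_one.
pose q : {path I from x0 to path_real p 0 in X} := mk_path cts_fun (@path_zero _ _ _ _ s) s1.
exists (path_section tau pc q); split.
- exact: path_section_lift.
- move=> k w; rewrite (@path_section_class _ pc q 0 k y e0 w (path_cat s (path_cst R y))).
    by apply: loop_class_div_homotopic; [exact: path_catp1|exact: path_homotopic_refl].
  move=> t; rewrite !path_catE /path_cat_fun; case: ifP => // _.
  by rewrite real_segmentE subrr mul0r addr0 e0.
- move=> k w; rewrite (@path_section_class _ pc q 1 k y e1 w (path_cat s p))//.
  move=> t; rewrite !path_catE /path_cat_fun; case: ifP => // _.
  by rewrite real_segmentE add0r subr0 mul1r /path_real clamp_val.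
Qed.

End LoopSection.

Section Core.
Variables (R : realType) (n' : nat).
Local Notation n := n'.+1.
Local Notation C := R[i].
Local Notation Re := complex.Re.
Local Notation Im := complex.Im.
Local Notation C3 := (C * C * C)%type.
Local Notation I := (I01 R).
Variable mu : 'I_n -> C.
Hypothesis mu_Im : forall k, 0 < Im (mu k).
Hypothesis mu_sorted : forall j k : 'I_n, (j < k)%N ->
  Re (mu k) * Im (mu j) < Re (mu j) * Im (mu k).
Variables (X : topologicalType) (pt : C3 -> X) (rep : X -> C3).
Local Notation off := (off_conics mu).
(** [pt] is the projection from the cone over the complement, with the scaling orbits as fibres, and
    is controlled only on [off]. [rep] is a section that need not be continuous, so local statements
    are proved on triples and brought down by [pt_open]. *)
Hypothesis rep_off : forall x, off (rep x).
Hypothesis repK : forall x, pt (rep x) = x.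
Hypothesis pt_scale : forall c v, c != 0 -> off v -> pt (scale3 c v) = pt v.
Hypothesis rep_pt : forall v, off v -> exists2 c, c != 0 & rep (pt v) = scale3 c v.
Hypothesis pt_continuous : forall v, off v -> {for v, continuous pt}.
Hypothesis pt_open : forall v (P : X -> Prop), off v ->
  (\forall u \near v, P (pt u)) -> \forall x \near pt v, P x.

Definition chart_set (k : option bool) (x : X) : Prop := chart mu k (rep x).

Lemma chart_set_pt k v : off v -> chart_set k (pt v) <-> chart mu k v.
Proof.
move=> hv; have [c c0 E] := rep_pt hv; rewrite /chart_set E; split; last exact: chart_scale.
have -> : v = scale3 c^-1 (scale3 c v).
  by case: v {hv E} => [[x y] z]; rewrite /scale3 /= !mulKf.
have cV0 : c^-1 != 0 by rewrite invr_eq0.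
move=> /(chart_scale cV0); congr chart.
by rewrite /scale3 /= !mulKf.
Qed.

Lemma chart_set_open k : open (chart_set k).
Proof.
rewrite openE => x hx; rewrite -(repK x); apply: pt_open; first exact: rep_off.
have h := near_chart mu_Im hx (@cvg_id _ _).
by apply: filterS h => v hv; apply/chart_set_pt => //; exact: chart_off_conics hv.
Qed.

Lemma chart_set_cover x : exists k, chart_set k x.
Proof. exact: (off_conics_chart mu_Im ord0 (mu_arg mu_Im mu_sorted) (rep_off x)). Qed.

Definition chart_ray_point k x (s : R) : X :=
  pt (chart_point k (chart_ray k (chart_coord k (rep x)) s)).

Lemma chart_ray_point_pt k v s : off v ->
  chart_ray_point k (pt v) s = pt (chart_point k (chart_ray k (chart_coord k v) s)).
Proof.
by move=> hv; rewrite /chart_ray_point; have [c c0 ->] := rep_pt hv; rewrite chart_coord_scale.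
Qed.

Lemma chart_point_off k e : chart_dom mu k e -> off (chart_point k e).
Proof. by move=> h; apply: (chart_off_conics mu_Im (k := k)); exact: chart_chart_point. Qed.

Lemma chart_ray_point_continuous k x s : chart_set k x -> 0 <= s <= 1 ->
  {for (x, s), continuous (fun u : X * R => chart_ray_point k u.1 u.2)}.
Proof.
move=> hx s01.
have hd : chart_dom mu k (chart_ray k (chart_coord k (rep x)) s).
  exact: chart_ray_dom s01 (chart_dom_coord mu_Im hx).
pose f (u : C3 * R) := pt (chart_point k (chart_ray k (chart_coord k u.1) u.2)).
have fc : {for (rep x, s), continuous f}.
  pose T := (C3 * R)%type; pose u0 : T := (rep x, s).
  have c1 : {for u0, continuous (fun u : T => u.1)} by exact: cvg_fst.
  have c2 : {for u0, continuous (fun u : T => u.2)} by exact: cvg_snd.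
  have c3 := for_chart_coord (x := u0) (f := fun u : T => u.1) hx c1.
  have c4 := for_chart_ray (k := k) c3 c2.
  have c5 := for_chart_point (x := u0)
    (f := fun u : T => chart_ray k (chart_coord k u.1) u.2) hd c4.
  exact: for_comp c5 (pt_continuous (chart_point_off hd)).
move=> A hA; have := fc A hA.
move=> [[B1 B2] /= [nB1 nB2] BA].
have nP : \forall y \near x, forall s', B2 s' -> A (chart_ray_point k y s').
  rewrite -(repK x); apply: pt_open; first exact: rep_off.
  have h := near_chart mu_Im hx (@cvg_id _ _).
  apply: filterS (filterI nB1 h) => v [Bv hv] s' Bs'.
  rewrite chart_ray_point_pt; last exact: chart_off_conics hv.
  exact: (BA (v, s')).
exists ([set y | forall s', B2 s' -> A (chart_ray_point k y s')], B2) => //=.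
by move=> [y s'] /= [hy hs']; exact: hy.
Qed.

Lemma chart_ray_point0 k x : chart_set k x ->
  chart_ray_point k x 0 = pt (chart_point k (chart_center R k)).
Proof. by move=> _; rewrite /chart_ray_point chart_ray0. Qed.

Lemma chart_ray_point1 k x : chart_set k x -> chart_ray_point k x 1 = x.
Proof.
move=> hx; rewrite /chart_ray_point chart_ray1 -[RHS]repK.
have [c c0 E] := chart_pointK hx; rewrite {2}E pt_scale//.
by apply: chart_point_off; exact: chart_dom_coord.
Qed.

Definition chart_path k x (hx : chart_set k x) :=
  star_path (@chart_ray_point_continuous k) (@chart_ray_point0 k) (@chart_ray_point1 k) hx.

(** The number 1 + i lies in both half-planes and m = 1 is on none of the lines, so this point is in
    all three charts. *)
Definition base_point : C3 := sector_point (1 +i* 1)%C 1.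

Lemma half_base b : half b (1 +i* 1 : C)%C.
Proof. by case: b => /=; rewrite ltr01. Qed.

Lemma ell1 k : ell mu k 1 = Im (mu k).
Proof. by rewrite /ell /= mul1r mul0r subr0. Qed.

Lemma generic1 : generic mu 1.
Proof. by move=> k; rewrite ell1 gt_eqF. Qed.

Lemma base_point_chart k : chart mu k base_point.
Proof.
have h b := sector_point_chart mu_Im ord0 (half_base b) generic1.
by case: k => [b|]; [have [] := h b|have [] := h true].
Qed.

Lemma base_point_off : off base_point.
Proof. exact: (chart_off_conics mu_Im (base_point_chart None)). Qed.

Lemma chart_set_base k : chart_set k (pt base_point).
Proof. by apply/chart_set_pt; [exact: base_point_off|exact: base_point_chart]. Qed.

Lemma path_to_base (x0 : X) : exists _ : {path I from x0 to pt base_point in X}, True.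
Proof.
have [k hk] := chart_set_cover x0.
by exists (path_cat (path_rev (chart_path hk)) (chart_path (chart_set_base k))).
Qed.

(** When turning counterclockwise from 1, [m] comes after the lines of index less than [j] and
    before the others; sector [n] is that of -1. *)
Definition sector (m : C) (j : nat) : Prop :=
  forall k, (ell mu k m < 0) = (k < j)%N /\ ell mu k m != 0.

Lemma sector_generic m j : sector m j -> generic mu m.
Proof. by move=> h k; have [] := h k. Qed.

Lemma ell_mu_gt0 (i j : 'I_n) : (j < i)%N -> 0 < ell mu i (mu j).
Proof. by move=> /mu_sorted h; rewrite /ell subr_gt0; move: h; lra. Qed.

Lemma ell_mu_lt0 (i j : 'I_n) : (i < j)%N -> ell mu i (mu j) < 0.
Proof. by move=> /mu_sorted h; rewrite /ell subr_lt0; move: h; lra. Qed.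

Lemma ell_mu_eq0 (i : 'I_n) : ell mu i (mu i) = 0.
Proof. by rewrite /ell; lra. Qed.

Lemma ellD i (a b : C) : ell mu i (a + b) = ell mu i a + ell mu i b.
Proof. by rewrite /ell ReD ImD; lra. Qed.

(** The sum of two consecutive directions lies between them; 1 and -1 serve for the extreme
    sectors. *)
Definition sector_rep (j : nat) : C :=
  if j is j'.+1 then if (j < n)%N then mu (inord j') + mu (inord j) else -1 else 1.

Lemma sector_repP j : (j <= n)%N -> sector (sector_rep j) j.
Proof.
case: j => [_ k|j jn k]; first by rewrite ell1 gt_eqF// lt_gtF.
rewrite /sector_rep; case: ltnP => [j1n|nj].
  have vj : val (inord j : 'I_n) = j by rewrite /= inordK// ltnW.
  have vj1 : val (inord j.+1 : 'I_n) = j.+1 by rewrite /= inordK.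
  rewrite ellD ltnS; case: (leqP k j) => [kj|jk].
    have h1 : ell mu k (mu (inord j.+1)) < 0 by apply: ell_mu_lt0; rewrite [X in (_ < X)%N]vj1.
    have h2 : ell mu k (mu (inord j)) <= 0.
      move: kj; rewrite leq_eqVlt => /orP[/eqP kj|kj].
        have -> : inord j = k by apply: val_inj; rewrite vj.
        by rewrite ell_mu_eq0.
      by apply/ltW/ell_mu_lt0; rewrite [X in (_ < X)%N]vj.
    have h : ell mu k (mu (inord j)) + ell mu k (mu (inord j.+1)) < 0 by lra.
    by rewrite h lt_eqF.
  have h1 : 0 < ell mu k (mu (inord j)) by apply: ell_mu_gt0; rewrite [X in (X < _)%N]vj.
  have h2 : 0 <= ell mu k (mu (inord j.+1)).
    move: jk; rewrite leq_eqVlt => /orP[/eqP kj|kj].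
      have -> : inord j.+1 = k by apply: val_inj; rewrite vj1.
      by rewrite ell_mu_eq0.
    by apply/ltW/ell_mu_gt0; rewrite [X in (X < _)%N]vj1.
  have h : 0 < ell mu k (mu (inord j)) + ell mu k (mu (inord j.+1)) by lra.
  by rewrite lt_gtF// gt_eqF.
rewrite ellN ell1 oppr_lt0 mu_Im oppr_eq0 gt_eqF//; split=> //.
by rewrite (leq_trans (ltn_ord k) nj).
Qed.

(** In the upper half-plane the lines already passed form an initial segment, by [ell_lt0_upper];
    [j] is its length, found as the least strict upper bound. *)
Lemma sector_upper m : generic mu m -> 0 <= Im m -> exists2 j, (j <= n)%N & sector m j.
Proof.
move=> hm m0; pose P j := [forall k : 'I_n, (ell mu k m < 0) ==> (k < j)%N].
have exP : exists j, P j by exists n; apply/forallP => k; apply/implyP => _; exact: ltn_ord.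
case: (ex_minnP exP) => j /forallP Pj minj; exists j.
  by apply: minj; apply/forallP => k; apply/implyP => _; exact: ltn_ord.
move=> k; split; last exact: hm.
apply/idP/idP => [hk|kj]; first exact: (implyP (Pj k)).
apply: contraLR kj => nk; rewrite -leqNgt; apply: minj.
apply/forallP => l; apply/implyP => hl; rewrite ltnNge; apply/negP => kl.
case/negP: nk; move: kl; rewrite leq_eqVlt => /orP[/eqP/val_inj -> //|kl].
exact: (ell_lt0_upper mu_Im mu_sorted m0 kl hl).
Qed.

Section PrefixProduct.
Variable (G : groupType).
Local Open Scope group_scope.
Implicit Types b : 'I_n -> G.

Definition prefix_prod b (j : nat) : G := \prod_(i <- take j (enum 'I_n)) b i.

Lemma prefix_prod0 b : prefix_prod b 0 = 1.
Proof. by rewrite /prefix_prod take0 big_nil. Qed.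

Lemma prefix_prodS b (k : 'I_n) : prefix_prod b k.+1 = prefix_prod b k * b k.
Proof.
rewrite /prefix_prod (take_nth k) ?size_enum_ord// nth_ord_enum.
by rewrite -cats1 big_cat big_seq1.
Qed.

Lemma prefix_prod_size b : prefix_prod b n = \prod_(i <- enum 'I_n) b i.
Proof. by rewrite /prefix_prod take_oversize// size_enum_ord. Qed.

Lemma prefix_prod_telescope (T : nat -> G) j : (j <= n)%N -> T 0%N = 1 ->
  prefix_prod (fun k : 'I_n => T k * (T k.+1)^-1) j = (T j)^-1.
Proof.
move=> + T0; elim: j => [_|j IH jn]; first by rewrite prefix_prod0 T0 invg1.
by have := prefix_prodS (fun k : 'I_n => T k * (T k.+1)^-1) (Ordinal jn);
  rewrite IH ?(ltnW jn)//= => ->; rewrite mulKg.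
Qed.

Lemma prefix_prod_mem b (S : set G) : S 1 -> (forall x y, S x -> S y -> S (x * y)) ->
  (forall k, S (b k)) -> forall j, S (prefix_prod b j).
Proof. by move=> S1 SM Sb j; rewrite /prefix_prod; elim/big_ind: _. Qed.

End PrefixProduct.

(** * Transitions between the charts and the crossing elements *)

Section BasePath.
Variables (x0 : X) (p0 : {path I from x0 to pt base_point in X}).

(** The detour through the centre of the chart makes all tails homotopic to [p0] at the base point,
    where the transitions are therefore trivial. *)
Definition tail k x (hx : chart_set k x) : {path I from x0 to x in X} :=
  path_cat (path_cat p0 (path_rev (chart_path (chart_set_base k)))) (chart_path hx).

Lemma tail_cat k x y (hx : chart_set k x) (hy : chart_set k y)
    (p : {path I from x to y in X}) : (forall t, chart_set k (p t)) ->
  path_homotopic (path_cat (tail hx) p) (tail hy).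
Proof.
move=> hp; apply: path_homotopic_trans (path_homotopic_sym (path_catA _ _ _)) _.
by apply: path_cat_homotopicr; exact: star_path_cat.
Qed.

Lemma tail_base k (h : chart_set k (pt base_point)) : path_homotopic (tail h) p0.
Proof. by rewrite /tail (Prop_irrelevance (chart_set_base k) h); exact: path_catVKr. Qed.

Local Notation trans := (transition tail).

Lemma transition_base k l : trans k l (pt base_point) = 1%g.
Proof.
rewrite (transitionE _ (chart_set_base k) (chart_set_base l)).
by rewrite (loop_class_div_homotopic (tail_base _) (tail_base _)) loop_class_divpp.
Qed.

Lemma transition_cat k l x y (p : {path I from x to y in X}) :
  (forall t, chart_set k (p t)) -> (forall t, chart_set l (p t)) ->
  trans k l x = trans k l y.
Proof.
move=> hk hl.
have kx : chart_set k x by have := hk zero; rewrite path_zero.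
have ky : chart_set k y by have := hk one; rewrite path_one.
have lx : chart_set l x by have := hl zero; rewrite path_zero.
have ly : chart_set l y by have := hl one; rewrite path_one.
rewrite (transitionE _ kx lx) (transitionE _ ky ly) -(loop_class_divr _ _ p).
by apply: loop_class_div_homotopic; exact: tail_cat.
Qed.

Lemma transition_curve k l (v : R -> C3) :
  (forall t, 0 <= t <= 1 -> {for t, continuous v}) ->
  (forall t, 0 <= t <= 1 -> chart mu k (v t)) ->
  (forall t, 0 <= t <= 1 -> chart mu l (v t)) ->
  trans k l (pt (v 0)) = trans k l (pt (v 1)).
Proof.
move=> vc hk hl.
have t01 (t : I) : 0 <= I01_val t <= 1 by rewrite I01_ge0 I01_le1.
have ho (t : I) : off (v (I01_val t)) by exact: (chart_off_conics mu_Im (hk _ (t01 t))).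
have c : continuous (fun t : I => pt (v (I01_val t))).
  move=> t; have c1 : {for t, continuous (fun t : I => v (I01_val t))}.
    exact: for_comp (@I01_val_continuous R t) (vc _ (t01 t)).
  exact: for_comp c1 (pt_continuous (ho t)).
have e0 : pt (v (I01_val (zero : I))) = pt (v 0) by rewrite I01_val0.
have e1 : pt (v (I01_val (one : I))) = pt (v 1) by rewrite I01_val1.
apply: (@transition_cat k l _ _ (mk_path c e0 e1)) => t; apply/chart_set_pt => //.
  exact: hk.
exact: hl.
Qed.

Definition mix (t : R) (a b : C) : C := (1 - t)%:C%C * a + t%:C%C * b.

Lemma mix0 a b : mix 0 a b = a.
Proof. by rewrite /mix subr0 mul1r mul0r addr0. Qed.

Lemma mix1 a b : mix 1 a b = b.
Proof. by rewrite /mix subrr mul1r mul0r add0r. Qed.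

Lemma Re_mix t a b : Re (mix t a b) = (1 - t) * Re a + t * Re b.
Proof. by rewrite ReD !ReZ. Qed.

Lemma Im_mix t a b : Im (mix t a b) = (1 - t) * Im a + t * Im b.
Proof. by rewrite ImD !ImZ. Qed.

Lemma for_mix a b t : {for t, continuous (fun s => mix s a b)}.
Proof.
apply: forC_add; apply: forC_mul; try exact: for_cst.
  by apply: for_real; apply: for_sub; [exact: for_cst|exact: cvg_id].
by apply: for_real; exact: cvg_id.
Qed.

Lemma convex_gt0 (t x y : R) : 0 <= t <= 1 -> 0 < x -> 0 < y -> 0 < (1 - t) * x + t * y.
Proof.
move=> /andP[t0 t1] x_gt0 y_gt0; have [->|tn0] := eqVneq t 0.
  by rewrite subr0 mul1r mul0r addr0.
by rewrite ltr_wpDl// ?mulr_ge0 ?subr_ge0// ?ltW// mulr_gt0// lt_def tn0.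
Qed.

Lemma half_mix b t r r' : 0 <= t <= 1 -> half b r -> half b r' -> half b (mix t r r').
Proof. by case: b => /=; rewrite ?Re_mix ?Im_mix; exact: convex_gt0. Qed.

Lemma ell_mix k t m m' : ell mu k (mix t m m') = (1 - t) * ell mu k m + t * ell mu k m'.
Proof. by rewrite /ell Re_mix Im_mix; ring. Qed.

Lemma generic_mix t m m' : 0 <= t <= 1 -> generic mu m -> generic mu m' ->
  (forall k, (ell mu k m < 0) = (ell mu k m' < 0)) -> generic mu (mix t m m').
Proof.
move=> t01 hm hm' h k; rewrite ell_mix; have := h k.
have := hm k; have := hm' k; rewrite !neq_lt => /orP[c|c] /orP[d|d];
  rewrite ?c ?d ?(lt_gtF c) ?(lt_gtF d)// => _.
- rewrite -oppr_gt0 opprD -!mulrN (convex_gt0 t01)// oppr_gt0//.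
- by rewrite (convex_gt0 t01)// orbT.
Qed.

(** Once the signs of the [ell k] are fixed, [r] and [m] range over convex sets, so a curve inside
    the overlap joins the two points. *)
Lemma transition_sector b r m r' m' : half b r -> half b r' ->
  generic mu m -> generic mu m' -> (forall k, (ell mu k m < 0) = (ell mu k m' < 0)) ->
  trans None (Some b) (pt (sector_point r m)) = trans None (Some b) (pt (sector_point r' m')).
Proof.
move=> hr hr' hm hm' h.
pose v t := sector_point (mix t r r') (mix t m m').
have hv t : 0 <= t <= 1 -> _ := fun ht =>
  sector_point_chart mu_Im ord0 (half_mix ht hr hr') (generic_mix ht hm hm' h).
have := @transition_curve None (Some b) v; rewrite /v !mix0 !mix1; apply.
- move=> t ht; have r0 := half_neq0 (half_mix ht hr hr').
  have cr := @for_mix r r' t; have cm := @for_mix m m' t.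
  have cv := @forC_div R R t (fun s => mix s m m') (fun s => mix s r r') r0 cm cr.
  have cp := @forC_mul R R t (fun s => mix s r r') (fun s => mix s m m') cr cm.
  exact: for_pair (for_pair cp cv) (@for_cst _ t C 1).
- by move=> t ht; have [] := hv t ht.
- by move=> t ht; have [] := hv t ht.
Qed.

Lemma chart_overlap_in v : chart mu (Some true) v -> Im (v.1.1 / v.1.2) != 0 ->
  chart mu (Some false) v.
Proof.
case: v => [[x y] z] [/= xn yn _ hs] h; split=> //=.
by rewrite /off_npos sqr_i mulN1r ImN oppr_eq0 h.
Qed.

(** The overlap retracts to the line z = 0, where two convex pieces remain, according to the sign of
    Im r. The point is moved along a segment to [r0] while its third coordinate shrinks to 0. *)
Lemma transition_overlap v r0 : chart mu (Some true) v -> chart mu (Some false) v ->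
  0 < Re r0 -> Im r0 != 0 -> (0 < Im (v.1.1 / v.1.2)) = (0 < Im r0) ->
  trans (Some true) (Some false) (pt v) =
  trans (Some true) (Some false) (pt (chart_point (Some true) (r0, 0))).
Proof.
move=> h1 h2 R0 I0 sgn.
have [I1 _] := chart_overlap h1 h2.
have := chart_dom_coord mu_Im h1; have [c c0 vE] := chart_pointK h1.
case E : (chart_coord (Some true) v) => [r w] [/= hr hw].
rewrite E in vE.
have ho : off (chart_point (Some true) (r, w)) by apply: chart_point_off; split.
rewrite vE pt_scale//.
have IE : Im (v.1.1 / v.1.2) = 2 * (Re r * Im r).
  have r00 : r != 0 by exact: (@half_neq0 R true).
  have -> : v.1.1 / v.1.2 = r ^+ 2 by rewrite vE /=; field; rewrite c0 r00.
  by rewrite expr2 ImM; ring.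
have Ir0 : Im r != 0 by apply: contraNneq I1 => Z; rewrite IE Z !mulr0.
have sgn' : (0 < Im r) = (0 < Im r0) by rewrite -sgn IE pmulr_rgt0// pmulr_rgt0.
pose f t := chart_point (Some true) (mix t r r0, mix t w 0).
have fd t : 0 <= t <= 1 -> chart_dom mu (Some true) (mix t r r0, mix t w 0).
  move=> ht; split=> [|j] /=; first by rewrite Re_mix convex_gt0.
  have ht' : 0 <= (1 - t) * (1 - t) <= 1.
    by case/andP: ht => t0 t1; rewrite mulr_ge0 ?mulr_ile1//=; lra.
  have := slit_scale ht' (hw j); congr slit.
  by rewrite /mix mulr0 addr0 rmorphM exprMn [RHS]mulrCA expr2.
have := @transition_curve (Some true) (Some false) f; rewrite /f !mix0 !mix1; apply.
- move=> t ht; apply: (for_chart_point (mu := mu)) (fd t ht) _.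
  exact: for_pair (@for_mix r r0 t) (@for_mix w 0 t).
- by move=> t ht; apply: chart_chart_point; exact: fd.
- move=> t ht; apply: chart_overlap_in; first by apply: chart_chart_point; exact: fd.
  rewrite /= invrK ImM [X in _ + X]mulrC -mulr2n -mulr_natl !mulf_neq0 ?pnatr_eq0//.
    by have [/= gt0 _] := fd t ht; rewrite gt_eqF.
  rewrite Im_mix; have := sgn'; move: Ir0 I0.
  rewrite !neq_lt => /orP[c1|c1] /orP[d|d]; rewrite ?c1 ?d ?(lt_gtF c1) ?(lt_gtF d)// => _.
    by rewrite -oppr_gt0 opprD -!mulrN (convex_gt0 ht)// oppr_gt0.
  by rewrite (convex_gt0 ht)// orbT.
Qed.

(** The [T m] of the overview. As r = 1 + i lies in both half-planes, the same points test the
    charts [Some true] and [Some false]. *)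
Definition cross (m : C) : pi1 R x0 :=
  trans None (Some true) (pt (sector_point (1 +i* 1)%C m)).

Lemma sector_point_set r m b : half b r -> generic mu m ->
  chart_set None (pt (sector_point r m)) /\ chart_set (Some b) (pt (sector_point r m)).
Proof.
move=> hr hm; have [h1 h2 _] := sector_point_chart mu_Im ord0 hr hm.
have ho : off (sector_point r m) by exact: (chart_off_conics mu_Im h1).
by split; apply/chart_set_pt.
Qed.

Lemma tail_cocycle k l m x : chart_set k x -> chart_set l x -> chart_set m x ->
  (trans k l x * trans l m x = trans k m x)%g.
Proof. exact: transition_cocycle. Qed.

Lemma cross_eq m m' : generic mu m -> generic mu m' ->
  (forall k, (ell mu k m < 0) = (ell mu k m' < 0)) -> cross m = cross m'.
Proof. by move=> hm hm' h; apply: transition_sector => //; exact: (half_base true). Qed.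

Lemma cross1 : cross 1 = 1%g.
Proof. exact: transition_base. Qed.

Lemma sector_point_ratio (r m : C) : m != 0 -> r != 0 ->
  (sector_point r m).1.1 / (sector_point r m).1.2 = r ^+ 2.
Proof. by move=> m0 r0; rewrite /sector_point /=; field; rewrite m0 r0. Qed.

Lemma transition_positive v : chart mu (Some true) v -> chart mu (Some false) v ->
  0 < Im (v.1.1 / v.1.2) -> trans (Some true) (Some false) (pt v) = 1%g.
Proof.
move=> h1 h2 hI.
have e : 0 < Im ((1 +i* 1 : C)%C) by exact: ltr01.
have e' : 0 < Re ((1 +i* 1 : C)%C) by exact: ltr01.
rewrite (@transition_overlap v (1 +i* 1)%C) ?gt_eqF ?hI//.
rewrite -(transition_base (Some true) (Some false)).
symmetry; apply: transition_overlap => //; try exact: base_point_chart; first by rewrite gt_eqF.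
rewrite sector_point_ratio ?oner_neq0//; last exact: half_neq0 (half_base true).
by rewrite expr2 ImM /= !mulr1 ltr01 addr_gt0.
Qed.

(** At r = 1 + i the two charts at infinity overlap in the piece of the base point, where their
    transition is 1. *)
Lemma cross_false r m : half false r -> generic mu m ->
  trans None (Some false) (pt (sector_point r m)) = cross m.
Proof.
move=> hr hm; rewrite (@transition_sector false r m (1 +i* 1)%C m)//;
  last exact: (half_base false).
have [h1 h2] := sector_point_set (half_base true) hm.
have [_ h3] := sector_point_set (half_base false) hm.
rewrite -(tail_cocycle h1 h2 h3) transition_positive ?mulg1//.
- by have [] := sector_point_chart mu_Im ord0 (half_base true) hm.
- by have [] := sector_point_chart mu_Im ord0 (half_base false) hm.
rewrite sector_point_ratio ?(generic_neq0 ord0 hm)//; last exact: half_neq0 (half_base true).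
by rewrite expr2 ImM /= !mulr1 addr_gt0.
Qed.

Lemma cross_true r m : half true r -> generic mu m ->
  trans None (Some true) (pt (sector_point r m)) = cross m.
Proof. by move=> hr hm; apply: transition_sector => //; exact: (half_base true). Qed.

Lemma sector_pointN (r m : C) : sector_point (- r) (- m) = sector_point r m.
Proof. by rewrite /sector_point mulrNN invrN mulrNN. Qed.

Lemma half_conj b : half b (if b then 1 -i* 1 else -1 +i* 1 : C)%C.
Proof. by case: b => /=; rewrite ltr01. Qed.

(** One point is written both with (1 - i, m) and with (-1 + i, -m). The first form gives its
    transition to [Some true], the second its transition to [Some false], and the cocycle identity
    compares them. *)
Lemma cross_negative m v : generic mu m ->
  chart mu (Some true) v -> chart mu (Some false) v -> Im (v.1.1 / v.1.2) < 0 ->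
  (cross m * trans (Some true) (Some false) (pt v) = cross (- m))%g.
Proof.
move=> hm h1 h2 hI; have hm' := genericN hm.
have m0 := generic_neq0 ord0 hm.
have eN : ((1 -i* 1 : C) = - (-1 +i* 1))%C.
  by apply: complex_eqP; rewrite ?ReN ?ImN /= ?opprK.
have [k1 k2] := sector_point_set (half_conj true) hm.
have [_] := sector_point_set (half_conj false) hm'.
rewrite -sector_pointN opprK -eN => k3.
rewrite -(cross_true (half_conj true) hm) -(cross_false (half_conj false) hm').
rewrite -[X in _ = trans _ _ (pt X)]sector_pointN opprK -eN.
rewrite -(tail_cocycle k1 k2 k3); congr (_ * _)%g.
have i0 : Im (1 -i* 1 : C)%C < 0 by rewrite /= oppr_lt0 ltr01.
have r0 : 0 < Re (1 -i* 1 : C)%C by rewrite /= ltr01.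
have [p1 p2 _] := sector_point_chart mu_Im ord0 (half_conj true) hm.
have [_ p3 _] := sector_point_chart mu_Im ord0 (half_conj false) hm'.
rewrite -sector_pointN opprK -eN in p3.
rewrite (@transition_overlap v (1 -i* 1)%C) ?lt_eqF ?(lt_gtF i0) ?(lt_gtF hI)//.
symmetry; apply: transition_overlap; rewrite ?lt_eqF ?(lt_gtF i0)//.
rewrite sector_point_ratio ?m0//; last exact: half_neq0 (half_conj true).
by rewrite expr2 ImM /= mulr1 mul1r; apply/negbTE; rewrite -leNgt; lra.
Qed.

Lemma transition_cross b v : chart mu None v -> chart mu (Some b) v ->
  trans None (Some b) (pt v) = cross (chart_coord (Some b) v).2^-1.
Proof.
move=> h0 hb; have /= [hr hm [c c0 E]] := chart_sector_point mu_Im h0 hb.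
have [hs _ _] := sector_point_chart mu_Im ord0 hr hm.
rewrite [X in trans _ _ (pt X)]E pt_scale//; last exact: (chart_off_conics mu_Im hs).
by case: b hb hr {hs E} hm => hb hr hm; [exact: cross_true|exact: cross_false].
Qed.

Definition crossing (k : 'I_n) : pi1 R x0 :=
  (cross (sector_rep k) * (cross (sector_rep k.+1))^-1)%g.

Lemma cross_sector m j : (j <= n)%N -> sector m j -> cross m = ((prefix_prod crossing j)^-1)%g.
Proof.
move=> jn hm.
rewrite (prefix_prod_telescope (T := fun j => cross (sector_rep j)))//; last exact: cross1.
have hj := sector_repP jn; rewrite invgK; apply: cross_eq.
- exact: sector_generic hm.
- exact: sector_generic hj.
- by move=> k; have [-> _] := hm k; have [-> _] := hj k.
Qed.

Lemma crossing_sector (k : 'I_n) m m' : sector m k -> sector m' k.+1 ->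
  (cross m * (cross m')^-1 = crossing k)%g.
Proof.
move=> hm hm'; rewrite (cross_sector _ hm) ?(cross_sector _ hm')//; last exact: ltnW.
by rewrite invgK prefix_prodS mulKg.
Qed.

(** The transition between the two charts at infinity on the lower piece does not depend on [m];
    taking m = 1 identifies it with [cross (-1)]. *)
Lemma crossN m : generic mu m -> cross (- m) = (cross m * cross (-1)%R)%g.
Proof.
have key m' : generic mu m' -> cross (- m') =
    (cross m' * trans (Some true) (Some false) (pt (sector_point (1%R -i* 1%R)%C 1%R)))%g.
  move=> hm'.
  have [_ p2 _] := sector_point_chart mu_Im ord0 (half_conj true) generic1.
  have [_ p3 _] := sector_point_chart mu_Im ord0 (half_conj false) (genericN generic1).
  have eN : ((1 -i* 1 : C) = - (-1 +i* 1))%C.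
    by apply: complex_eqP; rewrite ?ReN ?ImN /= ?opprK.
  rewrite -sector_pointN opprK -eN in p3.
  rewrite (cross_negative hm' p2 p3)// sector_point_ratio ?oner_neq0//.
    by rewrite expr2 ImM /= mulr1 mul1r; lra.
  exact: half_neq0 (half_conj true).
by move=> hm; rewrite (key m hm) (key 1 generic1) cross1 mul1g.
Qed.

Lemma crossing_relation :
  (\prod_(i <- enum 'I_n) crossing i * \prod_(i <- enum 'I_n) crossing i = 1)%g.
Proof.
have E : cross (-1) = ((\prod_(i <- enum 'I_n) crossing i)^-1)%g.
  rewrite -prefix_prod_size; apply: cross_sector => // k.
  by rewrite ellN ell1 oppr_lt0 mu_Im oppr_eq0 gt_eqF// ltn_ord.
have := crossN (genericN generic1); rewrite opprK cross1 E => /esym h.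
by apply: (@invg_inj (pi1 R x0)); rewrite invgM invg1.
Qed.

Section Subgroup.
Variable S : set (pi1 R x0).
Hypothesis S1 : S 1%g.
Hypothesis SM : forall x y, S x -> S y -> S (x * y)%g.
Hypothesis SV : forall x, S x -> S (x^-1)%g.
Hypothesis S_crossing : forall k, S (crossing k).

Lemma cross_mem m : generic mu m -> S (cross m).
Proof.
have up m' : generic mu m' -> 0 <= Im m' -> S (cross m').
  move=> hm' m0; have [j jn hj] := sector_upper hm' m0.
  by rewrite (cross_sector jn hj); apply: SV; exact: prefix_prod_mem.
move=> hm; have [m0|m0] := leP 0 (Im m); first exact: up.
have hm' := genericN hm.
rewrite -(opprK m) crossN//; apply: SM; apply: up => //.
- by rewrite ImN oppr_ge0 ltW.
- exact: genericN generic1.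
- by rewrite ImN /= oppr0.
Qed.

Lemma transition_mem k l x : chart_set k x -> chart_set l x -> S (trans k l x).
Proof.
have h0 b y : chart_set None y -> chart_set (Some b) y -> S (trans None (Some b) y).
  move=> h1 h2; rewrite -(repK y) transition_cross//; apply: cross_mem.
  by have [] := chart_sector_point mu_Im h1 h2.
have inv k' l' y : chart_set k' y -> chart_set l' y -> S (trans k' l' y) -> S (trans l' k' y).
  by move=> h1 h2 /SV; rewrite (cocycle_sym (W := chart_set) tail_cocycle h1 h2).
have refl k' y : chart_set k' y -> S (trans k' k' y).
  by move=> h1; rewrite (cocycle_refl (W := chart_set) tail_cocycle h1).
have tf y : chart_set (Some true) y -> chart_set (Some false) y ->
    S (trans (Some true) (Some false) y).
  move=> h1 h2; have [I0 _] := chart_overlap h1 h2.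
  rewrite -(repK y); move: I0; rewrite neq_lt => /orP[I0|I0].
    have E := cross_negative generic1 h1 h2 I0.
    by rewrite cross1 mul1g in E; rewrite E; apply: cross_mem; exact: genericN generic1.
  by rewrite transition_positive.
case: k l => [[]|] [[]|] h1 h2; try exact: refl; try exact: h0; try exact: tf;
  by apply: inv => //; first [exact: h0|exact: tf].
Qed.

(* The conjugation by the class of the tail is onto, so that membership of all
   the conjugates suffices. *)
Lemma crossing_generate : forall g, S g.
Proof.
have [k0 hk0] := chart_set_cover x0.
pose c := loop_class (tail hk0) : pi1 R x0.
suff key g : S (c * g * c^-1)%g.
  by move=> g; have := key (c^-1 * g * c)%g; rewrite !mulgA mulgV mul1g mulgK.
have [p ->] := loop_classP g.
have [L [Ll L0 L1]] := loop_section chart_set_open tail_cat (path_cst R x0) p.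
have W0 : chart_set k0 (path_real p 0) by rewrite path_real0.
have W1 : chart_set k0 (path_real p 1) by rewrite path_real1.
(* Multiplied by [c], the lift starts at 1 and ends at the conjugate of the loop by [c]. *)
have E0 : (c * L 0 k0)%g = 1%g.
  rewrite (L0 k0 hk0) pi1_mul_class; apply/loop_class_eq.
  apply: path_homotopic_trans (path_cat_homotopicr _ (path_cat1p _)) _.
  exact: path_catpV.
have E1 : (c * L 1%R k0)%g = (c * loop_class p * c^-1)%g.
  rewrite (L1 k0 hk0) /c pi1_inv_class !pi1_mul_class; apply/loop_class_eq.
  apply: path_homotopic_trans (path_catA _ _ _) _; apply: path_cat_homotopicl.
  apply: path_cat_homotopicr; exact: path_cat1p.
rewrite -E1.
have h := lift_subgroup chart_set_open chart_set_cover SM transition_mem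
  (@connected_real R) (@path_real_continuous R X _ _ p) (lift_mull c Ll) W0.
by apply: h W1; rewrite E0.
Qed.

End Subgroup.

(** The loop starts in sector k, runs in [Some true], and returns in [None] from a point of sector k
    + 1. Read in [None] by [lift_split], its monodromy is T_k times the inverse of T_{k+1}; [omega]
    is the tail of that chart. *)
Lemma crossing_loop (k : 'I_n) (y : X) (p : {path I from y to y in X}) (c : R) r m r' m' :
  0 <= c <= 1 ->
  (forall t, 0 <= t <= c -> chart_set (Some true) (path_real p t)) ->
  (forall t, c <= t <= 1 -> chart_set None (path_real p t)) ->
  half true r -> half true r' -> sector m k -> sector m' k.+1 ->
  y = pt (sector_point r m) -> path_real p c = pt (sector_point r' m') ->
  exists omega : {path I from x0 to y in X},
    crossing k = loop_class (path_cat (path_cat omega p) (path_rev omega)).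
Proof.
move=> c01 h1 h0 hr hr' hm hm' yE cE.
have hy : chart_set None y.
  by rewrite -(path_real1 p); apply: h0; rewrite lexx andbT; case/andP: c01.
exists (tail hy).
have [L [Ll L0 L1]] := loop_section chart_set_open tail_cat (tail hy) p.
have e : path_real p 1 = path_real p 0 by rewrite path_real0 path_real1.
have := lift_split Ll c01 e h1 h0; rewrite (L0 None hy) (L1 None hy) loop_class_divpp.
rewrite invg1 mul1g => ->; rewrite path_real0 cE yE.
have [s1 s2] := sector_point_set hr' (sector_generic hm').
rewrite (cocycle_sym (W := chart_set) tail_cocycle s1 s2).
rewrite (cross_true hr (sector_generic hm)) (cross_true hr' (sector_generic hm')).
by rewrite (crossing_sector hm hm').
Qed.

(** * A morphism to any group with elements satisfying the relation *)

Section Universal.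
Variables (G : groupType) (b : 'I_n -> G).
Hypothesis b_relation :
  (\prod_(i <- enum 'I_n) b i * \prod_(i <- enum 'I_n) b i = 1)%g.

Definition count_neg (m : C) : nat := #|[pred k | ell mu k m < 0]|.

(** The value prescribed for [T] at -1; by the relation its square is 1. *)
Definition full_prod : G := (prefix_prod b n)^-1%g.

(* When m turns around 0, crossing the half-line of mu k or of - mu k multiplies
   this value on the left by (b k)^-1. *)
Definition sector_val (m : C) : G :=
  if 0 < ell mu ord_max m then (prefix_prod b (count_neg m))^-1%g
  else ((prefix_prod b (count_neg (- m)))^-1 * full_prod)%g.

Lemma full_prod2 : (full_prod * full_prod = 1)%g.
Proof. by apply: invg_inj; rewrite /full_prod prefix_prod_size invgM invgK invg1. Qed.

Lemma count_negE m m' : (forall k, (ell mu k m < 0) = (ell mu k m' < 0)) ->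
  count_neg m = count_neg m'.
Proof. by move=> h; apply: eq_card => k; rewrite !inE h. Qed.

Lemma sector_valE m m' : generic mu m -> generic mu m' ->
  (forall k, (ell mu k m < 0) = (ell mu k m' < 0)) -> sector_val m = sector_val m'.
Proof.
move=> hm hm' h.
have gt0 z k : generic mu z -> (0 < ell mu k z) = ~~ (ell mu k z < 0).
  by move=> hz; rewrite -leNgt lt_def hz.
rewrite /sector_val !gt0// h (count_negE h) (@count_negE (- m) (- m'))//.
by move=> k; rewrite !ellN !oppr_lt0 !gt0// h.
Qed.

Lemma sector_valN m : generic mu m -> sector_val (- m) = (sector_val m * full_prod)%g.
Proof.
move=> hm; rewrite /sector_val ellN oppr_gt0 opprK lt_neqAle leNgt hm /=.
by case: ltP => _ //=; rewrite -mulgA full_prod2 mulg1.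
Qed.

Lemma card_ord_lt j : (j <= n)%N -> #|[pred k : 'I_n | (k < j)%N]| = j.
Proof.
move=> jn; rewrite -sum1_card (eq_bigl (fun k : 'I_n => (k < j)%N))//.
by rewrite -(big_ord_widen n (fun=> 1%N) jn) sum_nat_const card_ord muln1.
Qed.

(** The half-plane on the right of the last line consists of the sectors 0 to n - 1, where
    [count_neg] is the index; sector n is opposite to sector 0. *)
Lemma sector_val_sector m j : (j <= n)%N -> sector m j -> sector_val m = (prefix_prod b j)^-1%g.
Proof.
move=> jn hm; rewrite /sector_val.
have gt0 : (0 < ell mu ord_max m) = (j < n)%N.
  have [h1 h2] := hm ord_max; rewrite lt_def h2 leNgt h1 /=.
  by rewrite -ltnNge ltnS.
rewrite gt0; case: ltnP => [lt_jn|n_j].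
  rewrite /count_neg (eq_card (B := [pred k : 'I_n | (k < j)%N])) ?card_ord_lt//.
  by move=> k; rewrite !inE; have [-> _] := hm k.
have -> : j = n by apply/eqP; rewrite eqn_leq jn.
rewrite (_ : count_neg _ = 0%N) ?prefix_prod0 ?invg1 ?mul1g//.
apply: eq_card0 => k; rewrite !inE ellN oppr_lt0 lt_gtF//.
by have [-> _] := hm k; rewrite (leq_trans (ltn_ord k)).
Qed.

Lemma sector_val1 : sector_val 1 = 1%g.
Proof.
rewrite (@sector_val_sector 1 0) ?prefix_prod0 ?invg1// => k.
by rewrite ell1 gt_eqF// lt_gtF.
Qed.

Lemma near_sector_val (T : topologicalType) (x : T) (f : T -> C) :
  generic mu (f x) -> {for x, continuous f} ->
  \forall t \near x, sector_val (f t) = sector_val (f x).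
Proof.
move=> hx fc.
have ec k : {for x, continuous (fun t => ell mu k (f t))}.
  have c1 := for_Re fc; have c2 := for_Im fc.
  have d1 := for_mul c1 (@for_cst T x R (Im (mu k))).
  have d2 := for_mul c2 (@for_cst T x R (Re (mu k))).
  exact: for_sub d1 d2.
have ns : \forall t \near x, forall k,
    (ell mu k (f t) < 0) = (ell mu k (f x) < 0) /\ ell mu k (f t) != 0.
  apply: filter_forall => k; have := hx k; rewrite neq_lt => /orP[h|h].
    by apply: filterS (near_lt (ec k) h) => t ht; rewrite ht h (lt_eqF ht).
  by apply: filterS (near_gt (ec k) h) => t ht; rewrite (lt_gtF h) (lt_gtF ht) gt_eqF.
apply: filterS ns => t ht; apply: sector_valE => // k; by have [] := ht k.
Qed.

(* The G-valued cocycle is the coboundary of [potential], and its values on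
   the overlaps are locally constant. *)
Definition potential (k : option bool) (v : C3) : G :=
  if k is Some s then
    if `[< chart mu None v >] then sector_val (chart_coord (Some s) v).2^-1
    else if s || (0 < Im (v.1.1 / v.1.2)) then 1%g else full_prod
  else 1%g.

Definition cocycle (k l : option bool) (x : X) : G :=
  ((potential k (rep x))^-1 * potential l (rep x))%g.

Lemma cocycleP k l m x : chart_set k x -> chart_set l x -> chart_set m x ->
  (cocycle k l x * cocycle l m x = cocycle k m x)%g.
Proof. by move=> _ _ _; rewrite /cocycle !mulgA mulgK. Qed.

Lemma potential_scale k c v : c != 0 -> chart mu k v ->
  potential k (scale3 c v) = potential k v.
Proof.
move=> c0; case: k => [s|//] hs; rewrite /potential chart_coord_scale//.
have -> : (scale3 c v).1.1 / (scale3 c v).1.2 = v.1.1 / v.1.2.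
  by rewrite /= -mulf_div mulfV// mul1r.
have -> : `[< chart mu None (scale3 c v) >] = `[< chart mu None v >].
  apply/asboolP/asboolP => h; last exact: chart_scale.
  have hv := chart_off_conics mu_Im hs.
  by apply/(chart_set_pt None hv); rewrite -(pt_scale c0 hv);
    apply/chart_set_pt => //; exact: scale3_off_conics.
by [].
Qed.

Lemma cocycle_pt k l v : chart mu k v -> chart mu l v ->
  cocycle k l (pt v) = ((potential k v)^-1 * potential l v)%g.
Proof.
move=> hk hl; have [c c0 E] := rep_pt (chart_off_conics mu_Im hk).
by rewrite /cocycle E !potential_scale.
Qed.

(** Inside chart [None] the factor comes from the replacement of m by -m; outside of it, [potential]
    is defined so as to give the same answer. The transition thus does not jump at the border of
    chart [None]. *)
Lemma potential_overlap v : chart mu (Some true) v -> chart mu (Some false) v ->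
  ((potential (Some true) v)^-1 * potential (Some false) v)%g =
  if 0 < Im (v.1.1 / v.1.2) then 1%g else full_prod.
Proof.
move=> h1 h2; have [I0 E] := chart_overlap h1 h2.
rewrite /potential E; case: asboolP => [h0|_] /=; last first.
  by case: ifP; rewrite invg1 mul1g.
have /= [_ hm _] := chart_sector_point mu_Im h0 h1.
case: ifP => _; first by rewrite mulVg.
by rewrite /= invrN sector_valN// mulKg.
Qed.

Lemma cocycle_locally_constant k l x : chart_set k x -> chart_set l x ->
  \forall y \near x, cocycle k l y = cocycle k l x.
Proof.
have inv k' l' y z : cocycle k' l' z = cocycle k' l' y -> cocycle l' k' z = cocycle l' k' y.
  have flip w : cocycle l' k' w = (cocycle k' l' w)^-1%g by rewrite /cocycle invgM invgK.
  by rewrite !flip => ->.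
have refl k' y z : cocycle k' k' z = cocycle k' k' y by rewrite /cocycle !mulVg.
have local k' l' y : chart_set k' y -> chart_set l' y ->
    (\forall u \near rep y, chart mu k' u -> chart mu l' u ->
       (potential k' u)^-1 * potential l' u = (potential k' (rep y))^-1 * potential l' (rep y))%g ->
    \forall z \near y, cocycle k' l' z = cocycle k' l' y.
  move=> h1 h2 h; rewrite -{1}(repK y); apply: pt_open; first exact: rep_off.
  have n1 := near_chart mu_Im h1 (@cvg_id _ _).
  have n2 := near_chart mu_Im h2 (@cvg_id _ _).
  apply: filterS (filterI h (filterI n1 n2)) => u [hu [u1 u2]].
  by rewrite cocycle_pt// hu.
have h0 s y : chart_set None y -> chart_set (Some s) y ->
    \forall z \near y, cocycle None (Some s) z = cocycle None (Some s) y.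
  move=> h1 h2; apply: local => //.
  have /= [_ hm _] := chart_sector_point mu_Im h1 h2.
  have c1 := for_chart_coord (x := rep y) (f := fun u : C3 => u) h2 (@cvg_id _ _).
  have c2 := for_snd c1.
  have w0 : (chart_coord (Some s) (rep y)).2 != 0.
    by rewrite -invr_eq0; exact: (generic_neq0 ord0 hm).
  have c3 := @forC_inv R _ (rep y) (fun u : C3 => (chart_coord (Some s) u).2) w0 c2.
  have n3 := near_sector_val (x := rep y)
    (f := fun u : C3 => (chart_coord (Some s) u).2^-1) hm c3.
  have n1 := near_chart mu_Im h1 (@cvg_id _ _).
  apply: filterS (filterI n3 n1) => u [hu u0] _ u2.
  by rewrite /potential !asboolT// hu.
have tf y : chart_set (Some true) y -> chart_set (Some false) y ->
    \forall z \near y, cocycle (Some true) (Some false) z = cocycle (Some true) (Some false) y.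
  move=> h1 h2; apply: local => //.
  have [I0 _] := chart_overlap h1 h2.
  have yn : (rep y).1.2 != 0 by case: h1.
  have [d1 d2 _] := @for_coords3 R _ (rep y) (fun u : C3 => u) (@cvg_id _ _).
  have c1 := for_Im (@forC_div R _ (rep y) (fun u : C3 => u.1.1) (fun u : C3 => u.1.2) yn d1 d2).
  have : \forall u \near rep y,
      (0 < Im (u.1.1 / u.1.2)) = (0 < Im ((rep y).1.1 / (rep y).1.2)).
    move: I0; rewrite neq_lt => /orP[hI|hI].
      by apply: filterS (near_lt c1 hI) => u hu; rewrite (lt_gtF hI) (lt_gtF hu).
    by apply: filterS (near_gt c1 hI) => u hu; rewrite hu hI.
  by apply: filterS => u hu u1 u2; rewrite !potential_overlap// hu.
case: k l => [[]|] [[]|] h1 h2; try (by apply: nearW => z; exact: refl);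
  first [exact: h0|exact: tf|apply: filterS (tf _ h2 h1) => z; exact: inv
        |apply: filterS (h0 _ _ h2 h1) => z; exact: inv].
Qed.

Lemma potential_base k : potential k base_point = 1%g.
Proof.
case: k => [s|//]; rewrite /potential asboolT; last exact: base_point_chart.
have [_ _ ->] := sector_point_chart mu_Im ord0 (half_base s) generic1.
by rewrite /= !invr1 sector_val1.
Qed.

Lemma cocycle_base k l : cocycle k l (pt base_point) = 1%g.
Proof. by rewrite cocycle_pt ?potential_base ?mulVg//; exact: base_point_chart. Qed.

Local Notation hol := (holonomy chart_set_open chart_set_cover cocycleP cocycle_locally_constant).

Lemma holonomy_change x y (p : {path I from x to y in X}) k l l' :
  chart_set k x -> chart_set l y -> chart_set l' y ->
  hol p k l' = (hol p k l * cocycle l l' y)%g.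
Proof.
move=> hk hl hl'.
have [L Lp] := path_lift chart_set_open chart_set_cover cocycleP cocycle_locally_constant p.
have E := holonomyE chart_set_open chart_set_cover cocycleP cocycle_locally_constant Lp hk.
rewrite (E _ hl) (E _ hl'); case: Lp => L1 _.
have e1 := path_real1 p; have := L1 1 l l'; rewrite e1 => -> //.
by rewrite mulgA.
Qed.

(** The morphism is the holonomy, conjugated by the holonomy [c] of [p0]. Every tail also has
    holonomy [c], so the transitions go to the values of the cocycle, and a crossing to the quotient
    of two consecutive sector values. *)
Lemma crossing_morphism : exists2 psi : pi1 R x0 -> G,
  (forall x y, psi (x * y)%g = (psi x * psi y)%g) & forall k, psi (crossing k) = b k.
Proof.
have [k0 hk0] := chart_set_cover x0.
pose c : G := hol p0 k0 None.
pose psi (a : pi1 R x0) : G := (c^-1 * hol (loop_repr a) k0 k0 * c)%g.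
have psi_class p : psi (loop_class p) = (c^-1 * hol p k0 k0 * c)%g.
  by rewrite /psi (holonomy_homotopic _ _ _ _ hk0 hk0 (loop_repr_class p)).
have hol_in k x y (p : {path I from x to y in X}) :
    (forall t, chart_set k (p t)) -> hol p k k = 1%g.
  exact: holonomy_in.
have hol_cat x y z (p : {path I from x to y in X}) (q : {path I from y to z in X}) k l m :
    chart_set k x -> chart_set l y -> chart_set m z ->
    hol (path_cat p q) k m = (hol p k l * hol q l m)%g.
  exact: holonomy_cat.
have star_in k x (hx : chart_set k x) t : chart_set k (chart_path hx t).
  rewrite star_pathE; apply/chart_set_pt; last first.
    apply: chart_chart_point; apply: chart_ray_dom; first by rewrite I01_ge0 I01_le1.
    exact: (chart_dom_coord mu_Im).
  apply: chart_point_off; apply: chart_ray_dom; first by rewrite I01_ge0 I01_le1.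
  exact: (chart_dom_coord mu_Im).
have center k : chart_set k (pt (chart_point k (chart_center R k))).
  by have := star_in k _ (chart_set_base k) zero; rewrite path_zero.
(* After [p0] the tail stays in chart [k], and the cocycle is trivial at the base point. *)
have hol_tail k x (hx : chart_set k x) : hol (tail hx) k0 k = c.
  rewrite (hol_cat _ _ _ _ _ _ k) // (hol_cat _ _ _ _ _ _ k) //; last exact: chart_set_base.
  rewrite !hol_in ?mulg1//; last by move=> t; exact: star_in.
  rewrite (@holonomy_change _ _ p0 k0 None k) ?cocycle_base ?mulg1//; exact: chart_set_base.
have psi_trans k l x : chart_set k x -> chart_set l x -> psi (trans k l x) = cocycle k l x.
  move=> hk hl; rewrite (transitionE _ hk hl) psi_class (hol_cat _ _ _ _ _ _ k)//.
  rewrite (holonomy_rev _ _ _ _ _ hk0 hk) (holonomy_change (tail hl) hk0 hl hk) !hol_tail.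
  by rewrite mulKg invgM mulgVK /cocycle invgM invgK.
have psi_cross m : generic mu m -> psi (cross m) = sector_val m.
  move=> hm; have [h1 h2] := sector_point_set (half_base true) hm.
  have [h1' h2' E] := sector_point_chart mu_Im ord0 (half_base true) hm.
  rewrite psi_trans// cocycle_pt// /potential asboolT// E /= invrK.
  by rewrite invg1 mul1g.
have psiM x y : psi (x * y)%g = (psi x * psi y)%g.
  have [p ->] := loop_classP x; have [q ->] := loop_classP y.
  rewrite pi1_mul_class !psi_class (hol_cat _ _ _ _ _ _ k0)//.
  by generalize c (hol p k0 k0) (hol q k0 k0) => d u v; rewrite !mulgA mulgK.
exists psi => // k.
have h1 := sector_repP (ltnW (ltn_ord k)); have h2 := sector_repP (ltn_ord k).
apply: (mulIg (psi (cross (sector_rep k.+1)))); rewrite -psiM /crossing mulgVK.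
rewrite !psi_cross; [|exact: sector_generic h2|exact: sector_generic h1].
rewrite (sector_val_sector _ h1) ?(sector_val_sector _ h2)//; last exact: ltnW.
by rewrite prefix_prodS invgM mulVKg.
Qed.

End Universal.

End BasePath.

Lemma crossing_presentation (x0 : X) : exists a : 'I_n -> pi1 R x0,
  [/\ (\prod_(i <- enum 'I_n) a i * \prod_(i <- enum 'I_n) a i = 1)%g,
    forall S : set (pi1 R x0), S 1%g -> (forall x y, S x -> S y -> S (x * y)%g) ->
      (forall x, S x -> S (x^-1)%g) -> (forall i, S (a i)) -> forall g, S g,
    forall (G : groupType) (b : 'I_n -> G),
      (\prod_(i <- enum 'I_n) b i * \prod_(i <- enum 'I_n) b i = 1)%g ->
      exists2 psi : pi1 R x0 -> G, (forall x y, psi (x * y)%g = (psi x * psi y)%g) &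
        forall i, psi (a i) = b i &
    forall (k : 'I_n) (y : X) (p : {path I from y to y in X}) (c : R) r m r' m',
      0 <= c <= 1 ->
      (forall t, 0 <= t <= c -> chart_set (Some true) (path_real p t)) ->
      (forall t, c <= t <= 1 -> chart_set None (path_real p t)) ->
      half true r -> half true r' -> sector m k -> sector m' k.+1 ->
      y = pt (sector_point r m) -> path_real p c = pt (sector_point r' m') ->
      exists omega : {path I from x0 to y in X},
        a k = loop_class (path_cat (path_cat omega p) (path_rev omega))].
Proof.
have [p0 _] := path_to_base x0; exists (crossing p0); split.
- exact: crossing_relation.
- exact: crossing_generate.
- exact: crossing_morphism.
- exact: crossing_loop.
Qed.

End Core.

(** * Presentations *)

Section WordValue.
Variables (A : choiceType) (H : groupType) (a : A -> H).
Local Open Scope group_scope.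

Lemma word_val_cat u v : word_val a (u ++ v) = word_val a u * word_val a v.
Proof. exact: big_cat. Qed.

Lemma word_val_inv u : word_val a (word_inv u) = (word_val a u)^-1.
Proof.
elim: u => [|[i b] u IH]; first by rewrite /word_val !big_nil invg1.
rewrite word_inv_cons word_val_cat IH -[(i, b) :: u]cat1s word_val_cat invgM.
by rewrite /word_val !big_seq1 /=; case: b => //=; rewrite invgK.
Qed.

Lemma word_val_gen i : word_val a [:: (i, false)] = a i.
Proof. exact: big_seq1. Qed.

Lemma word_val_map (H' : groupType) (psi : H -> H') (b : A -> H') u :
  (forall x y, psi (x * y) = psi x * psi y) -> (forall i, psi (a i) = b i) ->
  psi (word_val a u) = word_val b u.
Proof.
move=> psiM psia.
have psi1 : psi 1 = 1 by apply: (mulgI (psi 1)); rewrite -psiM !mulg1.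
have psiV x : psi x^-1 = (psi x)^-1 by apply: (mulgI (psi x)); rewrite -psiM !mulgV.
rewrite /word_val; elim: u => [|[i s] u IH]; first by rewrite !big_nil.
by rewrite !big_cons psiM IH; case: s; rewrite /= ?psiV psia.
Qed.

Variable rel : set (word A).
Hypothesis rel1 : forall r, rel r -> word_val a r = 1.

Lemma word_val_eq u v : word_eq rel u v -> word_val a u = word_val a v.
Proof.
elim=> {u v} [//|u v _ -> //|u v w _ -> _ -> //|u u' v v' _ E _ E'|i b|r /rel1 ->].
- by rewrite !word_val_cat E E'.
- rewrite /word_val !big_cons !big_nil /= mulg1.
  by case: b; rewrite /= ?mulgV ?mulVg.
- by rewrite /word_val big_nil.
Qed.

Definition presented_map (g : presented rel) : H := word_val a (word_repr g).

Lemma presented_map_class u : presented_map (word_class rel u) = word_val a u.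
Proof. exact/word_val_eq/word_repr_class. Qed.

Lemma presented_mapM g h : presented_map (g * h) = presented_map g * presented_map h.
Proof.
have [u ->] := word_classP g; have [v ->] := word_classP h.
have -> : word_class rel u * word_class rel v = word_class rel (u ++ v) := presented_mulE rel u v.
by rewrite !presented_map_class word_val_cat.
Qed.

End WordValue.

Lemma word_val_presented_gen (A : choiceType) (rel : set (word A)) u :
  word_val (presented_gen rel) u = word_class rel u.
Proof.
rewrite /word_val; elim: u => [|[i b] u IH]; first by rewrite big_nil.
rewrite big_cons IH.
have E (x : presented rel) v w : x = word_class rel v ->
    (x * word_class rel w)%g = word_class rel (v ++ w).
  by move=> ->; exact: presented_mulE.
by rewrite (E _ [:: (i, b)])//; case: b => //=; exact: presented_invE.
Qed.

(** * Reordering the generators by Hurwitz moves *)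

Section SquareBasis.
Variables (H : groupType) (n : nat) (M : 'I_n -> H -> Prop).
Hypothesis M_conj : forall i g h, M i g -> M i (h * g * h^-1)%g.
Local Open Scope group_scope.

(* The elements a i, multiplied in the order of l, present the group by the
   single relation that the square of the product is trivial. *)
Definition square_basis (l : seq 'I_n) (a : 'I_n -> H) : Prop :=
  [/\ \prod_(i <- l) a i * \prod_(i <- l) a i = 1,
    forall S : set H, S 1 -> (forall x y, S x -> S y -> S (x * y)) ->
      (forall x, S x -> S x^-1) -> (forall i, S (a i)) -> forall g, S g &
    forall (G : groupType) (b : 'I_n -> G),
      \prod_(i <- l) b i * \prod_(i <- l) b i = 1 ->
      exists2 psi : H -> G, (forall x y, psi (x * y) = psi x * psi y) &
        forall i, psi (a i) = b i].

Definition has_square_basis (l : seq 'I_n) : Prop :=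
  uniq l /\ exists2 a, square_basis l a & forall i, M i (a i).

Lemma eq_prod_notin (G : groupType) (l : seq 'I_n) (a b : 'I_n -> G) y :
  y \notin l -> (forall i, i != y -> a i = b i) ->
  \prod_(i <- l) a i = \prod_(i <- l) b i.
Proof.
move=> yl E; apply: eq_big_seq => i il; apply: E.
by apply: contraNneq yl => <-.
Qed.

(** A Hurwitz move: [a y] becomes its conjugate by [a x], which leaves the product along the list
    unchanged and stays in [M y]. *)
Lemma has_square_basis_swap l1 x y l2 :
  has_square_basis (l1 ++ x :: y :: l2) -> has_square_basis (l1 ++ y :: x :: l2).
Proof.
move=> [ul [a [arel agen auniv] aM]].
have E : perm_eq (l1 ++ y :: x :: l2) (l1 ++ x :: y :: l2).
  rewrite perm_cat2l -[y :: _]/([:: y] ++ [:: x] ++ _).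
  by rewrite -[x :: y :: _]/([:: x] ++ [:: y] ++ _) perm_catCA.
split; first by rewrite (perm_uniq E).
have [xy yl1 yl2] : [/\ x != y, y \notin l1 & y \notin l2].
  move: ul; rewrite cat_uniq /= !inE !negb_or => /and5P[_ /and3P[_ -> _] /andP[-> _] -> _].
  by [].
pose move_y (G : groupType) (c : 'I_n -> G) (z : G) i := if i == y then z else c i.
have moveE (G : groupType) (c : 'I_n -> G) z l : y \notin l ->
    \prod_(i <- l) move_y G c z i = \prod_(i <- l) c i.
  by move=> yl; apply: (eq_prod_notin yl) => i /negbTE iy; rewrite /move_y iy.
exists (move_y H a (a x * a y * (a x)^-1)); last first.
  by move=> i; rewrite /move_y; case: eqP => [->|_]; [exact: M_conj|exact: aM].
split.
- suff -> : \prod_(i <- l1 ++ y :: x :: l2) move_y H a (a x * a y * (a x)^-1) i =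
            \prod_(i <- l1 ++ x :: y :: l2) a i by [].
  rewrite !big_cat !big_cons /= !moveE// /move_y eqxx (negbTE xy).
  by rewrite !mulgA mulgVK.
- move=> S S1 SM SV Sa; apply: agen => // i.
  have Sx : S (a x) by have := Sa x; rewrite /move_y (negbTE xy).
  have [->|iy] := eqVneq i y; last by have := Sa i; rewrite /move_y (negbTE iy).
  have := Sa y; rewrite /move_y eqxx => Sy.
  have -> : a y = (a x)^-1 * (a x * a y * (a x)^-1) * a x by rewrite !mulgA mulVg mul1g mulgVK.
  exact: (SM _ _ (SM _ _ (SV _ Sx) Sy) Sx).
move=> G b brel.
(* The inverse substitution turns elements for the new order into elements for the old one. *)
have [|psi psiM psia] := auniv G (move_y G b ((b x)^-1 * b y * b x)).
  suff -> : \prod_(i <- l1 ++ x :: y :: l2) move_y G b ((b x)^-1 * b y * b x) i =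
            \prod_(i <- l1 ++ y :: x :: l2) b i by [].
  rewrite !big_cat !big_cons /= !moveE// /move_y eqxx (negbTE xy).
  by rewrite !mulgA mulgK.
exists psi => // i; rewrite {1}/move_y; have [->|iy] := eqVneq i y; last first.
  by rewrite psia /move_y (negbTE iy).
have psi1 : psi 1 = 1 by apply: (mulgI (psi 1)); rewrite -psiM !mulg1.
have psiV z : psi z^-1 = (psi z)^-1 by apply: (mulgI (psi z)); rewrite -psiM !mulgV.
by rewrite !psiM psiV !psia /move_y eqxx (negbTE xy) !mulgA mulgV mul1g mulgK.
Qed.

(** Induction on the target list: its head is carried to the front by successive swaps and then
    joins the prefix [pre]. *)
Lemma has_square_basis_perm l l' : perm_eq l l' ->
  has_square_basis l -> has_square_basis l'.
Proof.
suff key pre : perm_eq l l' -> has_square_basis (pre ++ l) -> has_square_basis (pre ++ l').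
  exact: (key [::]).
elim: l' l pre => [|x l' IH] l pre E.
  by have /eqP -> : l == [::] by rewrite -size_eq0 (perm_size E).
have : x \in l by rewrite (perm_mem E) mem_head.
move=> xl; move: E; case/splitPr: xl => l1 l2 E.
have {}E : perm_eq (l1 ++ l2) l'.
  by move: E; rewrite -[x :: l2]cat1s perm_catCA perm_cons.
have front q : has_square_basis (q ++ l1 ++ x :: l2) -> has_square_basis (q ++ x :: l1 ++ l2).
  elim: l1 q {E} => [//|y l1 IH1] q h.
  apply: has_square_basis_swap.
  by rewrite -cat_rcons; apply: IH1; rewrite cat_rcons.
by move=> /front; rewrite -!cat_rcons; exact: IH.
Qed.

End SquareBasis.

(** The universal property, applied to the presented group itself, yields the inverse of the
    evaluation of words. *)
Lemma square_basis_presented (H : groupType) (n : nat) (a : 'I_n -> H) :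
  square_basis (enum 'I_n) a ->
  (forall g, exists w : word 'I_n, g = word_val a w) /\
  exists phi : {multiplicative presented [set product_word n ++ product_word n] -> H},
    bijective phi /\ forall i, phi (presented_gen _ i) = a i.
Proof.
move=> [arel agen auniv].
have word_prod (G : groupType) (b : 'I_n -> G) :
    word_val b (product_word n) = (\prod_(i <- enum 'I_n) b i)%g.
  by rewrite /word_val /product_word big_map.
have gen g : exists w : word 'I_n, g = word_val a w.
  apply: (agen (fun g => exists w : word 'I_n, g = word_val a w)).
  - by exists [::]; rewrite /word_val big_nil.
  - by move=> x y [u ->] [v ->]; exists (u ++ v); rewrite word_val_cat.
  - by move=> x [u ->]; exists (word_inv u); rewrite word_val_inv.
  - by move=> i; exists [:: (i, false)]; rewrite word_val_gen.
split=> //.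
pose rel : set (word 'I_n) := [set product_word n ++ product_word n].
have rel1 r : rel r -> word_val a r = 1%g by move=> ->; rewrite word_val_cat word_prod.
pose phi : {multiplicative presented rel -> H} := HB.pack (@presented_map _ H a rel)
  (isMultiplicative.Build _ _ _ (presented_mapM rel1)).
have phiE u : phi (word_class rel u) = word_val a u by exact: presented_map_class.
have [|psi psiM psia] := auniv (presented rel) (presented_gen rel).
  rewrite -word_prod -word_val_cat word_val_presented_gen.
  exact/word_class_eq/word_eq_rel.
exists phi; split; last by move=> i; rewrite phiE word_val_gen.
exists psi => x.
  have [u ->] := word_classP x.
  by rewrite phiE (word_val_map _ psiM psia) word_val_presented_gen.
have [u ->] := gen x.
by rewrite (word_val_map _ psiM psia) word_val_presented_gen phiE.
Qed.

(** * Normal form of bitangent conics *)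

Section QuadraticForms.
Variable R : realType.
Local Notation C := R[i].
Local Notation poly3 := (mpoly.mpoly 3 C).
Implicit Types (F G : poly3) (v w : 'rV[C]_3) (c : C).

Lemma pevalD F G v : peval (F + G) v = peval F v + peval G v.
Proof. exact: mpoly.mevalD. Qed.

Lemma pevalZ c F v : peval (c *: F) v = c * peval F v.
Proof. exact: mpoly.mevalZ. Qed.

Lemma pevalM F G v : peval (F * G) v = peval F v * peval G v.
Proof. exact: mpoly.mevalM. Qed.

Lemma peval0 v : peval 0 v = 0.
Proof. exact: raddf0. Qed.

Lemma differentialD F G v w : differential (F + G) v w = differential F v w + differential G v w.
Proof.
rewrite /differential -big_split /=; apply: eq_bigr => k _.
by rewrite mpoly.mderivD pevalD mulrDl.
Qed.

Lemma differentialZ c F v w : differential (c *: F) v w = c * differential F v w.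
Proof.
rewrite /differential big_distrr /=; apply: eq_bigr => k _.
by rewrite mpoly.mderivZ pevalZ mulrA.
Qed.

Lemma differential0 v w : differential 0 v w = 0.
Proof. by rewrite /differential big1// => k _; rewrite mpoly.mderiv0 peval0 mul0r. Qed.

Lemma differentialM F G v w :
  differential (F * G) v w = differential F v w * peval G v + peval F v * differential G v w.
Proof.
rewrite /differential big_distrl big_distrr -big_split /=; apply: eq_bigr => k _.
by rewrite mpoly.mderivM pevalD !pevalM mulrDl mulrAC mulrA.
Qed.

Lemma differential_addr F v w w' :
  differential F v (w + w') = differential F v w + differential F v w'.
Proof.
by rewrite /differential -big_split /=; apply: eq_bigr => k _; rewrite !mxE mulrDr.
Qed.

Lemma differential_scaler F v c w : differential F v (c *: w) = c * differential F v w.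
Proof.
by rewrite /differential big_distrr /=; apply: eq_bigr => k _; rewrite !mxE mulrCA.
Qed.

(** Presents [differential F] as the polar form of [peval F], so that linear algebra replaces
    computations with polynomials. *)
Definition quadratic F : Prop :=
  [/\ forall v w, peval F (v + w) = peval F v + differential F v w + peval F w,
      forall c v, peval F (c *: v) = c ^+ 2 * peval F v &
      forall v w, differential F v w = differential F w v].

Lemma quadraticD F G : quadratic F -> quadratic G -> quadratic (F + G).
Proof.
move=> [f1 f2 f3] [g1 g2 g3]; split=> [v w|c v|v w].
- rewrite !pevalD !differentialD f1 g1.
  by rewrite [LHS]addrACA (addrACA (peval F v)).
- by rewrite !pevalD f2 g2 mulrDr.
- by rewrite !differentialD f3 g3.
Qed.

Lemma quadraticZ c F : quadratic F -> quadratic (c *: F).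
Proof.
move=> [f1 f2 f3]; split=> [v w|d v|v w].
- by rewrite !pevalZ !differentialZ f1 !mulrDr.
- by rewrite !pevalZ f2 mulrCA.
- by rewrite !differentialZ f3.
Qed.

Lemma quadratic0 : quadratic 0.
Proof. by split=> *; rewrite ?peval0 ?differential0 ?mulr0 ?addr0. Qed.

Let X (i : 'I_3) : poly3 := mpoly.mpolyX C (mpoly.mnm1 i).

Lemma peval_var i v : peval (X i) v = v 0 i.
Proof. exact: mpoly.mevalXU. Qed.

Lemma differential_var i v w : differential (X i) v w = w 0 i.
Proof.
rewrite /differential (bigD1 i)//= big1 => [|k ki].
  rewrite addr0 /X mpoly.mderivX mpoly.mnm1E eqxx scale1r.
  have -> : (mpoly.mnm_sub (mpoly.mnm1 i) (mpoly.mnm1 i)) = mpoly.mnm0.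
    by apply/mpoly.mnmP => j; rewrite mpoly.mnmBE mpoly.mnm0E subnn.
  by rewrite mpoly.mpolyX0 /peval mpoly.meval1 mul1r.
by rewrite /X mpoly.mderivX mpoly.mnm1E eq_sym (negbTE ki) scale0r peval0 mul0r.
Qed.

Lemma quadratic_var i j : quadratic (X i * X j).
Proof.
split=> [v w|c v|v w]; rewrite ?differentialM ?pevalM ?peval_var ?differential_var ?mxE; ring.
Qed.

Lemma homogeneous_quadratic F : F \is mpoly.ishomog1 2 (@mpoly.mdeg 3) -> quadratic F.
Proof.
move=> /mpoly.dhomogP hF; rewrite [F]mpoly.mpolyE big_seq.
apply: (big_ind quadratic quadratic0 quadraticD) => m /hF hm; apply: quadraticZ.
have split_var (m' : mpoly.multinom 3) : mpoly.mdeg m' != 0%N ->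
    exists i, m' = mpoly.mnm_add (mpoly.mnm_sub m' (mpoly.mnm1 i)) (mpoly.mnm1 i).
  rewrite mpoly.mdegE => m0.
  have [i mi] : exists i, m' i != 0%N.
    apply: contrapT => hN; case/eqP: m0; apply: big1 => i _.
    by apply/eqP; apply: contrapT => /negP h; apply: hN; exists i.
  by exists i; rewrite mpoly.submK// mpoly.lep1mP.
have m0 : mpoly.mdeg m != 0%N by rewrite hm.
have [i mE] := split_var m m0.
set m1 := mpoly.mnm_sub m _ in mE.
have m1d : mpoly.mdeg m1 = 1%N.
  by apply/eqP; rewrite -(eqn_add2r 1) -[X in (_ + X)%N](mpoly.mdeg1 i) -mpoly.mdegD -mE hm.
have /mpoly.mdeg1P[j /eqP m1E] : mpoly.mdeg m1 == 1%N by rewrite m1d.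
by rewrite mE m1E mpoly.mpolyXD; exact: quadratic_var.
Qed.

Lemma quadratic_double F v : quadratic F -> differential F v v = 2 * peval F v.
Proof.
move=> [f1 f2 _]; have := f1 v v.
have -> : v + v = 2 *: v by rewrite scaler_nat mulr2n.
by rewrite f2 => E; apply: (@addrI _ (peval F v)); apply: (@addIr _ (peval F v)); rewrite -E; ring.
Qed.

(** For the polar form B, a vector v of the radical satisfies F(v) = B(v, v) / 2 = 0, and its
    partial derivatives are values of B(v, -). *)
Lemma quadratic_singular F v : quadratic F -> v != 0 ->
  (forall w, differential F v w = 0) -> exists x, singular_point F x.
Proof.
move=> Fq v0 h; have [_ f2 f3] := Fq; have [x xv] := coords_point v0.
exists x => v' /(coords_scale v' xv) [c _ ->]; split.
  rewrite f2; have := quadratic_double v Fq; rewrite h => /esym/eqP.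
  by rewrite mulf_eq0 pnatr_eq0 /= => /eqP ->; rewrite mulr0.
move=> k; have : differential F (c *: v) (delta_mx 0 k) = 0.
  by rewrite f3 differential_scaler f3 h mulr0.
rewrite /differential (bigD1 k)//= big1 => [|j jk].
  by rewrite mxE !eqxx mulr1 addr0.
by rewrite mxE (negbTE jk) andbF mulr0.
Qed.

Section Basis.
Variables (p q : 'rV[C]_3).
Hypothesis pq_free : forall a b, a *: p + b *: q = 0 -> a = 0 /\ b = 0.

Definition comb3 (p q r : 'rV[C]_3) (a b c : C) : 'rV[C]_3 := a *: p + b *: q + c *: r.

Lemma peval_comb3 F r a b c : quadratic F -> peval F (comb3 p q r a b c) =
  a ^+ 2 * peval F p + b ^+ 2 * peval F q + c ^+ 2 * peval F r +
  a * b * differential F p q + a * c * differential F p r + b * c * differential F q r.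
Proof.
move=> [f1 f2 f3]; have fZ v w d : differential F (d *: v) w = d * differential F v w.
  by rewrite f3 differential_scaler f3.
have fD v v' w : differential F (v + v') w = differential F v w + differential F v' w.
  by rewrite f3 differential_addr !(f3 w).
rewrite /comb3 !f1 !f2 fD !fZ !differential_scaler.
move: (peval F p) (peval F q) (peval F r) (differential F p q) (differential F p r).
by move: (differential F q r) => x1 x2 x3 x4 x5 x6; ring.
Qed.

Lemma independent_third : exists r, forall a b c, comb3 p q r a b c = 0 ->
  [/\ a = 0, b = 0 & c = 0].
Proof.
have [k hk] : exists k : 'I_3, forall a b, delta_mx 0 k != a *: p + b *: q.
  apply: contrapT => hN.
  have : ((1%:M : 'M[C]_3) <= (p + q))%MS.
    apply/row_subP => k; rewrite row1; apply: contrapT => /negP nk.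
    apply: hN; exists k => a b; apply: contraNneq nk => ->.
    by rewrite addmx_sub// scalemx_sub// ?addsmxSl ?addsmxSr.
  move=> /mxrankS; rewrite mxrank1 => /leq_trans/(_ (mxrank_adds_leqif p q)).
  by move=> /leq_trans/(_ (leq_add (rank_leq_row _) (rank_leq_row _))).
exists (delta_mx 0 k) => a b c; rewrite /comb3.
have [->|c0] := eqVneq c 0; first by rewrite scale0r addr0 => /pq_free[-> ->].
move=> E; have /eqP[] := hk (- (a / c)) (- (b / c)); apply: (scalerI c0).
rewrite scalerDr !scalerA !mulrN ![c * (_ / c)]mulrC !mulfVK// !scaleNr -opprD.
by apply/eqP; rewrite -addr_eq0 addrC E.
Qed.

Variable r : 'rV[C]_3.
Hypothesis pqr_free : forall a b c, comb3 p q r a b c = 0 -> [/\ a = 0, b = 0 & c = 0].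

Definition basis_mx : 'M[C]_3 := \matrix_(i < 3) nth 0 [:: p; q; r] i.

Definition o0 : 'I_3 := ord0.
Definition o1 : 'I_3 := fintype.lift ord0 ord0.
Definition o2 : 'I_3 := fintype.lift ord0 (fintype.lift ord0 ord0).

Lemma mulmx_basis (u : 'rV[C]_3) : u *m basis_mx = comb3 p q r (u 0 o0) (u 0 o1) (u 0 o2).
Proof. by rewrite mulmx_sum_row !big_ord_recl big_ord0 !rowK /= addr0 addrA. Qed.

Lemma basis_unit : basis_mx \in unitmx.
Proof.
rewrite -row_free_unit; apply: inj_row_free => u; rewrite mulmx_basis => /pqr_free[u0 u1 u2].
apply/rowP => j; rewrite !mxE; have : j \in enum 'I_3 by rewrite mem_enum.
by rewrite enum_ordSl enum_ordSl enum_ordSl enum_ord0 !inE /= => /or3P[] /eqP ->.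
Qed.

Lemma comb3_ex w : exists a b c, w = comb3 p q r a b c.
Proof.
exists ((w *m invmx basis_mx) 0 o0), ((w *m invmx basis_mx) 0 o1), ((w *m invmx basis_mx) 0 o2).
by rewrite -mulmx_basis mulmxKV// basis_unit.
Qed.

Variable F : poly3.
Hypothesis Fq : quadratic F.
Hypothesis F_smooth : forall x, ~ singular_point F x.

Lemma differential_comb3 v a b c : differential F v (comb3 p q r a b c) =
  a * differential F v p + b * differential F v q + c * differential F v r.
Proof. by rewrite !differential_addr !differential_scaler. Qed.

Lemma smooth_nonsingular v : differential F v p = 0 -> differential F v q = 0 ->
  differential F v r = 0 -> v = 0.
Proof.
move=> hp hq hr; apply: contrapT => /eqP v0.
have [|x] := quadratic_singular Fq v0; last exact: F_smooth.
move=> w; have [a [b [c ->]]] := comb3_ex w.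
by rewrite differential_comb3 hp hq hr !mulr0 !addr0.
Qed.

(** If B(p, q) = 0 for the polar form B, then B(q, r) p - B(p, r) q is orthogonal to the three basis
    vectors, hence 0; so B(p, r) = 0 and p itself is in the radical. *)
Lemma smooth_polar_neq0 : peval F p = 0 -> peval F q = 0 -> differential F p q != 0.
Proof.
move=> p0 q0; apply/eqP => pq0; have [_ _ f3] := Fq.
have pp : differential F p p = 0 by rewrite quadratic_double// p0 mulr0.
have qq : differential F q q = 0 by rewrite quadratic_double// q0 mulr0.
have pn : p != 0.
  apply/eqP => pE; have h : comb3 p q r 1 0 0 = 0.
    by rewrite /comb3 pE scaler0 !scale0r !addr0.
  by have [/eqP] := pqr_free h; rewrite oner_eq0.
have E : differential F q r *: p + - differential F p r *: q = 0.
  apply: smooth_nonsingular; rewrite f3 differential_addr !differential_scaler.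
  - by rewrite pp pq0 !mulr0 addr0.
  - by rewrite qq (f3 q p) pq0 !mulr0 addr0.
  - by rewrite !(f3 r) mulrC mulNr subrr.
have [_ /eqP] := pq_free E; rewrite oppr_eq0 => /eqP pr0.
by case/eqP: pn; exact: smooth_nonsingular.
Qed.

Lemma smooth_pole_neq0 : differential F p r = 0 -> differential F q r = 0 -> peval F r != 0.
Proof.
move=> pr0 qr0; apply/eqP => r0; have [_ _ f3] := Fq.
have rE : r = 0.
  apply: smooth_nonsingular; rewrite ?(f3 r p) ?(f3 r q)//.
  by rewrite quadratic_double// r0 mulr0.
have h : comb3 p q r 0 0 1 = 0 by rewrite /comb3 rE scaler0 !scale0r !addr0.
by have [_ _ /eqP] := pqr_free h; rewrite oner_eq0.
Qed.

End Basis.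

End QuadraticForms.

Lemma coords_free (R : realType) (p q : P2 R) (u v : 'rV[R[i]]_3) :
  p != q -> coords p u -> coords q v ->
  forall a b, a *: u + b *: v = 0 -> a = 0 /\ b = 0.
Proof.
move=> pq pu qv a b E; have u0 := coords_neq0 pu; have v0 := coords_neq0 qv.
have [a0|a0] := eqVneq a 0.
  by move: E; rewrite a0 scale0r add0r => /eqP; rewrite scaler_eq0 (negbTE v0) orbF => /eqP.
have uE : u = - (b / a) *: v.
  apply: (scalerI a0); rewrite scalerA mulrN mulrC mulfVK// scaleNr.
  by apply/eqP; rewrite -addr_eq0 E.
have c0 : - (b / a) != 0 by apply: contraNneq u0 => c0; rewrite uE c0 scale0r.
case/eqP: pq; apply: (coords_inj pu).
by apply/(coords_scale u qv); exists (- (b / a)).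
Qed.

Lemma tangent_line_transfer (R : realType) (F G : mpoly.mpoly 3 R[i]) (x : P2 R)
    (u w : 'rV[R[i]]_3) :
  quadratic F -> coords x u -> w != 0 -> tangent_line F x = tangent_line G x ->
  differential F u w = 0 -> differential G u w = 0.
Proof.
move=> [_ _ f3] xu w0 E Fuw; have [y yw] := coords_point w0.
have : tangent_line F x y.
  move=> u' w' /(coords_scale u' xu) [c _ ->] /(coords_scale w' yw) [d _ ->].
  by rewrite differential_scaler f3 differential_scaler f3 Fuw !mulr0.
by rewrite E; apply.
Qed.

(** The tangents of the first conic at [p] and [q] meet in the pole [r] of the line joining them.
    All the conics share these tangents, so [r] is the pole for each, and in the basis u, v, r only
    the coefficients of xy and z^2 survive. *)
Lemma bitangent_normal_form (R : realType) (n : nat) (n_ge1 : (1 <= n)%N)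
    (F : 'I_n -> mpoly.mpoly 3 R[i])
    (F_quadric : forall i, smooth_curve 2 (F i))
    (F_distinct : injective (fun i => zero_locus (F i)))
    (p q : P2 R) (pq_distinct : p != q)
    (p_common : forall i, zero_locus (F i) p)
    (q_common : forall i, zero_locus (F i) q)
    (p_tangent : forall i j, i != j -> tangent_at (F i) (F j) p)
    (q_tangent : forall i j, i != j -> tangent_at (F i) (F j) q) :
  exists (P : 'M[R[i]]_3) (lam al : 'I_n -> R[i]),
    [/\ P \in unitmx, forall i, lam i != 0, forall i, al i != 0, injective lam &
      forall i u, peval (F i) (u *m P) = al i * (u 0 o0 * u 0 o1 - lam i * u 0 o2 ^+ 2)].
Proof.
have Fq i : quadratic (F i) by have [h _ _] := F_quadric i; exact: homogeneous_quadratic.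
have Fs i x : ~ singular_point (F i) x by have [_ _] := F_quadric i; apply.
have [u pu] := coords_ex p; have [v qv] := coords_ex q.
have uv_free := coords_free pq_distinct pu qv.
have [s uvs_free] := independent_third uv_free.
have Fu i : peval (F i) u = 0 by exact: p_common.
have Fv i : peval (F i) v = 0 by exact: q_common.
have Fuv i : differential (F i) u v != 0.
  exact: (smooth_polar_neq0 uv_free uvs_free (Fq i) (Fs i)).
pose i0 := Ordinal n_ge1; pose B := differential (F i0).
(* Since [u] and [v] are isotropic and B(u, v) is nonzero, these coefficients make [r] orthogonal to
   both. *)
pose c := B v s / B u v; pose d := B u s / B u v.
pose r := s - c *: u - d *: v.
have uvr_free a b e : comb3 u v r a b e = 0 -> [/\ a = 0, b = 0 & e = 0].
  have -> : comb3 u v r a b e = comb3 u v s (a - e * c) (b - e * d) e.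
    rewrite /comb3 /r !scalerBr !scalerBl !scalerA.
    by rewrite -!addrA; congr (_ + _); rewrite [RHS]addrC -!addrA; congr (_ + _);
      rewrite [RHS]addrC addrA addrAC.
  by move=> /uvs_free[+ + e0]; rewrite e0 !mul0r !subr0.
have r0 : r != 0.
  apply/eqP => rE; have h : comb3 u v r 0 0 1 = 0 by rewrite /comb3 rE scaler0 !scale0r !addr0.
  by have [_ _ /eqP] := uvr_free _ _ _ h; rewrite oner_eq0.
have BN w a x : B w (- (a *: x)) = - (a * B w x).
  by rewrite -scaleNr /B differential_scaler mulNr.
have [_ _ B3] := Fq i0.
have B0u : B u r = 0.
  rewrite /r /B !differential_addr -/B !BN.
  by rewrite {2}/B quadratic_double// Fu !mulr0 subr0 /d mulfVK ?subrr//; exact: Fuv.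
have B0v : B v r = 0.
  rewrite /r /B !differential_addr -/B !BN.
  rewrite {3}/B quadratic_double// Fv !mulr0 subr0 {2}/B B3 -/(B u v) /c.
  by rewrite mulfVK ?subrr//; exact: Fuv.
have Bu i : differential (F i) u r = 0.
  have [->//|ii0] := eqVneq i i0.
  have [_ _ E] := p_tangent _ _ ii0.
  exact: (tangent_line_transfer (Fq i0) pu r0 (esym E) B0u).
have Bv i : differential (F i) v r = 0.
  have [->//|ii0] := eqVneq i i0.
  have [_ _ E] := q_tangent _ _ ii0.
  exact: (tangent_line_transfer (Fq i0) qv r0 (esym E) B0v).
have Fr i : peval (F i) r != 0.
  exact: (smooth_pole_neq0 uvr_free (Fq i) (Fs i) (Bu i) (Bv i)).
pose al i := differential (F i) u v; pose lam i := - (peval (F i) r / al i).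
have key i w : peval (F i) (w *m basis_mx u v r) =
    al i * (w 0 o0 * w 0 o1 - lam i * w 0 o2 ^+ 2).
  rewrite mulmx_basis (peval_comb3 _ _ _ _ _ _ (Fq i)) Fu Fv Bu Bv.
  rewrite -/(al i) !mulr0 !addr0 !add0r.
  rewrite mulrBr /lam mulNr mulrN opprK mulrA [al i * (_ / _)]mulrC mulfVK; last exact: Fuv.
  by rewrite addrC mulrC [w 0 o2 ^+ 2 * _]mulrC.
exists (basis_mx u v r), lam, al; split.
- exact: (basis_unit uvr_free).
- by move=> i; rewrite oppr_eq0 mulf_eq0 invr_eq0 (negbTE (Fr i)) (negbTE (Fuv i)).
- exact: Fuv.
- move=> i j E; apply: F_distinct; apply/seteqP; move: E.
have sub k l : lam k = lam l -> zero_locus (F k) `<=` zero_locus (F l).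
  move=> kl x hx w /hx; have -> : w = (w *m invmx (basis_mx u v r)) *m basis_mx u v r.
    by rewrite (mulmxKV (basis_unit uvr_free)).
  rewrite !key => /eqP; rewrite mulf_eq0 (negbTE (Fuv k)) /= kl => /eqP ->.
  by rewrite mulr0.
  by move=> E; split; [exact: sub|exact: (sub _ _ (esym E))].
- exact: key.
Qed.

(** * Choice of the twist and of the rotation *)

Section GenericTwist.
Variable R : realType.
Local Notation C := R[i].
Local Notation Re := complex.Re.
Local Notation Im := complex.Im.

Lemma sin_neq0 (x : R) : x != 0 -> `|x| < pi -> sin x != 0.
Proof.
rewrite neq_lt => /orP[x0|x0] hx.
  rewrite -oppr_eq0 -sinN gt_eqF// sin_gt0_pi// oppr_gt0 x0 /=.
  by apply: le_lt_trans hx; rewrite -normrN ler_norm.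
by rewrite gt_eqF// sin_gt0_pi// x0 /=; apply: le_lt_trans hx; rewrite ler_norm.
Qed.

Lemma Re_sign_cases (u : C) : off_npos (- u) \/ Im u = 0 /\ 0 <= Re u.
Proof.
rewrite /off_npos ImN ReN oppr_eq0 oppr_gt0.
by case: eqVneq => [->|_] /=; [case: ltP; [left|right]|left].
Qed.

(** [off_npos (- v)] says that v is not a nonnegative real. Either this holds for [u] and persists,
    or [u] is a positive real and a small nonzero angle takes it off the real axis. *)
Lemma near_rotation (f : R -> R) (u : C) : f 0 = 0 ->
  (forall t, 0 < t -> f t != 0) -> {for 0, continuous f} -> u != 0 ->
  \forall t \near (0 : R)^'+, off_npos (- (u * cexp (f t))).
Proof.
move=> f0 fn fc u0; have [hu|[I0 R0]] := Re_sign_cases u.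
  have c1 : {for (0 : R), continuous (fun t => - (u * cexp (f t)) : C)}.
    apply: (@for_opp R (0 : R) C).
    apply: (@forC_mul R R 0); first exact: for_cst.
    exact: for_cexp.
  have h0 : off_npos (- (u * cexp (f 0))) by rewrite f0 cexp0 mulr1.
  have n0 := near_off_npos (x := (0 : R)) (f := fun t => - (u * cexp (f t)) : C) h0 c1.
  by apply: filterS n0 => t ht _.
have n1 : \forall t \near (0 : R), `|f t| < pi.
  apply: near_lt; last by rewrite f0 normr0 pi_gt0.
  by apply: for_comp fc _; exact: norm_continuous.
apply: filterS n1 => t ht t0.
apply/orP; left; rewrite ImN oppr_eq0 ImM I0 mul0r addr0 mulf_neq0//.
  by apply: contraNneq u0 => Z; apply/eqP/complex_eqP.
by apply: sin_neq0 => //; exact: fn.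
Qed.

(** The twist turns [u] by the angle -t ln|u|, which is nonzero unless |u| = 1; and on the unit
    circle only 1 is a positive real. *)
Lemma near_twist (u : C) : u != 0 -> u != 1 ->
  \forall t \near (0 : R)^'+, off_npos (- twist t u).
Proof.
move=> u0 u1; have [l0|l0] := eqVneq (ln (cabs u)) 0; last first.
  have c : {for (0 : R), continuous (fun t : R => - (t * ln (cabs u)))}.
    by apply: for_opp; apply: for_mul; [exact: cvg_id|exact: for_cst].
  have h t : 0 < t -> - (t * ln (cabs u)) != 0.
    by move=> t0; rewrite oppr_eq0 mulf_neq0// gt_eqF.
  have z : - (0 * ln (cabs u)) = 0 by rewrite mul0r oppr0.
  have r := near_rotation (f := fun t : R => - (t * ln (cabs u))) z h c u0.
  by apply: filterS r => t ht; exact: ht.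
have tE t : twist t u = u by rewrite /twist l0 mulr0 oppr0 cexp0 mulr1.
apply: nearW => t; rewrite tE; have [//|[I0 R0]] := Re_sign_cases u.
have cu : cabs u = 1.
  by apply/eqP; rewrite -ln_eq0 ?cabs_gt0// l0.
case/eqP: u1; apply: complex_eqP => //=.
apply/eqP; rewrite -(@eqrXn2 _ 2)// expr1n; apply/eqP.
by have := cabs_sqr u; rewrite cu I0 expr1n expr0n addr0.
Qed.

(** [al] comes first and separates the ratios, which a common rotation does not affect; a small [th]
    then moves all values off the positive reals. *)
Lemma generic_angles (n : nat) (lam : 'I_n -> C) : (forall i, lam i != 0) -> injective lam ->
  exists al th : R,
    (forall i j, i != j -> off_npos (- twist al (lam i / lam j))) /\
    (forall i, off_npos (- (twist al (lam i) * cexp th))).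
Proof.
move=> lam0 lam_inj.
have n1 : \forall t \near (0 : R)^'+, forall i j, i != j -> off_npos (- twist t (lam i / lam j)).
  apply: filter_forall => i; apply: filter_forall => j.
  have [->|ij] := eqVneq i j; first by apply: nearW.
  have h : \forall t \near (0 : R)^'+, off_npos (- twist t (lam i / lam j)).
    apply: near_twist; first by rewrite mulf_neq0 ?invr_eq0.
    apply: contra ij => /eqP E; apply/eqP/lam_inj.
    by rewrite -(mulfVK (lam0 j) (lam i)) E mul1r.
  by apply: filterS h.
near (0 : R)^'+ => al.
have hal : forall i j, i != j -> off_npos (- twist al (lam i / lam j)) by near: al.
have n2 : \forall t \near (0 : R)^'+, forall i, off_npos (- (twist al (lam i) * cexp t)).
  apply: filter_forall => i.
  have c : {for (0 : R), continuous (fun t : R => t)} by exact: cvg_id.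
  have h (t : R) : 0 < t -> t != 0 by exact: lt0r_neq0.
  have u0 : twist al (lam i) != 0 by rewrite twist_eq0.
  exact: (near_rotation (f := fun t : R => t) erefl h c u0).
near (0 : R)^'+ => th; exists al, th; split=> //.
by near: th.
Unshelve. all: by end_near. Qed.

Lemma root_false_neg (u : C) : off_npos (- u) -> 0 < Im (root false u) /\ root false u ^+ 2 = u.
Proof.
have -> : - u = eta R false ^+ 2 * u by rewrite /eta sqr_i mulN1r.
by move=> h; split; [exact: (@root_half R false)|exact: root_sqr].
Qed.

Lemma generic_twist (n : nat) (lam : 'I_n -> C) : (forall i, lam i != 0) -> injective lam ->
  exists (al : R) (rho : C) (sg : 'I_n -> 'I_n) (mu : 'I_n -> C),
    [/\ injective sg, rho != 0, forall k, 0 < Im (mu k),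
      forall j k : 'I_n, (j < k)%N -> Re (mu k) * Im (mu j) < Re (mu j) * Im (mu k) &
      forall k, mu k ^+ 2 = rho * twist al (lam (sg k))].
Proof.
move=> lam0 lam_inj; have [al [th [hal hth]]] := generic_angles lam0 lam_inj.
pose m i := root false (twist al (lam i) * cexp th).
have m_Im i : 0 < Im (m i) by have [] := root_false_neg (hth i).
have m2 i : m i ^+ 2 = twist al (lam i) * cexp th by have [] := root_false_neg (hth i).
(* Minus the cotangent of the argument, an increasing function of it on the upper half-plane. *)
pose key i := - (Re (m i) / Im (m i)).
pose leT : rel 'I_n := fun i j => key i <= key j.
have key_lt i j : (key i < key j) = (Re (m j) * Im (m i) < Re (m i) * Im (m j)).
  by rewrite ltrN2 ltr_pdivrMr// mulrAC ltr_pdivlMr.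
(* Equal keys make [m i] a positive real multiple of [m j], hence the twisted ratio of the [lam] a
   positive real, which [hal] excludes. *)
have key_inj i j : i != j -> key i != key j.
  move=> ij; apply/eqP => /oppr_inj E.
  have := hal i j ij; pose c := Im (m i) / Im (m j).
  have mE : m i = c%:C%C * m j.
    apply: complex_eqP; rewrite ?ReZ ?ImZ /c; last by rewrite mulfVK ?gt_eqF.
    by rewrite mulrAC -mulrA -E mulrC mulfVK ?gt_eqF.
  have lE : twist al (lam i / lam j) = (c ^+ 2)%:C%C.
    have th0 := cexp_neq0 th.
    have : twist al (lam i / lam j) * (twist al (lam j) * cexp th) =
        (c ^+ 2)%:C%C * (twist al (lam j) * cexp th).
      by rewrite mulrA -twistM mulfVK// -!m2 mE exprMn rmorphXn.
    by apply: mulIf; rewrite mulf_neq0// twist_eq0.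
  rewrite lE /off_npos ImN ReN /= oppr0 eqxx /= oppr_gt0.
  by rewrite ltNge sqr_ge0.
pose l := sort leT (enum 'I_n).
have lu : uniq l by rewrite sort_uniq enum_uniq.
have ls : size l = n by rewrite size_sort size_enum_ord.
pose sg (k : 'I_n) := nth k l k.
have sgE i (k : 'I_n) : sg k = nth i l k by apply: set_nth_default; rewrite ls.
have sg_inj : injective sg.
  move=> j k; rewrite (sgE k j) => /eqP; rewrite nth_uniq ?ls// => /eqP.
  exact: val_inj.
exists al, (cexp th), sg, (fun k => m (sg k)); split => //.
- exact: cexp_neq0.
- move=> j k jk; rewrite -key_lt lt_neqAle key_inj /=; last first.
    by apply: contraTneq jk => /sg_inj ->; rewrite ltnn.
  have le_tr : transitive leT by move=> x y z; exact: le_trans.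
  have le_rf : reflexive leT by move=> x; exact: lexx.
  have ss : sorted leT l by apply: sort_sorted => x y; exact: le_total.
  by rewrite (sgE k j); apply: (sorted_leq_nth le_tr le_rf k ss); rewrite ?inE ?ls// ltnW.
- by move=> k; rewrite m2 mulrC.
Qed.

End GenericTwist.

(** * Homogeneous coordinates and meridians *)

Section RowTopology.
Variables (T : topologicalType) (x : T) (V : topologicalType).

Lemma for_row (m : nat) (f : T -> 'rV[V]_m) :
  (forall j, {for x, continuous (fun t => f t 0 j)}) -> {for x, continuous f}.
Proof.
move=> fc A [P hP PA].
have h : \forall t \near x, forall j, P 0 j (f t 0 j).
  by apply: filter_forall => j; exact: (fc j _ (hP 0 j)).
by apply: filterS h => t ht; apply: PA => i j; rewrite (ord1 i).
Qed.

Lemma for_entry (m : nat) (f : T -> 'rV[V]_m) j : {for x, continuous f} ->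
  {for x, continuous (fun t => f t 0 j)}.
Proof.
move=> fc A hA; apply: (fc [set u | A (u 0 j)]).
exists (fun i j' => if (i, j') == (0, j) then A else setT) => /=.
  move=> i j'; case: eqP => [[-> ->] //|_]; exact: filterT.
by move=> u hu; have := hu 0 j; rewrite eqxx.
Qed.

End RowTopology.

Lemma set_type_nbhs (Y : topologicalType) (S : set Y) (y : S) (A : set S) :
  nbhs y A -> exists O : set Y, [/\ open O, O (\val y) & forall z : S, O (\val z) -> A z].
Proof.
rewrite nbhsE => -[B [Bo By] BA]; case: Bo => O Oo E; exists O; split=> //.
  by have : B y by []; rewrite -E.
by move=> z Oz; apply: BA; rewrite -E.
Qed.

Lemma set_type_near (Y : topologicalType) (S : set Y) (O : set Y) (y : S) :
  open O -> O (\val y) -> \forall z \near y, O (\val z).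
Proof.
move=> Oo Oy; apply: (@open_nbhs_nbhs S y (\val @^-1` O)).
by split=> //; exists O.
Qed.

(** Openness is tested on the cone over [U]; the set [O] is constrained only at nonzero vectors. *)
Lemma open_P2 (R : realType) (U : set (P2 R)) : open U <->
  exists2 O : set 'rV[R[i]]_3, open O &
    forall x v, coords x v -> U x <-> O v.
Proof.
split=> [|[V Vo VU]].
  case=> O Oo E; exists O => // x v [u uv xE].
  have -> : U x <-> (\val @^-1` O) u by rewrite E xE.
  by rewrite /= -uv.
exists V => //; apply/seteqP; split=> u hu.
  have h : coords (\pi_{eq_quot (@proportional_equiv R)} u)%qT (nzvec_val u) by exists u.
  exact/(VU _ _ h).
have h : coords (\pi_{eq_quot (@proportional_equiv R)} u)%qT (nzvec_val u) by exists u.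
exact: (VU _ _ h).1.
Qed.

(** * A circle about 1 and its position with respect to the unit circle *)

Section Circle.
Variable R : realType.
Local Notation C := R[i].
Local Notation Re := complex.Re.
Local Notation Im := complex.Im.
Implicit Types (b t : R) (u : C).

Lemma slit_le1 u : cabs u <= 1 -> u != 1 -> slit u.
Proof.
move=> u1 un; rewrite /slit; case: eqVneq => //= I0.
rewrite lt_neqAle (le_trans (ler_norm _) (le_trans (Re_le_cabs u) u1)) andbT.
by apply: contra un => /eqP R1; apply/eqP/complex_eqP.
Qed.

(* Centre 1; meets the unit circle at t = 0 in [cexp (- (2 * b))] and at
   t = 1 / 2 + b / pi in [cexp (2 * b)]. *)
Definition circle b t : C := 1 + cexp (2 * pi * t) * (cexp (- (2 * b)) - 1).

Lemma cexp_pi : cexp (pi : R) = -1.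
Proof. by rewrite /cexp cospi sinpi; apply: complex_eqP; rewrite ?ReN ?ImN //= oppr0. Qed.

Lemma circle0 b : circle b 0 = cexp (- (2 * b)).
Proof. by rewrite /circle mulr0 cexp0 mul1r addrC subrK. Qed.

Lemma circle1 b : circle b 1 = circle b 0.
Proof.
rewrite circle0 /circle mulr1.
have -> : 2 * pi = pi + pi :> R by ring.
by rewrite cexpD cexp_pi mulrNN !mul1r addrC subrK.
Qed.

Lemma circle_mid b : circle b (2^-1 + b / pi) = cexp (2 * b).
Proof.
have pi0 : pi != 0 :> R by rewrite gt_eqF// pi_gt0.
have E : 2 * pi * (2^-1 + b / pi) = pi + 2 * b.
  rewrite mulrDr; congr (_ + _); first by rewrite mulrAC mulfV// mul1r.
  by rewrite -mulrA; congr (2 * _); rewrite mulrCA mulfV// mulr1.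
rewrite /circle E cexpD cexp_pi mulN1r mulNr mulrBr mulr1 cexpN mulfV ?cexp_neq0//.
by rewrite opprB addrCA subrr addr0.
Qed.

Lemma circle_neq1 b t : 0 < b -> b < pi / 2 -> circle b t != 1.
Proof.
move=> b0 bpi; rewrite /circle -subr_eq0 addrAC subrr add0r mulf_neq0 ?cexp_neq0//.
rewrite subr_eq0; apply/negP => /eqP /(congr1 (@complex.Im R)) /= /eqP.
by rewrite sinN oppr_eq0 gt_eqF// sin_gt0_pi// mulr_gt0//=; lra.
Qed.

(** As e^(-2ib) - 1 = -2i sin(b) e^(-ib), the squared modulus minus 1 is 4 sin(b) (sin(2 pi t - b) +
    sin(b)), which a sum-to-product formula factors. The sign changes at pi t = pi / 2 + b, whence
    the time 1/2 + b / pi. *)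
Lemma cabs_circle b t :
  cabs (circle b t) ^+ 2 = 1 + 8 * (sin b * sin (pi * t) * cos (pi * t - b)).
Proof.
have E1 : 2 * pi * t = pi * t + pi * t :> R by ring.
have E2 : 2 * b = b + b by ring.
rewrite cabs_sqr /circle E1 E2 ReD ImD ReM ImM ReB ImB /= cosN sinN.
rewrite cosB !cosD !sinD.
have A := cos2Dsin2 (pi * t); have B := cos2Dsin2 b.
move: (cos (pi * t)) (sin (pi * t)) (cos b) (sin b) A B => x x' y y' A B.
have {}A : x ^+ 2 = 1 - x' ^+ 2 by rewrite -A addrK.
have {}B : y ^+ 2 = 1 - y' ^+ 2 by rewrite -B addrK.
ring: A B. Qed.

Lemma circle_ge1 b t : 0 < b -> b < pi / 2 -> 0 <= t <= 2^-1 + b / pi -> 1 <= cabs (circle b t).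
Proof.
move=> b0 bpi /andP[t0 t1]; have p0 := pi_gt0 R.
rewrite -(@ler_sqr R) ?nnegrE ?cabs_ge0// expr1n cabs_circle lerDl.
have t1' : pi * t <= pi / 2 + b.
  have := ler_wpM2l (ltW p0) t1; rewrite mulrDr mulrCA mulfV ?gt_eqF// mulr1.
  by [].
rewrite mulr_ge0// mulr_ge0//; last first.
  by apply: cos_ge0_pihalf; have := mulr_ge0 (ltW p0) t0; move: t1'; lra.
rewrite mulr_ge0//; first by rewrite ltW// sin_gt0_pi// b0 /=; lra.
by apply: sin_ge0_pi; rewrite (mulr_ge0 (ltW p0) t0) /=; move: t1'; lra.
Qed.

Lemma circle_le1 b t : 0 < b -> b < pi / 2 -> 2^-1 + b / pi <= t <= 1 -> cabs (circle b t) <= 1.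
Proof.
move=> b0 bpi /andP[t0 t1]; have p0 := pi_gt0 R.
rewrite -(@ler_sqr R) ?nnegrE ?cabs_ge0// expr1n cabs_circle gerDl.
have t0' : pi / 2 + b <= pi * t.
  have := ler_wpM2l (ltW p0) t0; rewrite mulrDr mulrCA mulfV ?gt_eqF// mulr1.
  by [].
have t1' : pi * t <= pi by rewrite ler_piMr// ltW.
rewrite mulr_ge0_le0// mulr_ge0_le0//.
  rewrite mulr_ge0//; first by rewrite ltW// sin_gt0_pi// b0 /=; lra.
  apply: sin_ge0_pi; rewrite t1' andbT; lra.
rewrite -[pi * t - b](subrK (pi / 2)) cosDpihalf oppr_le0.
by apply: sin_ge0_pi; apply/andP; split; lra.
Qed.

Lemma circle_continuous b t : {for t, continuous (circle b)}.
Proof.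
apply: forC_add; first exact: for_cst.
apply: forC_mul; last exact: for_cst.
by apply: for_cexp; apply: for_mul; [exact: for_cst|exact: cvg_id].
Qed.

Lemma circle_radius b t : cabs (circle b t - 1) = cabs (cexp (- (2 * b)) - 1).
Proof. by rewrite /circle addrAC subrr add0r cabsM cabs_cexp mul1r. Qed.

End Circle.

(** * A transverse disc at one conic *)

Section DiscModel.
Variables (R : realType) (n' : nat).
Local Notation n := n'.+1.
Local Notation C := R[i].
Local Notation Re := complex.Re.
Local Notation Im := complex.Im.
Local Notation C3 := (C * C * C)%type.
Variable mu : 'I_n -> C.
Hypothesis mu_Im : forall k, 0 < Im (mu k).
Hypothesis mu_sorted : forall j k : 'I_n, (j < k)%N ->
  Re (mu k) * Im (mu j) < Re (mu j) * Im (mu k).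
Variables (al : R) (k : 'I_n).
Local Notation tw := (twist al).

(* Points of the line x = mu k * z through [mu k : mu k : 1]; on it the
   coordinate xy / z^2 is mu k ^ 2 times [tw u], and [tw] fixes the unit circle. *)
Definition disc_point (u : C) : C3 := (mu k, mu k * tw u, 1).

(** Near u = 1 the conditions on x / y and on the conics other than k hold for both charts, so that
    for u different from 1 the modulus of [u] alone decides. *)
Definition near_center (u : C) : Prop :=
  [/\ u != 0, off_npos (tw u)^-1 & forall j, j != k ->
    slit (mu j ^+ 2 / (mu k ^+ 2 * tw u)) /\ slit (mu k ^+ 2 * tw u / mu j ^+ 2)].

Lemma mu_ratio_slit j i : j != i -> slit (mu j ^+ 2 / mu i ^+ 2).
Proof.
move=> ji; rewrite /slit; case: eqVneq => //= I0.
by apply: lt_trans (mu_arg mu_Im mu_sorted ji I0) ltr01.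
Qed.

Lemma near_center1 : \forall u \near (1 : C), near_center u.
Proof.
have c : {for (1 : C), continuous (fun u : C => tw u)} by exact: twist_continuous.
have t1 : tw 1 = 1 := twist1 al.
have t0 : tw 1 != 0 by rewrite t1 oner_neq0.
have ci := @forC_inv R _ (1 : C) (fun u : C => tw u) t0 c.
have n1 : \forall u \near (1 : C), u != 0.
  by apply: (@nearC_neq R _ (1 : C) (fun u : C => u)); [exact: cvg_id|exact: oner_neq0].
have n2 : \forall u \near (1 : C), off_npos (tw u)^-1.
  apply: (near_off_npos (f := fun u : C => (tw u)^-1)) => //.
  by rewrite t1 invr1 /off_npos /= ltr01 orbT.
have cm : {for (1 : C), continuous (fun u : C => mu k ^+ 2 * tw u)}.
  by apply: forC_mul; [exact: for_cst|exact: c].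
have m0 : mu k ^+ 2 * tw 1 != 0 by rewrite t1 mulr1 expf_neq0// mu_neq0.
have n3 : \forall u \near (1 : C), forall j, j != k ->
    slit (mu j ^+ 2 / (mu k ^+ 2 * tw u)) /\ slit (mu k ^+ 2 * tw u / mu j ^+ 2).
  have FF : Filter (nbhs (1 : C)) by exact: nbhs_filter.
  apply: (@filter_forall _ _ _ _ FF) => j; have [->|jk] := eqVneq j k; first by apply: nearW.
  have d1 := @forC_div R _ (1 : C) (fun=> mu j ^+ 2) (fun u : C => mu k ^+ 2 * tw u)
    m0 (@for_cst _ (1 : C) C (mu j ^+ 2)) cm.
  have j0 : mu j ^+ 2 != 0 by rewrite expf_neq0// mu_neq0.
  have d2 := @forC_div R _ (1 : C) (fun u : C => mu k ^+ 2 * tw u) (fun=> mu j ^+ 2)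
    j0 cm (@for_cst _ (1 : C) C (mu j ^+ 2)).
  have e1 : slit (mu j ^+ 2 / (mu k ^+ 2 * tw 1)) by rewrite t1 mulr1 mu_ratio_slit.
  have e2 : slit (mu k ^+ 2 * tw 1 / mu j ^+ 2).
    by rewrite t1 mulr1 mu_ratio_slit// eq_sym.
  have s1 := near_slit (f := fun u : C => mu j ^+ 2 / (mu k ^+ 2 * tw u)) e1 d1.
  have s2 := near_slit (f := fun u : C => mu k ^+ 2 * tw u / mu j ^+ 2) e2 d2.
  by apply: filterS (filterI s1 s2) => u [h1 h2] _.
by apply: filterS (filterI n1 (filterI n2 n3)) => u [h1 [h2 h3]].
Qed.

(** Turning [mu k] by a small angle keeps it on the same side of the other lines and puts it just
    before or just after line k. *)
Lemma near_center_sector : \forall b \near (0 : R)^'+,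
  sector mu (cexp (- b) * mu k) k /\ sector mu (cexp b * mu k) k.+1.
Proof.
have ec (f : R -> R) j : {for (0 : R), continuous f} ->
    {for (0 : R), continuous (fun b => ell mu j (cexp (f b) * mu k))}.
  move=> fc; have c1 : {for (0 : R), continuous (fun b => cexp (f b) * mu k)}.
    by apply: forC_mul; [exact: for_cexp|exact: for_cst].
  have d1 := for_mul (for_Re c1) (@for_cst _ (0 : R) R (Im (mu j))).
  have d2 := for_mul (for_Im c1) (@for_cst _ (0 : R) R (Re (mu j))).
  exact: for_sub d1 d2.
have sgn (f : R -> R) j : {for (0 : R), continuous f} -> f 0 = 0 -> j != k ->
    \forall b \near (0 : R), (ell mu j (cexp (f b) * mu k) < 0) = (j < k)%N /\
      ell mu j (cexp (f b) * mu k) != 0.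
  move=> fc f0 jk; have c := ec f j fc.
  have e0 : ell mu j (cexp (f 0) * mu k) = ell mu j (mu k) by rewrite f0 cexp0 mul1r.
  have [lt_jk|lt_kj|E] := ltngtP (nat_of_ord j) (nat_of_ord k).
  - have h : ell mu j (cexp (f 0) * mu k) < 0 by rewrite e0; exact: ell_mu_lt0.
    by apply: filterS (near_lt c h) => b hb; rewrite hb (lt_eqF hb).
  - have h : 0 < ell mu j (cexp (f 0) * mu k) by rewrite e0; exact: ell_mu_gt0.
    apply: filterS (near_gt c h) => b hb; rewrite (lt_gtF hb) (gt_eqF hb).
    by split=> //; apply/esym/negbTE; rewrite -leqNgt ltnW.
  - by case/eqP: jk; exact: val_inj.
have own b : ell mu k (cexp b * mu k) = - (sin b * cabs (mu k) ^+ 2) by rewrite ell_mul.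
have mk2 : 0 < cabs (mu k) ^+ 2 by rewrite exprn_gt0// cabs_gt0 mu_neq0.
have npi : \forall b \near (0 : R), b < pi.
  by apply: (near_lt (f := fun b : R => b)); [exact: cvg_id|exact: pi_gt0].
have FF : Filter (nbhs (0 : R)) by exact: nbhs_filter.
have n1 : \forall b \near (0 : R), forall j, j != k ->
    (ell mu j (cexp (- b) * mu k) < 0) = (j < k)%N /\ ell mu j (cexp (- b) * mu k) != 0.
  apply: (@filter_forall _ _ _ _ FF) => j; have [->|jk] := eqVneq j k; first by apply: nearW.
  have c : {for (0 : R), continuous (fun b : R => - b)} by apply: for_opp; exact: cvg_id.
  by apply: filterS (sgn _ j c (oppr0 _) jk).
have n2 : \forall b \near (0 : R), forall j, j != k ->
    (ell mu j (cexp b * mu k) < 0) = (j < k)%N /\ ell mu j (cexp b * mu k) != 0.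
  apply: (@filter_forall _ _ _ _ FF) => j; have [->|jk] := eqVneq j k; first by apply: nearW.
  have c : {for (0 : R), continuous (fun b : R => b)} by exact: cvg_id.
  by apply: filterS (sgn _ j c erefl jk).
apply: filterS (filterI npi (filterI n1 n2)) => b [bpi [h1 h2]] b0.
have s0 : 0 < sin b by rewrite sin_gt0_pi// b0.
have m0 : 0 < sin b * cabs (mu k) ^+ 2 by rewrite mulr_gt0.
split=> j; have [->|jk] := eqVneq j k.
- by rewrite own sinN mulNr opprK (gt_eqF m0) (lt_gtF m0) ltnn.
- exact: h1.
- by rewrite own oppr_lt0 oppr_eq0 (gt_eqF m0) m0 ltnSn.
- have [-> ->] := h2 j jk; split=> //.
  by rewrite [RHS]ltnS [RHS]leq_eqVlt -[X in X || _]/(j == k) (negbTE jk).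
Qed.

Lemma disc_radius : exists b : R, [/\ 0 < b, b < pi / 2,
  sector mu (cexp (- b) * mu k) k, sector mu (cexp b * mu k) k.+1 &
  forall u, cabs (u - 1) <= cabs (cexp (- (2 * b)) - 1) -> near_center u].
Proof.
have [e e0 he] : exists2 e : R, 0 < e & forall u, cabs (u - 1) < e -> near_center u.
  have /nbhs_ballP[ce /= ce0 h] := near_center1.
  have [e e0 ceE] : exists2 e : R, 0 < e & ce = e%:C%C.
    case: ce ce0 {h} => e e'; rewrite ltcE /= => /andP[/eqP -> e0].
    by exists e.
  exists e => // u hu; apply: h; rewrite /ball /= normr_cabs ceE ltcR.
  by rewrite -[1 - u]opprB; move: hu; rewrite /cabs ReN ImN !sqrrN.
have n1 : \forall b \near (0 : R)^'+, cabs (cexp (- (2 * b)) - 1) < e.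
  have c : {for (0 : R), continuous (fun b : R => cabs (cexp (- (2 * b)) - 1))}.
    apply: for_cabs; apply: forC_add; last exact: for_cst.
    apply: for_cexp; apply: for_opp; apply: for_mul; [exact: for_cst|exact: cvg_id].
  have h : cabs (cexp (- (2 * 0)) - 1) < e.
    by rewrite mulr0 oppr0 cexp0 subrr /cabs /= expr0n addr0 sqrtr0.
  by apply: filterS (near_lt c h).
have n2 : \forall b \near (0 : R)^'+, b < pi / 2.
  have h : 0 < pi / 2 :> R by rewrite divr_gt0// pi_gt0.
  by apply: filterS (near_lt (f := fun b : R => b) (@cvg_id _ _) h).
have n3 := near_center_sector.
near (0 : R)^'+ => b; exists b.
have [s1 s2] : sector mu (cexp (- b) * mu k) k /\ sector mu (cexp b * mu k) k.+1 by near: b.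
have b0 : 0 < b by near: b; exact: nbhs_right_gt.
have bpi : b < pi / 2 by near: b.
have be : cabs (cexp (- (2 * b)) - 1) < e by near: b.
by split=> // u hu; apply: he; exact: le_lt_trans hu be.
Unshelve. all: by end_near. Qed.

Lemma twist_neq1 u : u != 1 -> tw u != 1.
Proof. by apply: contra => /eqP E; apply/eqP/(@twist_inj R al); rewrite E twist1. Qed.

(** Here xy / (mu_k^2 z^2) is [tw u], which has the modulus of [u] and differs from 1. In the chart
    at infinity its inverse is tested, hence the opposite inequality on the modulus. *)
Lemma disc_chart_none u : near_center u -> cabs u <= 1 -> u != 1 ->
  chart mu None (disc_point u).
Proof.
move=> [u0 _ hu] u1 un; split=> [|j]; first exact: oner_neq0.
rewrite /disc_point /= expr1n mulr1 mulrA -expr2.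
have [->|jk] := eqVneq j k; last by have [] := hu j jk.
rewrite mulrC mulKf ?expf_neq0 ?mu_neq0//.
by apply: slit_le1; rewrite ?cabs_twist ?twist_neq1.
Qed.

Lemma disc_chart_true u : near_center u -> 1 <= cabs u -> u != 1 ->
  chart mu (Some true) (disc_point u).
Proof.
move=> [u0 hn hu] u1 un; have m0 := mu_neq0 mu_Im.
have t0 : tw u != 0 by rewrite twist_eq0.
rewrite /disc_point; split=> /=.
- exact: m0.
- by rewrite mulf_neq0.
- by rewrite expr1n mul1r invfM mulrA mulfV// mul1r.
move=> j; rewrite expr1n mulr1 mulrA -expr2.
have [->|jk] := eqVneq j k; last by have [] := hu j jk.
rewrite invfM mulrA mulfV ?expf_neq0// mul1r.
apply: slit_le1; first by rewrite cabsV cabs_twist invf_le1// (lt_le_trans ltr01).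
by rewrite -[1]invr1 (inj_eq invr_inj) twist_neq1.
Qed.

Lemma disc_off u : near_center u -> u != 1 -> off_conics mu (disc_point u).
Proof.
move=> hu un; have [u1|/ltW u1] := leP (cabs u) 1.
  exact: (chart_off_conics mu_Im (disc_chart_none hu u1 un)).
exact: (chart_off_conics mu_Im (disc_chart_true hu u1 un)).
Qed.

(** The twist is the identity on the unit circle, so [r] and [m] are explicit there. *)
Lemma disc_sector_point b : disc_point (cexp (2 * b)) = sector_point (cexp (- b)) (cexp b * mu k).
Proof.
have E : tw (cexp (2 * b)) = cexp b * cexp b.
  by rewrite /twist cabs_cexp ln1 mulr0 oppr0 cexp0 mulr1 mulr_natl mulr2n cexpD.
rewrite /disc_point /sector_point E cexpN invrK; congr (_, _, _).
  by rewrite mulrA mulVf ?mul1r ?cexp_neq0.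
by rewrite [RHS]mulrAC [LHS]mulrC.
Qed.

Lemma disc_point_continuous u : {for u, continuous disc_point}.
Proof.
have c : {for u, continuous (fun u : C => mu k * tw u)}.
  by apply: forC_mul; [exact: for_cst|exact: twist_continuous].
exact: for_pair (for_pair (@for_cst _ u C (mu k)) c) (@for_cst _ u C 1).
Qed.

End DiscModel.

(** * Return to the given homogeneous coordinates *)

Section Coordinates.
Variables (R : realType) (n' : nat).
Local Notation n := n'.+1.
Local Notation C := R[i].
Local Notation Re := complex.Re.
Local Notation Im := complex.Im.
Local Notation C3 := (C * C * C)%type.
Variable F : 'I_n -> mpoly.mpoly 3 C.
Variables (P : 'M[C]_3) (lam a : 'I_n -> C).
Hypothesis P_unit : P \in unitmx.
Hypothesis a_neq0 : forall i, a i != 0.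
Hypothesis F_eq : forall i u,
  peval (F i) (u *m P) = a i * (u 0 o0 * u 0 o1 - lam i * u 0 o2 ^+ 2).
Variables (al : R) (rho : C) (sg : 'I_n -> 'I_n) (mu : 'I_n -> C).
Hypothesis sg_inj : injective sg.
Hypothesis rho_neq0 : rho != 0.
Hypothesis mu_Im : forall k, 0 < Im (mu k).
Hypothesis mu_sorted : forall j k : 'I_n, (j < k)%N ->
  Re (mu k) * Im (mu j) < Re (mu j) * Im (mu k).
Hypothesis mu_sqr : forall k, mu k ^+ 2 = rho * twist al (lam (sg k)).
Local Notation X := (~` union_curve F).
Local Notation tw := (twist al).
Local Notation untw := (twist (- al)).
Local Notation off := (off_conics mu).

Lemma untwK : cancel untw tw.
Proof. by move=> w; have := twistK (- al) w; rewrite opprK. Qed.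

Definition row3 (x y z : C) : 'rV[C]_3 := \row_j nth 0 [:: x; y; z] j.

Lemma row3E (u : 'rV[C]_3) : u = row3 (u 0 o0) (u 0 o1) (u 0 o2).
Proof.
apply/rowP => j; rewrite !mxE; have : j \in enum 'I_3 by rewrite mem_enum.
by rewrite enum_ordSl enum_ordSl enum_ordSl enum_ord0 !inE /= => /or3P[] /eqP ->.
Qed.

(** Undoes the rotation and the twist, then applies [P]. The factor [rho] is put on x alone, so that
    xy is divided by it once. *)
Definition vec (v : C3) : 'rV[C]_3 := row3 (untw (v.1.1 / rho)) (untw v.1.2) (untw v.2) *m P.

Definition unvec (w : 'rV[C]_3) : C3 :=
  let u := w *m invmx P in (rho * tw (u 0 o0), tw (u 0 o1), tw (u 0 o2)).

Lemma vecK v : unvec (vec v) = v.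
Proof.
case: v => [[x y] z]; rewrite /unvec /vec (mulmxK P_unit) !mxE /= !untwK.
by rewrite mulrC mulfVK.
Qed.

Lemma unvecK w : vec (unvec w) = w.
Proof.
rewrite /unvec /vec /= [rho * _]mulrC mulfK// !twistK -row3E.
exact: mulmxKV.
Qed.

Lemma row3Z c x y z : row3 (c * x) (c * y) (c * z) = c *: row3 x y z.
Proof. by rewrite [RHS]row3E !mxE. Qed.

Lemma vec_scale c v : vec (scale3 c v) = untw c *: vec v.
Proof. by rewrite /vec /scale3 /= -mulrA !twistM row3Z scalemxAl. Qed.

Lemma unvec_scale c w : unvec (c *: w) = scale3 (tw c) (unvec w).
Proof.
rewrite /unvec /scale3 -scalemxAl !mxE !twistM /=.
by congr (_, _, _); rewrite mulrCA.
Qed.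

Lemma peval_vec i v : peval (F i) (vec v) =
  a i * (untw (v.1.1 / rho) * untw v.1.2 - lam i * untw v.2 ^+ 2).
Proof. by rewrite /vec F_eq !mxE. Qed.

Lemma peval_vec_eq0 k v : (peval (F (sg k)) (vec v) == 0) =
  (v.1.1 * v.1.2 == mu k ^+ 2 * v.2 ^+ 2).
Proof.
rewrite peval_vec mulf_eq0 (negbTE (a_neq0 _)) /= subr_eq0.
have E (u w : C) : tw (untw u * untw w) = u * w by rewrite twistM !untwK.
rewrite -(inj_eq (@twist_inj R al)) [untw v.2 ^+ 2]expr2 E twistM E mu_sqr.
rewrite -(inj_eq (mulfI rho_neq0)) !mulrA [rho * _]mulrC.
by rewrite mulfK// expr2 !mulrA.
Qed.

Lemma sg_surj i : exists k, i = sg k.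
Proof. by exists (invF sg_inj i); rewrite f_invF. Qed.

Lemma off_vec v : off v <-> forall i, peval (F i) (vec v) != 0.
Proof.
split=> [h i|h k]; last by rewrite -peval_vec_eq0.
by have [k ->] := sg_surj i; rewrite peval_vec_eq0.
Qed.

Lemma pevalZ2 i c w : peval (F i) (c *: w) = c ^+ 2 * peval (F i) w.
Proof.
rewrite -(mulmxKV P_unit w) scalemxAl; move: (w *m invmx P) => u.
by rewrite !F_eq !mxE; ring.
Qed.

Lemma union_curveP x w : coords x w -> union_curve F x <-> exists i, peval (F i) w = 0.
Proof.
move=> xw; split=> [[i _ h]|[i h]]; exists i => //; first exact: h.
by move=> w' /(coords_scale w' xw) [c _ ->]; rewrite pevalZ2 h mulr0.
Qed.

Lemma off_neq0 v : off v -> vec v != 0.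
Proof.
move=> /off_vec/(_ ord0); apply: contra_neq => ->.
by rewrite -(scale0r 0) pevalZ2 expr0n mul0r.
Qed.

Lemma coords_off x w : coords x w -> X x -> off (unvec w).
Proof.
move=> xw hx; apply/off_vec => i; rewrite unvecK; apply/eqP => h.
by apply: hx; apply/(union_curveP xw); exists i.
Qed.

Lemma off_coords v : off v -> exists x : X, coords (\val x) (vec v).
Proof.
move=> hv; have [x xv] := coords_point (off_neq0 hv).
have hx : X x.
  by move=> /(union_curveP xv) [i h]; have := (off_vec v).1 hv i; rewrite h eqxx.
by exists (exist _ x (mem_set hx)).
Qed.

Variable x0 : X.

(** The value [x0] on the cone over the conics is a default. *)
Definition pt (v : C3) : X :=
  match pselect (off v) with left h => sval (cid (off_coords h)) | _ => x0 end.

Definition rep (x : X) : C3 := unvec (sval (cid (coords_ex (\val x)))).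

Lemma coords_pt v : off v -> coords (\val (pt v)) (vec v).
Proof. by move=> hv; rewrite /pt; case: pselect => // h; case: cid. Qed.

Lemma coords_rep x : coords (\val x) (vec (rep x)).
Proof. by rewrite /rep unvecK; case: cid. Qed.

Lemma pt_eq v x : off v -> coords (\val x) (vec v) -> pt v = x.
Proof. by move=> hv h; apply: val_inj; exact: coords_inj (coords_pt hv) h. Qed.

Lemma rep_off x : off (rep x).
Proof.
rewrite -[rep x]vecK; apply: (coords_off (x := \val x)); first exact: coords_rep.
exact: set_mem (valP x).
Qed.

Lemma repK x : pt (rep x) = x.
Proof. by apply: pt_eq; [exact: rep_off|exact: coords_rep]. Qed.

Lemma pt_scale c v : c != 0 -> off v -> pt (scale3 c v) = pt v.
Proof.
move=> c0 hv; apply: pt_eq; first exact: scale3_off_conics.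
apply/(coords_scale _ (coords_pt hv)); exists (untw c); last exact: vec_scale.
by rewrite twist_eq0.
Qed.

Lemma rep_pt v : off v -> exists2 c, c != 0 & rep (pt v) = scale3 c v.
Proof.
move=> hv; have /(coords_scale _ (coords_pt hv)) [c c0 E] := coords_rep (pt v).
exists (tw c); first by rewrite twist_eq0.
by rewrite -[rep _]vecK E unvec_scale vecK.
Qed.

Lemma for_mulmx (T : topologicalType) (x : T) (f : T -> 'rV[C]_3) (Q : 'M[C]_3) :
  {for x, continuous f} -> {for x, continuous (fun t => f t *m Q)}.
Proof.
move=> fc; apply: for_row => j.
have E : (fun t => (f t *m Q) 0 j) =
    fun t => f t 0 o0 * Q o0 j + f t 0 o1 * Q o1 j + f t 0 o2 * Q o2 j.
  by apply/funext => t; rewrite mxE !big_ord_recl big_ord0 addr0 addrA.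
rewrite E; apply: forC_add; first apply: forC_add.
- by apply: forC_mul; [exact: for_entry|exact: for_cst].
- by apply: forC_mul; [exact: for_entry|exact: for_cst].
- by apply: forC_mul; [exact: for_entry|exact: for_cst].
Qed.

Lemma for_twist (b : R) (T : topologicalType) (x : T) (f : T -> C) :
  {for x, continuous f} -> {for x, continuous (fun t => twist b (f t))}.
Proof. by move=> fc; apply: for_comp fc _; exact: twist_continuous. Qed.

Lemma for_row3 (T : topologicalType) (x : T) (f g h : T -> C) :
  {for x, continuous f} -> {for x, continuous g} -> {for x, continuous h} ->
  {for x, continuous (fun t => row3 (f t) (g t) (h t))}.
Proof.
move=> fc gc hc; apply: for_row => j.
have E : (fun t => row3 (f t) (g t) (h t) 0 j) = nth h [:: f; g] j.
  by apply/funext => t; rewrite mxE; case: j => [[|[|[|m]]]].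
rewrite E; case: j {E} => [[|[|m]] m3]; [exact: fc|exact: gc|].
rewrite nth_default; last exact: leq0n.
exact: hc.
Qed.

Lemma vec_continuous v : {for v, continuous vec}.
Proof.
have [c1 c2 c3] := @for_coords3 R _ v (fun u : C3 => u) (@cvg_id _ _).
apply: for_mulmx.
have h0 : {for v, continuous (fun u : C3 => untw (u.1.1 / rho))}.
  apply: for_twist; apply: forC_mul; [exact: c1|exact: for_cst].
have h1 : {for v, continuous (fun u : C3 => untw u.1.2)}.
  exact: (@for_twist (- al) _ v (fun u : C3 => u.1.2) c2).
have h2 : {for v, continuous (fun u : C3 => untw u.2)}.
  exact: (@for_twist (- al) _ v (fun u : C3 => u.2) c3).
exact: (for_row3 h0 h1 h2).
Qed.

Lemma unvec_continuous w : {for w, continuous unvec}.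
Proof.
have c : {for w, continuous (fun u : 'rV[C]_3 => u *m invmx P)}.
  by apply: for_mulmx; exact: cvg_id.
have e j : {for w, continuous (fun u : 'rV[C]_3 => tw ((u *m invmx P) 0 j))}.
  have cj := @for_entry _ w C 3 (fun u : 'rV[C]_3 => u *m invmx P) j c.
  exact: (@for_twist al _ w (fun u : 'rV[C]_3 => (u *m invmx P) 0 j) cj).
have e0 : {for w, continuous (fun u : 'rV[C]_3 => rho * tw ((u *m invmx P) 0 o0))}.
  by apply: forC_mul; [exact: for_cst|exact: (e o0)].
exact: for_pair (for_pair e0 (e o1)) (e o2).
Qed.

Lemma near_off v : off v -> \forall u \near v, off u.
Proof.
move=> hv; have [k hk] := off_conics_chart mu_Im ord0 (mu_arg mu_Im mu_sorted) hv.
have h := near_chart mu_Im hk (@cvg_id _ _).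
by apply: filterS h => u; exact: chart_off_conics.
Qed.

Lemma pt_continuous v : off v -> {for v, continuous pt}.
Proof.
move=> hv A /set_type_nbhs [U [/open_P2 [V Vo VU] Uv UA]].
have Vv : V (vec v) by apply/(VU _ _ (coords_pt hv)).
have n1 : \forall u \near v, V (vec u).
  by apply: (@vec_continuous v); exact: open_nbhs_nbhs.
apply: filterS (filterI n1 (near_off hv)) => u [Vu hu].
by apply: UA; apply/(VU _ _ (coords_pt hu)).
Qed.

(** The saturation [V] of an open set under scaling is a union of open sets, so it descends to an
    open set [U] of the projective plane. *)
Lemma pt_open v (Q : X -> Prop) : off v ->
  (\forall u \near v, Q (pt u)) -> \forall x \near pt v, Q x.
Proof.
move=> hv hQ; pose O3 := [set u | off u /\ Q (pt u)]°%classic.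
have O3v : O3 v by exact: filterI (near_off hv) hQ.
pose V (w : 'rV[C]_3) := exists2 c, c != 0 & O3 (unvec (c *: w)).
have Vo : open V.
  have -> : V = \bigcup_(c in [set c : C | c != 0]) ((fun w => unvec (c *: w)) @^-1` O3).
    by apply/seteqP; split=> [w [c c0 h]|w [c c0 h]]; exists c.
  apply: bigcup_open => c _; apply: open_comp; last exact: open_interior.
  move=> w _; apply: (@for_comp _ w _ _ (fun w : 'rV[C]_3 => c *: w) unvec);
    last exact: unvec_continuous.
  apply: for_row => j.
  have E : (fun w : 'rV[C]_3 => (c *: w) 0 j) = fun w => c * w 0 j.
    by apply/funext => u; rewrite mxE.
  rewrite E; apply: forC_mul; first exact: for_cst.
  by apply: for_entry; exact: cvg_id.
pose U (x : P2 R) := exists2 w, coords x w & O3 (unvec w).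
have Uo : open U.
  apply/open_P2; exists V => // x w xw; split=> [[w' /(coords_scale w' xw) [c c0 ->] h]|[c c0 h]].
    by exists c.
  by exists (c *: w) => //; apply/(coords_scale _ xw); exists c.
have Uv : U (\val (pt v)) by exists (vec v); [exact: coords_pt|rewrite vecK].
have := set_type_near Uo Uv; apply: filterS => x [w xw /interior_subset [hw Qw]].
by rewrite -(pt_eq hw (x := x)) ?unvecK.
Qed.

Hypothesis F_quadratic : forall i, quadratic (F i).

Lemma vec_disc k u : vec (disc_point mu al k u) =
  row3 (untw (mu k / rho)) (untw (mu k) * u) 1 *m P.
Proof.
have E : untw (mu k * tw u) = untw (mu k) * u by rewrite twistM twistK.
by rewrite /vec /disc_point /= E twist1.
Qed.

(** On this line the twist of the model and the inverse twist of [vec] cancel, so the disc is a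
    straight one in the given coordinates, as [is_meridian] requires. *)
Lemma vec_disc_line k (d z : C) : vec (disc_point mu al k (1 + z * d)) =
  vec (disc_point mu al k 1) + z *: (row3 0 (untw (mu k) * d) 0 *m P).
Proof.
rewrite !vec_disc scalemxAl -mulmxDl; congr (_ *m _).
by rewrite [RHS]row3E !mxE /= !mulr0 !addr0 mulrDr mulr1 [z * (_ * d)]mulrCA.
Qed.

Lemma disc_transverse k (d : C) : d != 0 ->
  differential (F (sg k)) (vec (disc_point mu al k 1)) (row3 0 (untw (mu k) * d) 0 *m P) != 0.
Proof.
move=> d0; set v := vec _; set w := _ *m P.
have [f1 _ _] := F_quadratic (sg k).
have E : differential (F (sg k)) v w =
    peval (F (sg k)) (v + w) - peval (F (sg k)) v - peval (F (sg k)) w.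
  by rewrite f1; move: (peval _ v) (peval _ w) (differential _ v w) => x y z; ring.
have -> : differential (F (sg k)) v w = a (sg k) * (untw (mu k / rho) * (untw (mu k) * d)).
  rewrite E /v /w vec_disc -mulmxDl !F_eq !mxE /=.
  by ring.
have m0 := mu_neq0 mu_Im.
have h1 : untw (mu k / rho) != 0 by rewrite twist_eq0 mulf_neq0 ?invr_eq0.
have h2 : untw (mu k) != 0 by rewrite twist_eq0.
exact: (mulf_neq0 (a_neq0 _) (mulf_neq0 h1 (mulf_neq0 h2 d0))).
Qed.

Lemma disc_center_locus k j : (peval (F (sg j)) (vec (disc_point mu al k 1)) == 0) = (j == k).
Proof.
rewrite peval_vec_eq0 /disc_point /= twist1 mulr1 expr1n mulr1 -expr2.
have [->|jk] := eqVneq j k; first by rewrite eqxx.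
apply/negbTE/eqP => E; have := mu_ratio_slit mu_Im mu_sorted jk.
by rewrite E mulfV ?slit1// expf_neq0// mu_neq0.
Qed.

(** At the centre exactly one factor vanishes and its differential does not, so by the product rule
    the differential of the product is nonzero. *)
Lemma disc_center_nonsingular k (x : P2 R) : coords x (vec (disc_point mu al k 1)) ->
  ~ singular_point (\prod_j F j) x.
Proof.
set v := vec _ => xv /(_ v xv) [_ h].
have d1 := disc_transverse k (oner_neq0 C).
rewrite -/v mulr1 in d1; set w := _ *m P in d1.
have : differential (\prod_j F j) v w = 0.
  by rewrite /differential big1// => i _; rewrite h mul0r.
rewrite (bigD1 (sg k))//= differentialM.
have -> : peval (F (sg k)) v = 0 by apply/eqP; rewrite disc_center_locus.
rewrite mul0r addr0 => /eqP; rewrite mulf_eq0 (negbTE d1) /= => /eqP.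
have -> : peval (\prod_(j | j != sg k) F j) v = \prod_(j | j != sg k) peval (F j) v.
  exact: (big_morph (fun G => peval G v) (fun G H => pevalM G H v) (mpoly.meval1 _)).
move/eqP; apply/negP; rewrite prodf_seq_neq0; apply/allP => j _; apply/implyP.
by have [i ->] := sg_surj j; rewrite disc_center_locus; apply: contra => /eqP ->.
Qed.

(* The circle first runs outside the unit disc, in the chart Some true, and then
   inside it, in the chart None. *)
Lemma disc_meridian (k : 'I_n) (g : pi1 R x0) :
  (forall (y : X) (p : {path I01 R from y to y in X}) (c : R) r m r' m',
      0 <= c <= 1 ->
      (forall t, 0 <= t <= c -> chart_set mu rep (Some true) (path_real p t)) ->
      (forall t, c <= t <= 1 -> chart_set mu rep None (path_real p t)) ->
      half true r -> half true r' -> sector mu m k -> sector mu m' k.+1 ->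
      y = pt (sector_point r m) -> path_real p c = pt (sector_point r' m') ->
      exists omega : {path I01 R from x0 to y in X},
        g = loop_class (path_cat (path_cat omega p) (path_rev omega))) ->
  is_meridian F (sg k) g.
Proof.
move=> hg; have [b [b0 bpi s1 s2 hnear]] := disc_radius mu_Im mu_sorted al k.
have p0 := pi_gt0 R.
(* [d] is the radius vector of the circle at time 0: with z = e^(2 pi i t), the point 1 + z d runs
   over [circle b]. *)
pose d := cexp (- (2 * b)) - 1; pose D u := disc_point mu al k u.
have circle_near t : near_center mu al k (circle b t) by apply: hnear; rewrite circle_radius.
have circle_off t : off (D (circle b t)) by apply: disc_off => //; exact: circle_neq1.
pose y := pt (D (circle b 0)).
have loop_continuous : continuous (fun t : I01 R => pt (D (circle b (I01_val t)))).
  move=> t; have c1 : {for t, continuous (fun t : I01 R => circle b (I01_val t))}.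
    exact: for_comp (@I01_val_continuous R t) (@circle_continuous R b _).
  have c2 := for_comp c1 (@disc_point_continuous R n' mu al k _).
  exact: for_comp c2 (pt_continuous (circle_off _)).
have e0 : pt (D (circle b (I01_val (zero : I01 R)))) = y by rewrite I01_val0.
have e1 : pt (D (circle b (I01_val (one : I01 R)))) = y by rewrite I01_val1 circle1.
pose delta : {path I01 R from y to y in X} := mk_path loop_continuous e0 e1.
have deltaE t : 0 <= t <= 1 -> path_real delta t = pt (D (circle b t)).
  by move=> /andP[t0 t1]; rewrite /path_real /= /mk_path val_clamp.
pose c : R := 2^-1 + b / pi.
have bp : 0 < b / pi < 2^-1.
  by rewrite divr_gt0//= ltr_pdivrMr// mulrC.
have c01 : 0 <= c <= 1 by rewrite /c; move: bp => /andP[]; lra.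
have half_b : half true (cexp b) by rewrite /= cos_gt0_pihalf//; apply/andP; split; lra.
have half_nb : half true (cexp (- b)) by rewrite /= cosN.
have [omega gE] : exists omega : {path I01 R from x0 to y in X},
    g = loop_class (path_cat (path_cat omega delta) (path_rev omega)).
  (* At time 0 the parameter is e^(-2ib), that is r = e^(ib) and m = e^(-ib) mu_k, in sector k; at
     time [c] it is e^(2ib), in sector k + 1. *)
  apply: (hg y delta c (cexp b) (cexp (- b) * mu k) (cexp (- b)) (cexp b * mu k) c01) => //.
  - move=> t /andP[t0 tc]; rewrite deltaE; last by rewrite t0 (le_trans tc)//; case/andP: c01.
    apply/(chart_set_pt rep_pt) => //; apply: disc_chart_true => //; last exact: circle_neq1.
    by apply: circle_ge1; rewrite ?t0.
  - move=> t /andP[tc t1]; rewrite deltaE; last first.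
      by rewrite t1 andbT (le_trans _ tc)//; case/andP: c01.
    apply/(chart_set_pt rep_pt) => //; apply: disc_chart_none => //; last exact: circle_neq1.
    by apply: circle_le1; rewrite ?tc.
  - by rewrite /y circle0 -mulrN /D disc_sector_point opprK.
  - by rewrite deltaE// circle_mid /D disc_sector_point.
have v0 : vec (D 1) != 0.
  apply/eqP => v0; have := congr1 snd (vecK (D 1)); rewrite v0 /unvec /= mul0mx mxE twist0.
  by move/eqP; rewrite eq_sym oner_eq0.
have [x xv] := coords_point v0.
exists x, (vec (D 1)), (row3 0 (untw (mu k) * d) 0 *m P), y, omega, delta; split.
- split; last exact: disc_center_nonsingular xv.
  move=> w /(coords_scale w xv) [e _ ->]; rewrite pevalZ2.
  have /eqP -> : peval (F (sg k)) (vec (D 1)) == 0 by rewrite disc_center_locus.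
  by rewrite mulr0.
- split=> //; apply: disc_transverse.
  by have := circle_neq1 0 b0 bpi; rewrite circle0 subr_eq0.
- move=> z x' z1; rewrite -vec_disc_line -/(D _) => x'u x'F.
  have hz : near_center mu al k (1 + z * d).
    apply: hnear; rewrite addrAC subrr add0r cabsM ler_piMl ?cabs_ge0//.
    by move: z1; rewrite normr_cabs lecR.
  have [E|un] := eqVneq (1 + z * d) 1; first by rewrite E in x'u; exact: (coords_inj x'u xv).
  have [i /eqP] := (union_curveP x'u).1 x'F.
  have := (off_vec _).1 (disc_off mu_Im hz un) i; by move=> /negbTE ->.
- move=> t; rewrite -vec_disc_line.
  exact: (coords_pt (circle_off _)).
- exact: gE.
Qed.

End Coordinates.

(** The conjugating loop is absorbed in the path [omega]. *)
Lemma is_meridian_conj (R : realType) (n : nat) (F : 'I_n -> mpoly.mpoly 3 R[i])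
    (i : 'I_n) (x0 : ~` union_curve F) (g h : pi1 R x0) :
  is_meridian F i g -> is_meridian F i (h * g * h^-1)%g.
Proof.
move=> [p [v [w [y [omega [delta [h1 h2 h3 h4 ->]]]]]]]; have [q ->] := loop_classP h.
exists p, v, w, y, (path_cat q omega), delta; split=> //.
rewrite pi1_inv_class !pi1_mul_class; symmetry; apply: loop_class_div.
apply: path_homotopic_trans (path_catA _ _ _) _.
apply: path_homotopic_trans (path_cat_homotopicl _ (path_catVKr _ _)) _.
apply: path_homotopic_trans (path_homotopic_sym (path_catA _ _ _)) _.
apply: path_homotopic_trans (path_cat_homotopicr _ (path_catVKr _ _)) _.
exact: path_catA.
Qed.

Theorem theorem5 (R : realType) (n : nat) (n_ge1 : (1 <= n)%N)
    (F : 'I_n -> mpoly.mpoly 3 R[i])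
    (F_quadric : forall i, smooth_curve 2 (F i))
    (F_distinct : injective (fun i => zero_locus (F i)))
    (p q : P2 R) (pq_distinct : p != q)
    (p_common : forall i, zero_locus (F i) p)
    (q_common : forall i, zero_locus (F i) q)
    (p_tangent : forall i j, i != j -> tangent_at (F i) (F j) p)
    (q_tangent : forall i j, i != j -> tangent_at (F i) (F j) q)
    (x0 : ~` union_curve F) :
  exists a : 'I_n -> pi1 R x0,
    [/\ forall i, is_meridian F i (a i),
        forall g, exists w : word 'I_n, g = word_val a w &
        exists phi :
          {multiplicative presented [set product_word n ++ product_word n]
            -> pi1 R x0},
          bijective phi /\ forall i, phi (presented_gen _ i) = a i].
Proof.
case: n n_ge1 F F_quadric F_distinct p_common q_common p_tangent q_tangent x0 => [//|n'].
move=> n_ge1 F F_quadric F_distinct p_common q_common p_tangent q_tangent x0.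
have F_quadratic i : quadratic (F i).
  by have [hF _ _] := F_quadric i; exact: homogeneous_quadratic.
have [P [lam [c [P_unit lam0 c0 lam_inj F_eq]]]] := bitangent_normal_form n_ge1 F_quadric
  F_distinct pq_distinct p_common q_common p_tangent q_tangent.
have [al [rho [sg [mu [sg_inj rho0 mu_Im mu_sorted mu_sqr]]]]] := generic_twist lam0 lam_inj.
pose ptx := pt P_unit c0 F_eq sg_inj rho0 mu_sqr x0.
pose repx := @rep R n' F P al rho.
have rep_offx x : off_conics mu (repx x) by exact: (rep_off P_unit c0 F_eq sg_inj rho0 mu_sqr).
have repKx x : ptx (repx x) = x by exact: repK.
have pt_scalex e v : e != 0 -> off_conics mu v -> ptx (scale3 e v) = ptx v by exact: pt_scale.
have rep_ptx v : off_conics mu v -> exists2 e, e != 0 & repx (ptx v) = scale3 e v.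
  exact: rep_pt.
have pt_contx v : off_conics mu v -> {for v, continuous ptx} by exact: pt_continuous.
have pt_openx v (Q : ~` union_curve F -> Prop) : off_conics mu v ->
    (\forall u \near v, Q (ptx u)) -> \forall x \near ptx v, Q x by exact: pt_open.
have [g [g_rel g_gen g_univ g_mer]] := crossing_presentation mu_Im mu_sorted
  rep_offx repKx pt_scalex rep_ptx pt_contx pt_openx x0.
have g_meridian k : is_meridian F (sg k) (g k).
  exact: (disc_meridian mu_Im mu_sorted F_quadratic (g_mer k)).
have prod_sg (G : groupType) (b : 'I_n'.+1 -> G) :
    (\prod_(i <- map sg (enum 'I_n'.+1)) b i = \prod_(i <- enum 'I_n'.+1) b (sg i))%g.
  by rewrite big_map.
(* The crossings follow the order of the arguments, which in terms of the given indices is the list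
   [map sg]. *)
have sg_basis : has_square_basis (fun i (h : pi1 R x0) => is_meridian F i h)
    (map sg (enum 'I_n'.+1)).
  split; first by rewrite map_inj_uniq// enum_uniq.
  exists (fun i => g (invF sg_inj i)); last first.
    by move=> i; have := g_meridian (invF sg_inj i); rewrite f_invF.
  have E k : g (invF sg_inj (sg k)) = g k by rewrite invF_f.
  split.
  - by rewrite prod_sg (eq_bigr _ (fun k _ => E k)).
  - by move=> S S1 SM SV Sg; apply: g_gen => // i; rewrite -E.
  - move=> G b; rewrite prod_sg => /g_univ[psi psiM psig]; exists psi => // i.
    by rewrite psig f_invF.
have perm_sg : perm_eq (map sg (enum 'I_n'.+1)) (enum 'I_n'.+1).
  have u : uniq (map sg (enum 'I_n'.+1)) by rewrite map_inj_uniq// enum_uniq.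
  apply: (uniq_perm u (enum_uniq _)) => i.
  by rewrite mem_enum -{1}(f_invF sg_inj i) map_f// mem_enum.
have [_ [a a_basis a_meridian]] := has_square_basis_perm
  (fun i h k => @is_meridian_conj _ _ _ i _ h k) perm_sg sg_basis.
have [a_words a_presented] := square_basis_presented a_basis.
by exists a; split.
Qed.
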